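(* Let $b\ge2$ be a fixed integer. There exist values $\sigma_0<\sigma_1<\cdots$ with $\lim_{k\to\infty}\sigma_k=\sigma_{\mathrm{crit}}=\frac{b+1}{b-1}\log b$ such that, as $n\to\infty$: (a) for each fixed $k\ge0$, $\lambda=\sigma_kn$ is a sharp threshold for both $C_k$ and $D_k$: for $\lambda=\sigma n$ with $\sigma$ fixed, $C_k$ and $D_k$ each hold with probability $1-o(1)$ if $\sigma<\sigma_k$, and each fail with probability $1-o(1)$ if $\sigma>\sigma_k$; (b) $\lambda=\sigma_{\mathrm{crit}}n$ is a sharp threshold for connectedness of $G^\bullet_n(\lambda)$: for $\lambda=\sigma n$ with $\sigma$ fixed, $G_n^\bullet(\lambda)$ is disconnected with probability $1-o(1)$ if $\sigma<\sigma_{\mathrm{crit}}$ and connected with probability $1-o(1)$ if $\sigma>\sigma_{\mathrm{crit}}$. Further, for each fixed $k\geq 0$, if $\lambda=\sigma_kn$ then $\mathbb{P}(D_k)$ and $\mathbb{P}(C_k)$ are bounded away from $0$ and $1$ as $n\to\infty$.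
   Context: $\log$ is the natural logarithm. Trees: $T_0$ is a single vertex; $T_{h+1}$ is obtained from $T_h$ by adding $b-1$ further disjoint copies of $T_h$ and a new vertex (the apex of $T_{h+1}$) joined to the apex of each of the $b$ copies of $T_h$ (the apex of $T_0$ being its only vertex). So $T_n$ is the complete $b$-ary tree of height $n$, with set of leaves $L_n$, $|L_n|=b^n$. The height of a vertex is its distance to the nearest leaf. The parent of a vertex is its unique higher neighbour; descendants/ancestors are defined accordingly (each vertex is a descendant of itself). Poisson particle model $G^\bullet_n(\lambda)$: a random multigraph with vertex set $L_n$. At each $v\in L_n$ start a number of particles, these numbers being i.i.d. with distribution $\mathrm{Po}(\lambda/2)$ (Poisson with mean $\lambda/2$). The particles perform independent simple random walks on $T_n$, each stopped at its first return to $L_n$. For each particle put an edge connecting its starting leaf to the leaf where it stopped. $D_k$ is the event that there is some vertex $v\in T_n$ at height $k$ such that the set of leaves which are descendants of $v$ has no edges of $G^\bullet_n(\lambda)$ to the remaining leaves. $C_k$ is the event that $G^\bullet_n(\lambda)$ has some component all of whose vertices have a common ancestor at height $k$ (not necessarily their lowest common ancestor). *)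

(* Defs.v *)
From HB Require Import structures.
From mathcomp Require Import all_boot all_order all_algebra.
From mathcomp Require Import all_classical all_reals all_analysis.
Import Order.TTheory GRing.Theory Num.Theory.
Import numFieldNormedType.Exports.

Set Implicit Arguments.
Unset Strict Implicit.
Unset Printing Implicit Defensive.

Local Open Scope classical_set_scope.
Local Open Scope ring_scope.

Section Tree.
Variables b n : nat.

(* The complete b-ary tree of height n: a vertex is a word of length at most n
   over 'I_b, the apex is the empty word, and the b children of a non-leaf u
   are the words [rcons u i].  The first letter of a nonempty word says which
   of the b copies of the tree of height n - 1 the vertex lies in. *)
Definition vertex : finType := n.-bseq 'I_b.

Implicit Types u v w : vertex.

Definition is_parent u v := [exists i : 'I_b, val v == rcons u i].

Definition adj u v := is_parent u v || is_parent v u.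

Definition degree u := #|[set v | adj u v]%SET|.

(* All leaves lie at depth n, so this is the distance to the nearest leaf. *)
Definition height v := (n - size v)%N.

Definition is_leaf v := height v == 0%N.

Definition leaf : finType := {v : vertex | is_leaf v}.

(* u is an ancestor of v; in particular every vertex is its own ancestor. *)
Definition ancestor u v := prefix u v.

(* A trajectory of a particle started at v is recorded as the sequence
   [:: X_1; ...; X_t] of its later positions (X_0 = v being left out).
   [stopped v p] says that t = size p is the time of first return to the
   leaves. *)
Definition stopped v (p : seq vertex) :=
  [&& p != [::], is_leaf (last v p)
    & all (fun u => ~~ is_leaf u) (behead (belast v p))].

(* An outcome: for each leaf x, the trajectories of the particles started
   at x. *)
Definition outcome : choiceType := {ffun leaf -> seq (seq vertex)}.

(* Adjacency in the multigraph of an outcome: a particle started at x and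
   ending at y, or vice versa.  Multiplicities and loops do not matter for
   the events below. *)
Definition edge (o : outcome) (x y : leaf) :=
  has (fun p => last (val x) p == val y) (o x)
  || has (fun p => last (val y) p == val x) (o y).

Definition component (o : outcome) (x : leaf) : {set leaf} :=
  [set y | connect (edge o) x y]%SET.

Definition evD (k : nat) : set outcome :=
  [set o | exists v : vertex, height v = k /\
     forall x y : leaf, ancestor v (val x) -> ~~ ancestor v (val y) ->
       ~~ edge o x y].

Definition evC (k : nat) : set outcome :=
  [set o | exists (x : leaf) (v : vertex), height v = k /\
     forall y : leaf, y \in component o x -> ancestor v (val y)].

Definition ev_connected : set outcome :=
  [set o | forall x y : leaf, connect (edge o) x y].

Variable R : realType.

Definition srw_step u v : R := if adj u v then (degree u)%:R^-1 else 0.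

(* The probability that a walk started at v follows p and is stopped at its
   last vertex. *)
Definition walk_weight v (p : seq vertex) : R :=
  if stopped v p then \prod_(s <- zip (v :: p) p) srw_step s.1 s.2 else 0.

(* [poisson_pmf 0] is constantly 1, so the degenerate law Po(0) is treated
   apart. *)
Definition Po (mu : R) (m : nat) : R :=
  if mu == 0 then (m == 0%N)%:R else poisson_pmf mu m.

(* The law of the Poisson particle model: independent Po(lambda / 2) numbers
   of particles, and independent stopped walks.  For fixed m the particles
   started at a leaf are listed in order, so no symmetry factor occurs. *)
Definition outcome_weight (lambda : R) (o : outcome) : R :=
  \prod_(x : leaf)
    (Po (lambda / 2) (size (o x)) * \prod_(p <- o x) walk_weight (val x) p).

(* There are only countably many outcomes, so this is the discrete law with the
   above weights; walks that never return to the leaves have probability 0. *)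
Definition Pr (lambda : R) (E : set outcome) : \bar R :=
  (\esum_(o in E) (outcome_weight lambda o)%:E)%E.

End Tree.

Arguments evD b n k : clear implicits.
Arguments evC b n k : clear implicits.
Arguments ev_connected b n : clear implicits.
Arguments Pr b n {R} lambda E.

Definition sigma_crit (R : realType) (b : nat) : R :=
  (b%:R + 1) / (b%:R - 1) * ln b%:R.

(* With probability 1 - o(1) as n tends to infinity, at lambda = s n. *)
Definition whp (R : realType) (b : nat) (s : R)
    (E : forall n, set (outcome b n)) : Prop :=
  Pr b n (s * n%:R) (E n) @[n --> \oo] --> 1%E.

Definition bounded_away (R : realType) (b : nat) (s : R)
    (E : forall n, set (outcome b n)) : Prop :=
  exists c : R, 0 < c /\
    \forall n \near \oo,
      (c%:E <= Pr b n (s * n%:R) (E n) <= (1 - c)%:E)%E.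

(* Main.v *)
(** The stopped walk from a leaf is diagonalised by the tree: the functions that
    are constant on the leaves below each child of a vertex of height [h], with
    mean zero, are eigenfunctions of eigenvalue [1 - (b-1)/(b^h-1)].  Hence the
    mean number of edges leaving a set [S] of leaves is [lambda] times the energy
    of [S], a sum over the inner vertices of
    [kappa_h * sum_i (a_i - a)^2], where [a] and the [a_i] are the densities of
    [S] below the vertex and its children and
    [kappa_h = (b-1) b^(h-1) / (b^h-1)].  For the leaves below a vertex of height
    [k] the energy tends to a constant [c_k], and [sigma_k = log b / c_k].

    Thinning makes the edges leaving [S] Poisson, so the isolated subtrees of
    height [k] are handled by first and second moments; at the threshold,
    splitting the tree at the apex into two independent parts bounds the
    probability that there is one away from 1.  Among the nonempty sets below a
    vertex of height [k] the full one strictly minimises the energy, so that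
    [C_k] has asymptotically the probability of [D_k].

    For connectedness all sets [S] of density at most 1/2 are summed.  With the
    [kappa_h] lowered to their limit, the energy of [S] in an empty surrounding
    is [Q(S) + q a^2 >= q], [q = b/(b+1)], and the weights
    [a exp(-T (Q(S) + q a^2 - q))] satisfy a recursion in the height in which
    passing to a parent with one occupied child is exactly neutral, while two or
    more occupied children cost an exponentially small factor.  Their sum
    therefore grows linearly in the height. *)
Require Import Defs.
From HB Require Import structures.
From mathcomp Require Import all_boot all_order all_algebra.
From mathcomp Require Import all_classical all_reals all_analysis.
From mathcomp Require Import ring lra zify.
Import Order.TTheory GRing.Theory Num.Theory.
Import numFieldNormedType.Exports.
Local Open Scope classical_set_scope.
Local Open Scope ring_scope.

Set Implicit Arguments.
Unset Strict Implicit.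
Unset Printing Implicit Defensive.

(** * Harmonic extension and energy on the tree *)

(** All three events depend only on the set of endpoints reached from each leaf. With Poisson
    numbers of particles, the event that no edge leaves a given set of leaves is a product event
    with an exact exponential probability, so the probabilistic content reduces to deterministic
    bounds on energies.

    The obstacle is connectedness down to the critical value. There are 2^(b^n) sets of leaves,
    while a subtree of bounded height is isolated with a probability only exponentially small in n.
    A union bound that groups sets by size is hopeless, and the energy must be used at all scales at
    once. The density factor in the weights serves this purpose: moving one step up multiplies the
    positions of a sparse set by b and divides its density by b.

    Since lambda is linear in n, energies must be known up to o(1/n). The corrections due to the
    finite height and to the apex are of order b^(-n), so the estimates survive at the thresholds
    themselves and not only away from them. *)

Section Words.
Variables (R : realType) (b : nat).
Hypothesis hb : (2 <= b)%N.

Local Notation word := (seq 'I_b).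
Local Notation B := (b%:R : R).

Implicit Types (f g : word -> R) (u w x y : word).

Lemma B_ge2 : 2 <= B. Proof. by rewrite ler_nat. Qed.
Lemma B_gt1 : 1 < B. Proof. by rewrite ltr1n. Qed.
Lemma B_gt0 : 0 < B. Proof. by rewrite ltr0n; lia. Qed.
Lemma B_neq0 : B != 0. Proof. by rewrite gt_eqF// B_gt0. Qed.
Lemma Bexp_gt0 n : 0 < B ^+ n. Proof. by rewrite exprn_gt0// B_gt0. Qed.
Lemma Bexp_neq0 n : B ^+ n != 0. Proof. by rewrite gt_eqF// Bexp_gt0. Qed.
Lemma BexpS_gt1 n : 1 < B ^+ n.+1. Proof. by rewrite exprn_egt1// B_gt1. Qed.
Lemma BexpS1_neq0 n : B ^+ n.+1 - 1 != 0.
Proof. by rewrite subr_eq0 gt_eqF// BexpS_gt1. Qed.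

Definition pre i f : word -> R := fun w => f (i :: w).

Fixpoint wsum n f : R :=
  if n is n'.+1 then \sum_(i < b) wsum n' (pre i f) else f [::].

Definition mean n f : R := wsum n f / B ^+ n.

Lemma eq_wsum n f g : (forall w, size w = n -> f w = g w) -> wsum n f = wsum n g.
Proof.
elim: n f g => [|n IH] f g fg /=; first exact: fg.
by apply: eq_bigr => i _; apply: IH => w sw; apply: fg; rewrite /= sw.
Qed.

Lemma wsumD n f g : wsum n (fun w => f w + g w) = wsum n f + wsum n g.
Proof.
elim: n f g => [//|n IH] f g /=; rewrite -big_split /=.
by apply: eq_bigr => i _; rewrite -IH.
Qed.

Lemma wsumZ n c f : wsum n (fun w => c * f w) = c * wsum n f.
Proof.
elim: n f => [//|n IH] f /=; rewrite mulr_sumr.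
by apply: eq_bigr => i _; rewrite -IH.
Qed.

Lemma wsumB n f g : wsum n (fun w => f w - g w) = wsum n f - wsum n g.
Proof.
rewrite -[- wsum n g]mulN1r -wsumZ -wsumD.
by apply: eq_wsum => w _; rewrite mulN1r.
Qed.

Lemma wsum_cst n c : wsum n (fun=> c) = B ^+ n * c.
Proof.
elim: n => [|n IH] /=; first by rewrite expr0 mul1r.
under eq_bigr do rewrite /pre IH.
by rewrite sumr_const card_ord exprS -mulrA mulr_natl.
Qed.

Lemma wsum0 n : wsum n (fun=> 0) = 0. Proof. by rewrite wsum_cst mulr0. Qed.

Lemma le_wsum n f g : (forall w, size w = n -> f w <= g w) -> wsum n f <= wsum n g.
Proof.
elim: n f g => [|n IH] f g fg /=; first exact: fg.
by apply: ler_sum => i _; apply: IH => w sw; apply: fg; rewrite /= sw.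
Qed.

Lemma wsum_ge0 n f : (forall w, size w = n -> 0 <= f w) -> 0 <= wsum n f.
Proof. by move=> f0; rewrite -(wsum0 n); apply: le_wsum. Qed.

Lemma meanS n f : mean n.+1 f = (\sum_(i < b) mean n (pre i f)) / B.
Proof.
by rewrite /mean /= -mulr_suml exprSr invfM mulrA.
Qed.

Lemma sum_mean n f : \sum_(i < b) mean n (pre i f) = B * mean n.+1 f.
Proof. by rewrite meanS mulrC divfK// B_neq0. Qed.

Lemma eq_mean n f g : (forall w, size w = n -> f w = g w) -> mean n f = mean n g.
Proof. by move=> fg; rewrite /mean (eq_wsum fg). Qed.

Lemma wsum_mean n f : wsum n f = B ^+ n * mean n f.
Proof. by rewrite mulrC divfK// Bexp_neq0. Qed.

Fixpoint words n : seq word :=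
  if n is n'.+1 then flatten [seq [seq i :: w | w <- words n'] | i <- enum 'I_b]
  else [:: [::]].

Lemma mem_words n w : (w \in words n) = (size w == n).
Proof.
elim: n w => [|n IH] [|i w] //=.
  by apply/flatten_mapP => -[j _ /mapP[]].
apply/flatten_mapP/idP => [[j _ /mapP[w' + [_ ->]]]|].
  by rewrite IH eqSS.
by rewrite eqSS -IH => ww; exists i; rewrite ?mem_enum//; apply: map_f.
Qed.

Lemma uniq_words n : uniq (words n).
Proof.
elim: n => [//|n IH] /=; apply/allpairs_uniq_dep.
- exact: enum_uniq.
- by move=> i _.
- by move=> [i w] [j w'] /= _ _ [-> ->].
Qed.

Lemma wsum_words n f : wsum n f = \sum_(w <- words n) f w.
Proof.
elim: n f => [|n IH] f /=; first by rewrite big_seq1.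
rewrite big_flatten big_map /= big_enum /=.
by apply: eq_bigr => i _; rewrite big_map IH.
Qed.

Lemma big_words (T : finType) (P : pred T) (h : T -> word) n f :
  injective h -> (forall t, P t -> size (h t) = n) ->
  (forall w, size w = n -> exists2 t, P t & h t = w) ->
  \sum_(t | P t) f (h t) = wsum n f.
Proof.
move=> hi hP hS; rewrite wsum_words -big_filter -(big_map h xpredT); apply: perm_big.
apply: uniq_perm => [||w].
- by rewrite map_inj_uniq// filter_uniq// index_enum_uniq.
- exact: uniq_words.
rewrite mem_words; apply/mapP/eqP => [[t]|/hS[t Pt <-]].
  by rewrite mem_filter => /andP[/hP sz _ ->].
by exists t => //; rewrite mem_filter Pt mem_index_enum.
Qed.

(** Gambler's ruin for the height of the walk: [rho h j] is the probability of reaching the apex of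
    a tree of height [h] from height [j] before the leaves, and [mu h] is the case of a particle
    that has just left its leaf. After such a visit the endpoint is uniform over the whole tree
    instead of over one copy, whence the differences of means in [hext] and [hop]. *)
Definition mu h : R := (B - 1) / (B ^+ h - 1).
Definition rho h j : R := (B ^+ j - 1) / (B ^+ h - 1).

(* Shifted index: [kap h] is kappa_(h+1), which belongs to height [h.+1]. *)
Definition kap h : R := mu h.+1 * B ^+ h.

(* The harmonic function on the tree of height [n] with boundary values [f] on
   the words of length [n]. *)
Fixpoint hext n f u : R :=
  match n, u with
  | n'.+1, i :: u' =>
      hext n' (pre i f) u' + rho n (n' - size u') * (mean n f - mean n' (pre i f))
  | _, _ => mean n f
  end.

Fixpoint hop n f x : R :=
  match n, x with
  | n'.+1, i :: x' =>
      hop n' (pre i f) x' + mu n * (mean n f - mean n' (pre i f))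
  | _, _ => f x
  end.

(* [hop] is the expectation of [f] at the end of a walk from [x], and [hker] is
   the law of that end: see [walk_esum] and [hop_ker]. *)
Fixpoint hker n x y : R :=
  match n, x, y with
  | n'.+1, i :: x', j :: y' =>
      (if i == j then hker n' x' y' - mu n / B ^+ n' else 0) + mu n / B ^+ n
  | _, _, _ => 1
  end.

Fixpoint energy n f : R :=
  if n is n'.+1 then
    \sum_(i < b) energy n' (pre i f)
    + kap n' * \sum_(i < b) (mean n' (pre i f) - mean n f) ^+ 2
  else 0.

Lemma eq_energy n f g : (forall w, size w = n -> f w = g w) ->
  energy n f = energy n g.
Proof.
elim: n f g => [//|n IH] f g fg /=.
have pfg i w : size w = n -> pre i f w = pre i g w.
  by move=> sw; apply: fg; rewrite /= sw.
rewrite (eq_mean fg); congr (_ + _ * _); apply: eq_bigr => i _.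
  by apply: IH => w; exact: pfg.
by rewrite (@eq_mean n _ (pre i g))// => w; exact: pfg.
Qed.

Lemma hext_nil n f : hext n f [::] = mean n f. Proof. by case: n. Qed.

Lemma hext_leaf n f w : size w = n -> hext n f w = f w.
Proof.
elim: n f w => [|n IH] f [|i w] //=; first by rewrite /mean /= expr0 divr1.
by move=> [sw]; rewrite IH// sw subnn /rho expr0 subrr !mul0r addr0.
Qed.

Lemma mu1 : mu 1 = 1.
Proof. by rewrite /mu expr1 divff// -[B]expr1 BexpS1_neq0. Qed.

Lemma rhoh1 h : rho h 1 = mu h. Proof. by rewrite /rho expr1. Qed.

(** The first step from a leaf leads to its parent with certainty, and there [rho] is taken at
    height 1, where it equals [mu]. *)
Lemma hop_hext n f u i : size u = n -> hop n.+1 f (rcons u i) = hext n.+1 f u.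
Proof.
elim: n f u => [|n IH] f [|j u] //.
  move=> _ /=; rewrite mu1 mul1r addrC /mean /pre /= expr0 divr1 subrK//.
move=> [su].
have -> : hop n.+2 f (rcons (j :: u) i) = hop n.+1 (pre j f) (rcons u i)
    + mu n.+2 * (mean n.+2 f - mean n.+1 (pre j f)) by [].
rewrite IH// -rhoh1.
have -> : hext n.+2 f (j :: u) = hext n.+1 (pre j f) u
    + rho n.+2 (n.+1 - size u) * (mean n.+2 f - mean n.+1 (pre j f)) by [].
by rewrite su subSnn.
Qed.

Lemma rho_harm h j :
  B * rho h j + rho h j.+2 = (B + 1) * rho h j.+1.
Proof.
rewrite /rho !mulrA -!mulrDl; congr (_ / _); rewrite !exprS; ring.
Qed.

Lemma rhohh h : rho h.+1 h.+1 = 1.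
Proof. by rewrite /rho divff// BexpS1_neq0. Qed.

Lemma hext_harm_root n f : \sum_(i < b) hext n.+1 f [:: i] = B * hext n.+1 f [::].
Proof.
rewrite /=.
under eq_bigr => i _ do rewrite hext_nil.
rewrite big_split /= -mulr_sumr sumrB sumr_const card_ord !sum_mean mulr_natl.
by rewrite subrr mulr0 addr0.
Qed.

Lemma hext_harm n f u j : ((size u).+1 < n)%N ->
  \sum_(i < b) hext n f (rcons (rcons u j) i) + hext n f u =
  (B + 1) * hext n f (rcons u j).
Proof.
elim: u n f => [|k u IH] [//|n] f; rewrite ltnS => su.
  (* For a child of the apex the upper neighbour is the apex itself; by [rhohh] its value fits the
     pattern of the correction term with factor 1. *)
  case: n su => [//|n] _.
  rewrite (_ : rcons [::] j = [:: j])// [hext _ _ [::]]hext_nil.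
  rewrite (eq_bigr (fun i => hext n.+1 (pre j f) [:: i]
     + rho n.+2 n * (mean n.+2 f - mean n.+1 (pre j f)))); last first.
    by move=> i _ /=; rewrite subn1.
  rewrite big_split /= -[X in X + _ + _]/(\sum_(i < b) hext n.+1 (pre j f) [:: i]).
  rewrite hext_harm_root hext_nil sumr_const card_ord -mulr_natl.
  have := rho_harm n.+2 n; rewrite rhohh ?hext_nil ?subn0.
  set r0 := rho _ n; set r1 := rho _ n.+1 => e.
  set m := mean n.+2 f; set m1 := mean n.+1 _.
  apply/eqP; rewrite -subr_eq0; apply/eqP.
  transitivity ((B * r0 + 1 - (B + 1) * r1) * (m - m1)); first by ring.
  by rewrite e subrr mul0r.
rewrite [rcons (k :: u) j]/=.
rewrite (eq_bigr (fun i => hext n (pre k f) (rcons (rcons u j) i)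
     + rho n.+1 (n - (size u).+2) * (mean n.+1 f - mean n (pre k f)))); last first.
  by move=> i _ /=; rewrite !size_rcons.
rewrite big_split /= sumr_const card_ord -mulr_natl size_rcons.
have {}su : ((size u).+1 < n)%N := su.
have := IH n (pre k f) su.
have -> : (n - size u = (n - (size u).+2).+2)%N by lia.
have -> : (n - (size u).+1 = (n - (size u).+2).+1)%N by lia.
have := rho_harm n.+1 (n - (size u).+2).
set r0 := rho _ _; set r2 := rho _ _.+2; set r1 := rho _ _.+1.
set S := \sum_(i < b) _; set D := mean n.+1 f - _.
set h1 := hext n _ (rcons u j); set h0 := hext n _ u => e1 e2.
apply/eqP; rewrite -subr_eq0; apply/eqP.
transitivity ((S + h0 - (B + 1) * h1) + (B * r0 + r2 - (B + 1) * r1) * D).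
  by ring.
by rewrite e1 e2 !subrr mul0r addr0.
Qed.

Lemma hop_ker n f x : size x = n -> hop n f x = wsum n (fun y => hker n x y * f y).
Proof.
elim: n f x => [|n IH] f [|i x] //=; first by rewrite mul1r.
move=> [sx]; rewrite IH//.
rewrite (eq_bigr (fun j => (if i == j then
   wsum n (fun y => hker n x y * pre i f y) - mu n.+1 * mean n (pre i f) else 0)
   + mu n.+1 / B ^+ n.+1 * wsum n (pre j f))); last first.
  move=> j _; rewrite -wsumZ; case: (eqVneq i j) => [->|ij].
    have -> : mu n.+1 * mean n (pre j f)
        = wsum n (fun y => mu n.+1 / B ^+ n * pre j f y).
      by rewrite wsumZ /mean; ring.
    rewrite -wsumB -wsumD; apply: eq_wsum => y _; rewrite /pre /= eqxx; ring.
  rewrite add0r; apply: eq_wsum => y _.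
  by rewrite /pre /= (negPf ij) add0r.
rewrite big_split /= -big_mkcond/= (big_pred1 i) => [|j]; last by rewrite eq_sym.
by rewrite -mulr_sumr /mean /=; ring.
Qed.

Lemma hker_sym n x y : hker n x y = hker n y x.
Proof.
by elim: n x y => [|n IH] [|i x] [|j y] //=; rewrite eq_sym IH; case: eqP.
Qed.

Lemma hop1 n x : hop n (fun=> 1) x = 1.
Proof.
elim: n x => [|n IH] [|i x] //=; rewrite IH /mean.
have -> : pre i (fun=> 1 : R) = fun=> 1 by [].
by rewrite !wsum_cst !mulr1 !divff ?Bexp_neq0// subrr mulr0 addr0.
Qed.

Lemma hker_sum1 n x : size x = n -> wsum n (hker n x) = 1.
Proof.
move=> sx; rewrite -(hop1 n x) hop_ker//.
by apply: eq_wsum => y _; rewrite mulr1.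
Qed.

Lemma var_mean n f :
  \sum_(i < b) (mean n (pre i f) - mean n.+1 f) ^+ 2 =
  \sum_(i < b) mean n (pre i f) ^+ 2 - B * mean n.+1 f ^+ 2.
Proof.
rewrite (eq_bigr (fun i => mean n (pre i f) ^+ 2
  + (mean n.+1 f ^+ 2 - 2 * mean n.+1 f * mean n (pre i f)))); last first.
  by move=> i _; ring.
rewrite big_split /= sumrB sumr_const card_ord -mulr_sumr sum_mean -mulr_natl.
ring.
Qed.

(** The quadratic form of the identity minus the walk. Each level changes [hop] by a function
    constant on the copies, so its contribution involves the means of the children only and
    collapses to their variance. *)
Lemma energy_hop n f : wsum n (fun x => f x * (f x - hop n f x)) = energy n f.
Proof.
elim: n f => [|n IH] f /=; first by rewrite subrr mulr0.
rewrite var_mean.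
rewrite (eq_bigr (fun i => energy n (pre i f)
   + kap n * (mean n (pre i f) ^+ 2 - mean n.+1 f * mean n (pre i f)))).
  rewrite big_split /= -mulr_sumr sumrB -mulr_sumr sum_mean; ring.
move=> i _; rewrite -IH.
rewrite (@eq_wsum _ _ (fun x => pre i f x * (pre i f x - hop n (pre i f) x) +
   mu n.+1 * (mean n (pre i f) - mean n.+1 f) * pre i f x)); last first.
  by move=> w _; rewrite /pre /=; ring.
rewrite wsumD wsumZ [wsum n (pre i f)]wsum_mean /kap; ring.
Qed.

End Words.

(** * Sums over words, Poisson sequences and finite products *)

Section Esum.
Variable R : realType.

Lemma esum_fin (I : finType) (a : I -> \bar R) : (forall i, 0%E <= a i)%E ->
  (\esum_(i in [set: I]) a i = \sum_i a i)%E.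
Proof.
move=> a0; rewrite esum_fset//; last exact: finite_finset.
rewrite fsbig_finite; last exact: finite_finset.
apply: perm_big.
apply: uniq_perm; rewrite ?finmap.fset_uniq ?index_enum_uniq// => i.
by rewrite in_fset_set ?mem_index_enum ?in_setT//; exact: finite_finset.
Qed.

Lemma esum_fibers (T J : choiceType) (phi : T -> J) (D : set T) (a : T -> \bar R) :
  (forall x, 0%E <= a x)%E ->
  (\esum_(x in D) a x
   = \esum_(j in [set: J]) \esum_(x in D `&` [set x | phi x = j]) a x)%E.
Proof.
move=> a0; rewrite esum_esum//.
apply/esym; apply: (reindex_esum D _ (fun x => (phi x, x)) (fun k => a k.2)).
split => [x Dx|x y _ _ [_ ->]//|[j x] /= [_ [Dx <-]]]; first by split.
by exists x.
Qed.

Lemma esumZ (T : choiceType) (D : set T) (a : T -> \bar R) (c : R) :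
  (forall x, 0%E <= a x)%E -> 0 <= c ->
  (\esum_(x in D) (c%:E * a x) = c%:E * \esum_(x in D) a x)%E.
Proof.
move=> a0.
have H d (f : T -> \bar R) : (forall x, 0%E <= f x)%E -> 0 <= d ->
    (\esum_(x in D) (d%:E * f x) <= d%:E * \esum_(x in D) f x)%E.
  move=> f0 d0; apply: ge_ereal_sup => _ [A [fA AD] <-].
  rewrite -ge0_mule_fsumr//; apply: lee_wpmul2l; first by rewrite lee_fin.
  by apply: ereal_sup_ubound; exists A.
rewrite le_eqVlt => /predU1P[<-|c0].
  by rewrite mul0e; apply: esum1 => x _; rewrite mul0e.
apply/eqP; rewrite eq_le H ?(ltW c0)//=.
(* The opposite inequality is [H] again, for the inverse scalar and the scaled family. *)
have := H c^-1 (fun x => c%:E * a x)%E.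
rewrite invr_ge0 (ltW c0) => /(_ _ isT) h.
rewrite -(@lee_pmul2l _ c^-1%:E) ?fin_numE// ?lte_fin ?invr_gt0//.
rewrite muleA -EFinM mulVf ?gt_eqF// mul1e.
apply: le_trans (h (fun x => mule_ge0 (ltW (_ : 0 < c%:E)%E) (a0 x))) => //.
apply: le_esum => x _.
by rewrite muleA -EFinM mulVf ?gt_eqF// mul1e.
Qed.

Lemma esum_size_cons (T : choiceType) m (a : seq T -> \bar R) :
  (forall s, 0%E <= a s)%E ->
  (\esum_(s in [set s | size s = m.+1]) a s =
   \esum_(x in [set: T]) \esum_(s in [set s | size s = m]) a (x :: s))%E.
Proof.
move=> a0; rewrite esum_esum//.
apply: (reindex_esum _ _ (fun k => k.1 :: k.2) a); split.
- by move=> [x s] /= [_ ->].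
- by move=> [x s] [y s'] _ _ /= [-> ->].
- by move=> [//|x s] /= [sz]; exists (x, s).
Qed.

Lemma esum_size0 (T : choiceType) (a : seq T -> \bar R) :
  (forall s, 0%E <= a s)%E ->
  (\esum_(s in [set s | size s = 0%N]) a s = a [::])%E.
Proof.
move=> a0; rewrite (_ : [set s | _] = [set [::]]) ?esum_set1//.
by apply/seteqP; split=> [s /= /size0nil//|s ->].
Qed.

Lemma esum_cons (T : choiceType) (a : seq T -> \bar R) :
  (forall s, 0%E <= a s)%E -> a [::] = 0%E ->
  (\esum_(s in [set: seq T]) a s =
   \esum_(x in [set: T]) \esum_(s in [set: seq T]) a (x :: s))%E.
Proof.
move=> a0 an; rewrite (esumID [set [::]])// setTI esum_set1// an add0e setTI.
rewrite esum_esum//.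
apply: (reindex_esum _ _ (fun k => k.1 :: k.2) a); split.
- by move=> [x s] /= _.
- by move=> [x s] [y s'] _ _ /= [-> ->].
- by move=> [|x s] /= h; [case: (h erefl) | exists (x, s)].
Qed.

Lemma esum_prod_size (T : choiceType) (g : T -> R) (q : R) m :
  (forall x, 0 <= g x) -> (\esum_(x in [set: T]) (g x)%:E = q%:E)%E ->
  (\esum_(s in [set s : seq T | size s = m]) (\prod_(x <- s) g x)%:E
   = (q ^+ m)%:E)%E.
Proof.
move=> g0 gq.
have p0 (s : seq T) : (0%E <= (\prod_(x <- s) g x)%:E)%E.
  by rewrite lee_fin prodr_ge0.
have q0 : 0 <= q by rewrite -lee_fin -gq esum_ge0// => x _; rewrite lee_fin.
elim: m => [|m IH]; first by rewrite esum_size0// big_nil expr0.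
rewrite esum_size_cons//.
rewrite (eq_esum (b := fun x => ((q ^+ m)%:E * (g x)%:E)%E)).
  by rewrite esumZ ?exprn_ge0// gq -EFinM -exprSr.
move=> x _; rewrite -IH muleC -esumZ//.
by apply: eq_esum => s _; rewrite big_cons EFinM.
Qed.

Lemma esum_exp_coeff (x : R) : 0 <= x ->
  (\esum_(m in [set: nat]) (exp_coeff x m)%:E = (expR x)%:E)%E.
Proof.
move=> x0; rewrite -nneseries_esumT; last first.
  by move=> m; rewrite lee_fin /exp_coeff divr_ge0// exprn_ge0.
rewrite /expR -EFin_lim; last exact: is_cvg_series_exp_coeff.
by apply/congr_lim/funext => n /=; rewrite /series /= sumEFin.
Qed.

Lemma Po_ge0 (m : R) k : 0 <= Po m k.
Proof. by rewrite /Po; case: ifP => // _; exact: poisson_pmf_ge0. Qed.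

Lemma esum_Po (m q : R) : 0 <= m -> 0 <= q ->
  (\esum_(k in [set: nat]) (Po m k * q ^+ k)%:E = (expR (- m * (1 - q)))%:E)%E.
Proof.
move=> m0 q0; have [->|mn0] := eqVneq m 0.
  rewrite oppr0 mul0r expR0 (esumID [set 0%N]); last first.
    by move=> k _; rewrite lee_fin mulr_ge0 ?Po_ge0 ?exprn_ge0.
  rewrite !setTI esum_set1 ?lee_fin /Po eqxx ?expr0 ?mulr1//= esum1 ?adde0//.
  by move=> [|k] //= _; rewrite mul0r.
have mp : 0 < m by rewrite lt_neqAle eq_sym mn0.
rewrite (eq_esum (b := fun k => ((expR (- m))%:E * (exp_coeff (m * q) k)%:E)%E)).
  rewrite esumZ ?esum_exp_coeff ?mulr_ge0 ?expR_ge0// -?EFinM -?expRD.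
    by congr (expR _)%:E; ring.
  by move=> k; rewrite lee_fin /exp_coeff divr_ge0// exprn_ge0// mulr_ge0.
move=> k _; rewrite -EFinM /Po (negPf mn0) /poisson_pmf mp /exp_coeff /= exprMn.
by congr EFin; ring.
Qed.

(** Poisson thinning: when [g] is the law of one walk restricted to a target of probability [q],
    this is the probability that no particle misses the target. *)
Lemma esum_Po_seq (T : choiceType) (g : T -> R) (m q : R) :
  0 <= m -> 0 <= q -> (forall x, 0 <= g x) ->
  (\esum_(x in [set: T]) (g x)%:E = q%:E)%E ->
  (\esum_(s in [set: seq T]) (Po m (size s) * \prod_(x <- s) g x)%:E
   = (expR (- m * (1 - q)))%:E)%E.
Proof.
move=> m0 q0 g0 gq; rewrite (esum_fibers size); last first.
  by move=> s; rewrite lee_fin mulr_ge0 ?Po_ge0 ?prodr_ge0.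
rewrite -esum_Po//; apply: eq_esum => k _; rewrite setTI.
rewrite EFinM -(esum_prod_size _ g0 gq) -esumZ ?Po_ge0//; last first.
  by move=> s; rewrite lee_fin prodr_ge0.
by apply: eq_esum => s /= <-; rewrite EFinM.
Qed.

Lemma esum_ffun (X : finType) (S : choiceType) (s0 : S) (g : X -> S -> R)
    (D : X -> set S) (q : X -> R) :
  (forall x s, 0 <= g x s) ->
  (forall x, \esum_(s in D x) (g x s)%:E = (q x)%:E)%E ->
  (\esum_(o in [set o : {ffun X -> S} | forall x, D x (o x)])
     (\prod_x g x (o x))%:E = (\prod_x q x)%:E)%E.
Proof.
move=> g0 gq.
(* Coordinates off the list are frozen at [s0], so that adding one coordinate is a bijection with
   pairs of a new entry and an old function. *)
pose E (r : seq X) := [set o : {ffun X -> S} |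
  (forall x, x \in r -> D x (o x)) /\ (forall x, x \notin r -> o x = s0)].
suff H (r : seq X) : uniq r ->
    (\esum_(o in E r) (\prod_(x <- r) g x (o x))%:E = (\prod_(x <- r) q x)%:E)%E.
  rewrite -H ?index_enum_uniq//; congr esum; apply/seteqP; split => o /=.
    by move=> Do; split=> [x _|x]; [exact: Do | rewrite mem_index_enum].
  by move=> [Do _] x; apply: Do; rewrite mem_index_enum.
have q0 x : 0 <= q x by rewrite -lee_fin -gq esum_ge0// => s _; rewrite lee_fin.
elim: r => [_|x r IH /= /andP[xr ur]].
  rewrite (_ : E [::] = [set [ffun=> s0]]).
    by rewrite esum_set1 !big_nil// lee_fin.
  apply/seteqP; split=> [ o [_ h]| o ->]; last first.
    by split=> // y _; rewrite ffunE.
  by apply/ffunP => y; rewrite ffunE h.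
rewrite big_cons mulrC EFinM -gq -esumZ ?prodr_ge0//; last first.
  by move=> s; rewrite lee_fin.
have pg (o : {ffun X -> S}) r' : 0 <= \prod_(y <- r') g y (o y).
  exact: prodr_ge0.
rewrite (eq_esum (b := fun s => (\esum_(o in E r)
    (g x s * \prod_(y <- r) g y (o y))%:E)%E)); last first.
  move=> s _; rewrite muleC -IH// -esumZ// => o.
  by rewrite lee_fin.
rewrite esum_esum; last by move=> s o _ _; rewrite lee_fin mulr_ge0.
pose e (k : S * {ffun X -> S}) := [ffun y => if y == x then k.1 else k.2 y].
rewrite (reindex_esum (D x `*`` (fun=> E r)) (E (x :: r)) e).
  apply: eq_esum => -[s o] /= _; congr EFin; rewrite big_cons ffunE eqxx.
  congr (_ * _); apply: eq_big_seq => y yr; rewrite ffunE.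
  by case: eqP xr => // <-; rewrite yr.
split.
- move=> [s o] /= [Ds [h1 h2]]; split=> y; rewrite inE ffunE.
    by case: eqP => [->|_] /=; [by []|exact: h1].
  by rewrite negb_or => /andP[/negPf -> /h2].
- move=> [s o] [s' o']; rewrite !inE /= => -[_ [_ h]] [_ [_ h']] /ffunP eo.
  have := eo x; rewrite !ffunE eqxx /= => ->; congr (_, _); apply/ffunP => y.
  have := eo y; rewrite !ffunE /=; case: eqP => [->|//] _.
  by rewrite h// h'.
- move=> o [h1 h2].
  exists (o x, [ffun y => if y == x then s0 else o y]) => /=.
    split; first by apply: h1; rewrite inE eqxx.
    split=> y yr; rewrite ffunE.
      case: eqP yr xr => [->|_ yr _]; first by move=> ->.
      by apply: h1; rewrite inE yr orbT.
    by case: eqP => // /eqP yx; apply: h2; rewrite inE negb_or yx.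
  by apply/ffunP => y; rewrite !ffunE; case: eqP => // ->.
Qed.

End Esum.

(** * The walk stopped at the leaves *)

Lemma seq_rcons (T : Type) (s : seq T) : s = [::] \/ exists v j, s = rcons v j.
Proof. by case/lastP: s => [|v j]; [left | right; exists v, j]. Qed.

Section Walk.
Variables (R : realType) (b n : nat).
Hypothesis hb : (2 <= b)%N.

Local Notation word := (seq 'I_b).
Local Notation B := (b%:R : R).
Local Notation V := (vertex b n).
Local Notation step := (srw_step R).

Definition nbrs (u : word) : seq word :=
  (if (size u < n)%N then [seq rcons u i | i <- enum 'I_b] else [::])
  ++ (if u is i :: u' then [:: belast i u'] else [::]).

Lemma mem_nbrs (u v : V) : (val v \in nbrs (val u)) = adj u v.
Proof.
have hv : (size (val v) <= n)%N by exact: size_bseq.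
rewrite /nbrs /adj /is_parent mem_cat; congr (_ || _).
  apply/idP/existsP => [|[i /eqP e]].
    by case: ifP => // _ /mapP[i _ ->]; exists i.
  have -> : (size (val u) < n)%N by move: hv; rewrite e size_rcons.
  by rewrite e; apply: map_f; rewrite mem_enum.
case: (val u) => [|i u'].
  by apply/esym/existsP => -[i /eqP /(congr1 size)]; rewrite size_rcons.
rewrite inE; apply/eqP/existsP => [->|[j]]; first by exists (last i u'); rewrite -lastI.
by rewrite lastI eqseq_rcons => /andP[/eqP -> _].
Qed.

Lemma uniq_nbrs u : uniq (nbrs u).
Proof.
rewrite /nbrs cat_uniq; apply/and3P; split.
- by case: ifP => // _; rewrite map_inj_uniq ?enum_uniq// => i j /rcons_inj[].
- apply/hasPn; case: u => // i u w; rewrite inE => /eqP ->.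
  case: ifP => // _; apply/negP => /mapP[j _ /(congr1 size)].
  by rewrite size_belast size_rcons /=; lia.
- by case: u.
Qed.

Lemma nbrs_size u w : (size u <= n)%N -> w \in nbrs u -> (size w <= n)%N.
Proof.
rewrite mem_cat => su /orP[].
  by case: ifP => // lt /mapP[i _ ->]; rewrite size_rcons.
case: u su => // i u su; rewrite inE => /eqP ->; rewrite size_belast.
by move: su => /=; lia.
Qed.

Lemma sum_adj (u : V) (g : word -> R) :
  \sum_(w : V | adj u w) g (val w) = \sum_(w <- nbrs (val u)) g w.
Proof.
rewrite -big_filter -(big_map val xpredT); apply: perm_big.
apply: uniq_perm => [||w].
- by rewrite map_inj_uniq ?filter_uniq ?index_enum_uniq//; exact: val_inj.
- exact: uniq_nbrs.
apply/mapP/idP => [[v + ->]|wu]; first by rewrite mem_filter => /andP[]; rewrite mem_nbrs.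
have sw := nbrs_size (size_bseq u) wu.
by exists (Bseq sw) => //; rewrite mem_filter -mem_nbrs/= wu mem_index_enum.
Qed.

Lemma sum_step (u : V) (g : word -> R) :
  \sum_(w : V) step u w * g (val w) =
  (\sum_(w <- nbrs (val u)) g w) / (size (nbrs (val u)))%:R.
Proof.
rewrite (bigID (adj u)) /= [X in _ + X]big1 ?addr0 => [|w /negPf a]; last first.
  by rewrite /srw_step a mul0r.
rewrite -sum_adj mulr_suml; apply: eq_bigr => w a.
rewrite /srw_step a mulrC; congr (_ * _^-1).
rewrite /degree cardsE -sum1_card natr_sum.
rewrite (sum_adj u (fun=> 1)).
by rewrite -[in RHS]sum1_size natr_sum.
Qed.

Lemma sum_step_nil (u : V) (g : word -> R) : val u = [::] -> (0 < n)%N ->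
  \sum_(w : V) step u w * g (val w) = (\sum_(i < b) g [:: i]) / B.
Proof.
move=> eu n0; rewrite sum_step eu /nbrs /= n0 cats0 big_map big_enum /=.
by rewrite size_map size_enum_ord.
Qed.

Lemma sum_step_rcons (u : V) (g : word -> R) v j :
  val u = rcons v j -> ((size v).+1 < n)%N ->
  \sum_(w : V) step u w * g (val w) =
  (\sum_(i < b) g (rcons (rcons v j) i) + g v) / (B + 1).
Proof.
move=> eu n0; rewrite sum_step eu /nbrs size_rcons n0.
have -> : match rcons v j with [::] => [::] | i :: u' => [:: belast i u'] end = [:: v].
  by case: v {eu n0} => //= i v; rewrite belast_rcons.
rewrite big_cat big_seq1 /= big_map big_enum /= size_cat size_map size_enum_ord.
by rewrite natrD.
Qed.

Lemma sum_step_leaf (u : V) (g : word -> R) v j :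
  val u = rcons v j -> (size v).+1 = n ->
  \sum_(w : V) step u w * g (val w) = g v.
Proof.
move=> eu n0; rewrite sum_step eu /nbrs size_rcons n0 ltnn.
have -> : match rcons v j with [::] => [::] | i :: u' => [:: belast i u'] end = [:: v].
  by case: v {eu n0} => //= i v; rewrite belast_rcons.
by rewrite big_seq1 /= divr1.
Qed.

Lemma leafE (u : V) : is_leaf u = (size (val u) == n).
Proof. by rewrite /is_leaf /height subn_eq0 eqn_leq size_bseq. Qed.

Lemma nleafE (u : V) : ~~ is_leaf u = (size (val u) < n)%N.
Proof. by rewrite leafE ltn_neqAle size_bseq andbT. Qed.

Lemma step_ge0 (u w : V) : 0 <= step u w.
Proof. by rewrite /srw_step; case: ifP. Qed.

Lemma hext_step f (u : V) : ~~ is_leaf u ->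
  \sum_(w : V) step u w * hext n f (val w) = hext n f (val u).
Proof.
rewrite nleafE; have [eu|[v [j eu]]] := seq_rcons (val u); rewrite eu.
  move=> n0; rewrite sum_step_nil//.
  have h m : (0 < m)%N -> \sum_(i < b) hext m f [:: i] = B * hext m f [::].
    by case: m => // m _; exact: hext_harm_root.
  by rewrite h// mulrC mulKf// B_neq0.
rewrite size_rcons => n0; rewrite (sum_step_rcons _ eu)// hext_harm//.
by rewrite mulrC mulKf// gt_eqF// addr_gt0// B_gt0.
Qed.

(** At the apex the height drops by 1; elsewhere its drift is -(b-1)/(b+1), which is -1/3 for b = 2
    and smaller for larger b. *)
Lemma height_step (u : V) : ~~ is_leaf u ->
  \sum_(w : V) step u w * (height w)%:R <= (height u)%:R - 3^-1.
Proof.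
rewrite nleafE; pose g (w : word) : R := (n - size w)%:R.
rewrite -[\sum_w _]/(\sum_(w : V) step u w * g (val w)).
rewrite -[(height u)%:R]/(g (val u)).
have [eu|[v [j eu]]] := seq_rcons (val u); rewrite eu.
  move=> n0; rewrite sum_step_nil// /g /= sumr_const card_ord -[X in X / _]mulr_natl.
  rewrite mulrC mulKf ?B_neq0// subn0 natrB//; lra.
rewrite size_rcons => n0; rewrite (sum_step_rcons _ eu)// /g.
under eq_bigr do rewrite !size_rcons.
rewrite sumr_const card_ord -[X in X + _]mulr_natl size_rcons.
rewrite ler_pdivrMr ?addr_gt0 ?B_gt0//.
have -> : (n - (size v).+1 = (n - (size v).+2).+1)%N by lia.
have -> : (n - (size v) = (n - (size v).+2).+2)%N by lia.
have := B_ge2 R hb; rewrite -(natr1 (_ - _).+1) -(natr1 (_ - _)).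
set h := (n - _)%:R; nra.
Qed.

(** The expectation of [f] at the arrival point, on the event that the leaves are first met at time
    exactly [t], time 0 included. *)
Fixpoint hit (f : word -> R) t (u : V) : R :=
  if is_leaf u then (if t is 0%N then f (val u) else 0)
  else if t is t'.+1 then \sum_(w : V) step u w * hit f t' w else 0.

(** The weight of a trajectory after its first step. Unlike [walk_weight] it also stops at time 0,
    since only the start of a particle is exempt from stopping. *)
Fixpoint tail_weight (u : V) (p : seq V) : R :=
  if p is w :: p' then if is_leaf u then 0 else step u w * tail_weight w p'
  else (is_leaf u)%:R.

Lemma tail_weight_ge0 u p : 0 <= tail_weight u p.
Proof.
by elim: p u => [|w p IH] u //=; case: ifP => // _; rewrite mulr_ge0 ?step_ge0.
Qed.

Lemma tail_weightE u p : tail_weight u p =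
  if is_leaf (last u p) && all (fun u => ~~ is_leaf u) (belast u p)
  then \prod_(s <- zip (u :: p) p) step s.1 s.2 else 0.
Proof.
elim: p u => [|w p IH] u /=; first by rewrite andbT big_nil; case: is_leaf.
rewrite IH; case: (is_leaf u) => /=; first by rewrite andbF.
by case: ifP => _; rewrite ?mulr0// big_cons.
Qed.

Lemma walk_weightE (x : V) p : is_leaf x -> walk_weight R x p =
  if p is w :: p' then step x w * tail_weight w p' else 0.
Proof.
move=> lx; case: p => [|w p] //; rewrite /walk_weight /stopped /= tail_weightE.
by case: ifP => _; rewrite ?mulr0// big_cons.
Qed.

Lemma hit_esum f t u : (forall w, 0 <= f w) ->
  (\esum_(p in [set p : seq V | size p = t])
     (tail_weight u p * f (val (last u p)))%:E = (hit f t u)%:E)%E.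
Proof.
move=> f0.
have p0 v p : (0%E <= (tail_weight v p * f (val (last v p)))%:E)%E.
  by rewrite lee_fin mulr_ge0// tail_weight_ge0.
elim: t u => [|t IH] u.
  by rewrite esum_size0//=; case: is_leaf; rewrite ?mul1r// mul0r.
rewrite esum_size_cons// esum_fin; last by move=> w; exact: esum_ge0.
rewrite /=; case: ifP => lu.
  by rewrite big1// => w _; rewrite esum1// => p _; rewrite mul0r.
rewrite -sumEFin; apply: eq_bigr => w _; rewrite EFinM -IH -esumZ ?step_ge0//.
by apply: eq_esum => p _; rewrite -EFinM mulrA.
Qed.

Lemma hit_ge0 f t u : (forall w, 0 <= f w) -> 0 <= hit f t u.
Proof.
by move=> f0; rewrite -lee_fin -hit_esum// esum_ge0// => p _;
  rewrite lee_fin mulr_ge0// tail_weight_ge0.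
Qed.

(* The height is a strict supersolution: its expectation drops by at least 1/3
   at each step, so the unstopped mass decays geometrically. *)
Lemma hit_hext_bound f : exists2 C, 0 <= C & forall T u,
  `|hext n f (val u) - \sum_(t < T.+1) hit f t u|
  <= C * (1 - (3 * n.+1%:R)^-1) ^+ T * (height u)%:R.
Proof.
pose F (u : V) := hext n f (val u); exists (\sum_(u : V) `|F u|).
  by apply: sumr_ge0.
(* Heights are at most [n], so a drop by 1/3 is at least a reduction by the factor [r]; [n.+1] keeps
   the denominator positive. *)
set C := \sum_(u : V) _; set r := 1 - _.
have r0 : 0 <= r.
  rewrite subr_ge0 invf_le1 ?mulr_gt0//; rewrite -natrM ler1n; lia.
have C0 : 0 <= C by apply: sumr_ge0.
have D0 T' (u : V) : is_leaf u -> F u - \sum_(t < T'.+1) hit f t u = 0.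
  move=> lu; rewrite big_ord_recl big1 => [|i _]; last by rewrite /= lu.
  by rewrite /= lu addr0 /F hext_leaf ?subrr//; apply/eqP; rewrite -leafE.
elim=> [|T IH] u.
  case: (boolP (is_leaf u)) => lu.
    by rewrite (D0 0%N)// normr0 !mulr_ge0.
  rewrite big_ord1 /= (negPf lu) subr0 expr0 mulr1.
  apply: (@le_trans _ _ C); last by rewrite ler_peMr// ler1n /height lt0n.
  by rewrite /C (bigD1 u)//= lerDl sumr_ge0.
case: (boolP (is_leaf u)) => lu.
  by rewrite (D0 T.+1)// normr0 !mulr_ge0 ?exprn_ge0.
rewrite big_ord_recl [hit f ord0 u]/= (negPf lu) add0r.
have -> : \sum_(i < T.+1) hit f (lift ord0 i) u =
    \sum_(w : V) step u w * \sum_(i < T.+1) hit f i w.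
  under eq_bigr => i _ do rewrite /bump /= (negPf lu).
  by rewrite exchange_big; apply: eq_bigr => w _; rewrite mulr_sumr.
rewrite -hext_step// -sumrB; apply: (le_trans (ler_norm_sum _ _ _)).
apply: (@le_trans _ _ (C * r ^+ T * \sum_(w : V) step u w * (height w)%:R)).
  rewrite mulr_sumr; apply: ler_sum => w _.
  rewrite -mulrBr normrM (ger0_norm (step_ge0 _ _)) mulrCA.
  by apply: ler_wpM2l; rewrite ?step_ge0.
rewrite exprSr -!mulrA; apply: ler_wpM2l => //; apply: ler_wpM2l.
  exact: exprn_ge0.
apply: (le_trans (height_step lu)); rewrite /r mulrBl mul1r lerD2l lerN2.
rewrite invfM -mulrA ler_piMr// mulrC ler_pdivrMr// mul1r ler_nat /height; lia.
Qed.

Lemma tail_esum f u : (forall w, 0 <= f w) ->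
  (\esum_(p in [set: seq V]) (tail_weight u p * f (val (last u p)))%:E
   = (hext n f (val u))%:E)%E.
Proof.
move=> f0.
have p0 v p : (0%E <= (tail_weight v p * f (val (last v p)))%:E)%E.
  by rewrite lee_fin mulr_ge0// tail_weight_ge0.
rewrite (esum_fibers size)//.
under eq_esum => t _ do rewrite setTI hit_esum//.
rewrite -nneseries_esumT; last by move=> t; rewrite lee_fin hit_ge0.
have cv : \sum_(t < T) hit f t u @[T --> \oo] --> hext n f (val u).
  rewrite -(cvg_shiftS (fun T => \sum_(t < T) hit f t u)).
  apply/subr_cvg0/norm_cvg0P.
  have [C C0 HC] := hit_hext_bound f.
  set r := 1 - _ in HC.
  apply: (@squeeze_cvgr _ _ _ _ (fun=> 0) (geometric (C * (height u)%:R) r)).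
  - by apply: nearW => T; rewrite /geometric /= normr_ge0 distrC mulrAC; exact: HC.
  - exact: cvg_cst.
  - apply: cvg_geometric; rewrite ger0_norm /r; last first.
      rewrite subr_ge0 invf_le1 ?mulr_gt0//; rewrite -natrM ler1n; lia.
    by rewrite ltrBlDr ltrDl invr_gt0 mulr_gt0.
rewrite -(cvg_lim _ cv)// -EFin_lim; last by apply/cvg_ex; exists (hext n f (val u)).
by apply/congr_lim/funext => T /=; rewrite big_mkord sumEFin.
Qed.

(** A tree of height 0 has no edges, so no walk returns there and the sum would be 0; this is why
    [n] is positive. *)
Lemma walk_esum f (x : V) : (0 < n)%N -> is_leaf x -> (forall w, 0 <= f w) ->
  (\esum_(p in [set: seq V]) (walk_weight R x p * f (val (last x p)))%:E
   = (hop n f (val x))%:E)%E.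
Proof.
move=> n0 lx f0.
have p0 v p : (0%E <= (tail_weight v p * f (val (last v p)))%:E)%E.
  by rewrite lee_fin mulr_ge0// tail_weight_ge0.
rewrite esum_cons; last 2 first.
- move=> p; rewrite lee_fin walk_weightE//.
  by case: p => [|w p]; rewrite ?mul0r// !mulr_ge0 ?step_ge0 ?tail_weight_ge0.
- by rewrite walk_weightE// mul0r.
have e w p : (walk_weight R x (w :: p) * f (val (last x (w :: p))))%:E =
    ((step x w)%:E * (tail_weight w p * f (val (last w p)))%:E)%E.
  by rewrite walk_weightE//= -EFinM mulrA.
under eq_esum => w _ do under eq_esum => p _ do rewrite e.
under eq_esum => w _ do rewrite esumZ ?step_ge0// tail_esum// -EFinM.
rewrite esum_fin; last first.
  move=> w; rewrite EFinM -tail_esum// mule_ge0 ?lee_fin ?step_ge0//.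
  exact: esum_ge0.
rewrite sumEFin; congr EFin.
move: lx; rewrite leafE => /eqP sx.
have [ex|[v [j ex]]] := seq_rcons (val x); first by rewrite -sx ex in n0.
rewrite ex size_rcons in sx; rewrite (sum_step_leaf _ ex)// ex.
have H m : m = (size v).+1 -> hext m f v = hop m f (rcons v j).
  by move=> ->; rewrite hop_hext.
exact: H.
Qed.

End Walk.

(** * The law of the endpoint sets *)

Section Model.
Variables (R : realType) (b n : nat).
Hypothesis hb : (2 <= b)%N.
Hypothesis n0 : (0 < n)%N.

Local Notation word := (seq 'I_b).
Local Notation V := (vertex b n).
Local Notation L := (leaf b n).

Definition lword (x : L) : word := val (val x).

Lemma size_lword x : size (lword x) = n.
Proof. by apply/eqP; rewrite -leafE; exact: (valP x). Qed.

Lemma lword_inj : injective lword.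
Proof. by move=> x y /val_inj/val_inj. Qed.

Lemma lword_surj w : size w = n -> exists x, lword x = w.
Proof.
move=> sw; have lw : (size w <= n)%N by rewrite sw.
have lv : is_leaf (Bseq lw : V) by rewrite leafE /= sw.
by exists (Sub (Bseq lw : V) lv); rewrite /lword SubK.
Qed.

Lemma sum_leaf (f : word -> R) : \sum_(x : L) f (lword x) = wsum n f.
Proof.
apply: big_words => [|x _|w /lword_surj[x e]]; first exact: lword_inj.
  exact: size_lword.
by exists x.
Qed.

Definition hk (x y : L) : R := hker R n (lword x) (lword y).

Definition ind (A : {set L}) (w : word) : R :=
  [exists y, (lword y == w) && (y \in A)]%:R.

Lemma indE A y : ind A (lword y) = (y \in A)%:R.
Proof.
rewrite /ind; congr (_%:R); congr (nat_of_bool _).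
by apply/existsP/idP => [[z /andP[/eqP/lword_inj -> //]]|yA]; exists y; rewrite eqxx.
Qed.

Lemma ind_ge0 A w : 0 <= ind A w. Proof. exact: ler0n. Qed.

Lemma hop_ind A x : hop n (ind A) (lword x) = \sum_(y in A) hk x y.
Proof.
rewrite hop_ker ?size_lword// -sum_leaf [RHS]big_mkcond /=.
by apply: eq_bigr => y _; rewrite indE; case: (y \in A); rewrite ?mulr1 ?mulr0.
Qed.

Lemma hk_sum1 x : \sum_y hk x y = 1.
Proof. by rewrite /hk (sum_leaf (hker R n (lword x))) hker_sum1// size_lword. Qed.

Lemma hk_sym x y : hk x y = hk y x. Proof. exact: hker_sym. Qed.

(** The recursion for [hker] contains a subtraction, so the sign is read off the sum over walks,
    whose terms are nonnegative. *)
Lemma hk_ge0 x y : 0 <= hk x y.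
Proof.
have := hop_ind [set y]%SET x; rewrite big_set1 => <-.
rewrite -lee_fin -(walk_esum hb n0 (valP x) (ind_ge0 [set y]%SET)).
apply: esum_ge0 => p _; rewrite lee_fin mulr_ge0 ?ind_ge0//.
by rewrite walk_weightE ?(valP x)//; case: p => // w p;
  rewrite mulr_ge0 ?step_ge0 ?tail_weight_ge0.
Qed.

Lemma walk_weight_ge0 (x : L) p : 0 <= walk_weight R (val x) p.
Proof.
by rewrite walk_weightE ?(valP x)//; case: p => // w p;
  rewrite mulr_ge0 ?step_ge0 ?tail_weight_ge0.
Qed.

(** Paths and multiplicities are forgotten here, which leaves finitely many configurations and still
    determines all edges. *)
Definition endset (x : L) (s : seq (seq V)) : {set L} :=
  [set y | has (fun p => last (val x) p == val y) s]%SET.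

Definition ends (o : outcome b n) : {ffun L -> {set L}} :=
  [ffun x => endset x (o x)].

Variable lam : R.
Hypothesis lam0 : 0 <= lam.

Definition row_weight (x : L) (s : seq (seq V)) : R :=
  Po (lam / 2) (size s) * \prod_(p <- s) walk_weight R (val x) p.

Lemma row_weight_ge0 x s : 0 <= row_weight x s.
Proof.
by rewrite mulr_ge0 ?Po_ge0// prodr_ge0// => p _; exact: walk_weight_ge0.
Qed.

Lemma row_esum_sub (x : L) (A : {set L}) :
  (\esum_(s in [set s | endset x s \subset A]) (row_weight x s)%:E
   = (expR (- (lam / 2) * \sum_(y in ~: A) hk x y))%:E)%E.
Proof.
have q0 : 0 <= \sum_(y in A) hk x y by apply: sumr_ge0 => y _; exact: hk_ge0.
have -> : \sum_(y in ~: A) hk x y = 1 - \sum_(y in A) hk x y.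
  have := hk_sum1 x; rewrite (bigID (mem A)) /= => <-; rewrite [RHS]addrC addKr.
  by apply: eq_bigl => y; rewrite inE.
pose g p := walk_weight R (val x) p * ind A (val (last (val x) p)).
rewrite -(@esum_Po_seq _ _ g)//; last first.
- by rewrite -hop_ind -(walk_esum hb n0 (valP x) (ind_ge0 A)).
- by move=> p; rewrite mulr_ge0 ?ind_ge0 ?walk_weight_ge0.
- by rewrite divr_ge0.
(* On the event every indicator in [g] is 1, except for trajectories of weight 0 that do not end at
   a leaf; off the event some indicator is 0. *)
rewrite esum_mkcond; apply: eq_esum => s _; case: ifPn => [/set_mem/= sA|/negP sA].
  congr (_ * _)%:E; apply: eq_big_seq => p ps; rewrite /g.
  case: (boolP (is_leaf (last (val x) p))) => lp; last first.
    by rewrite /walk_weight /stopped (negPf lp) andbF mul0r.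
  have [y ey] : exists y : L, val y = last (val x) p.
    by exists (Sub _ lp); rewrite SubK.
  rewrite -ey -/(lword y) indE (fintype.subsetP sA) ?mulr1// inE.
  by apply/hasP; exists p => //; rewrite ey.
have {sA} : ~~ (endset x s \subset A) by apply/negP => h; apply: sA; exact: mem_set.
case/fintype.subsetPn => y.
rewrite inE => /hasP[p ps /eqP ep] yA.
congr EFin; apply/esym/eqP; rewrite mulf_eq0; apply/orP; right.
rewrite (big_rem p ps) /= /g ep -/(lword y) indE (negPf yA).
by rewrite mulr0 mul0r.
Qed.

Definition endset_prob (x : L) (A : {set L}) : R :=
  fine (\esum_(s in [set s | endset x s = A]) (row_weight x s)%:E)%E.

Lemma endset_probE x A :
  (\esum_(s in [set s | endset x s = A]) (row_weight x s)%:E = (endset_prob x A)%:E)%E.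
Proof.
rewrite /endset_prob fineK// ge0_fin_numE; last first.
  by apply: esum_ge0 => s _; rewrite lee_fin row_weight_ge0.
apply: le_lt_trans (ltry (expR (- (lam / 2) * \sum_(y in ~: A) hk x y))).
rewrite -row_esum_sub [leRHS](esumID [set s | endset x s = A]); last first.
  by move=> s _; rewrite lee_fin row_weight_ge0.
have -> : [set s | endset x s \subset A] `&` [set s | endset x s = A] =
    [set s | endset x s = A].
  by apply/seteqP; split=> [s [_ //]|s /= ->].
rewrite leeDl//; apply: esum_ge0 => s _.
by rewrite lee_fin row_weight_ge0.
Qed.

Lemma endset_prob_ge0 x A : 0 <= endset_prob x A.
Proof.
by rewrite -lee_fin -endset_probE esum_ge0// => s _; rewrite lee_fin row_weight_ge0.
Qed.

Lemma sum_endset_prob (x : L) (A : {set L}) :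
  \sum_(T : {set L} | T \subset A) endset_prob x T =
  expR (- (lam / 2) * \sum_(y in ~: A) hk x y).
Proof.
apply: EFin_inj; rewrite -row_esum_sub (esum_fibers (endset x)); last first.
  by move=> s; rewrite lee_fin row_weight_ge0.
rewrite esum_fin; last first.
  by move=> T; apply: esum_ge0 => s _; rewrite lee_fin row_weight_ge0.
rewrite -sumEFin big_mkcond /=; apply: eq_bigr => T _.
case: ifP => TA; last first.
  rewrite (_ : _ `&` _ = set0) ?esum_set0//.
  by apply/seteqP; split=> // s [/= h e]; rewrite e TA in h.
rewrite -endset_probE; congr esum; apply/seteqP; split=> s /= [] //.
by move=> e; split; rewrite ?e.
Qed.

Definition ends_prob (m : {ffun L -> {set L}}) : R := \prod_x endset_prob x (m x).

Lemma ends_prob_ge0 m : 0 <= ends_prob m.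
Proof. by apply: prodr_ge0 => x _; exact: endset_prob_ge0. Qed.

Definition Prends (P : pred {ffun L -> {set L}}) : R := \sum_(m | P m) ends_prob m.

(** The rows are independent, so the probability factors over the leaves. Isolation of one set or of
    two sets at once is such a rectangle. *)
Lemma Prends_rect (A : L -> {set L}) :
  Prends (fun m => [forall x, m x \subset A x]) =
  expR (- (lam / 2) * \sum_x \sum_(y in ~: A x) hk x y).
Proof.
rewrite mulr_sumr expR_sum.
under [RHS]eq_bigr => x _ do rewrite -sum_endset_prob big_mkcond /=.
rewrite bigA_distr_bigA /= /Prends big_mkcond /=; apply: eq_bigr => m _.
case: ifPn => [/forallP h|/forallPn[x /negPf hx]].
  by apply: eq_bigr => x _; rewrite h.
by rewrite (bigD1 x)//= hx mul0r.
Qed.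

Lemma Prends1 : Prends predT = 1.
Proof.
rewrite -[RHS](expR0 R).
transitivity (Prends (fun m => [forall x, m x \subset [set: L]%SET])).
  by apply: eq_bigl => m; apply/esym/forallP => x; exact: finset.subsetT.
rewrite Prends_rect big1 ?mulr0// => x _.
by rewrite finset.setCT big_set0.
Qed.

(** The passage from the infinite discrete law to a finite sum, on which all later estimates are
    made. *)
Lemma Pr_ends (E : set (outcome b n)) (P : pred {ffun L -> {set L}}) :
  (forall o, E o <-> P (ends o)) -> Pr b n lam E = (Prends P)%:E.
Proof.
move=> EP; rewrite /Pr.
have w0 (o : outcome b n) : (0%E <= (outcome_weight lam o : R)%:E)%E.
  rewrite lee_fin; apply: prodr_ge0 => x _; exact: (row_weight_ge0 x (o x)).
rewrite (esum_fibers ends)// esum_fin; last first.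
  by move=> m; apply: esum_ge0 => o _.
rewrite /Prends -sumEFin [RHS]big_mkcond /=; apply: eq_bigr => m _.
case: ifPn => Pm; last first.
  rewrite (_ : _ `&` _ = set0) ?esum_set0//.
  apply/seteqP; split=> // o [/= /EP h e]; rewrite e in h.
  by rewrite h in Pm.
rewrite -(esum_ffun [::] row_weight_ge0 (fun x => endset_probE x (m x))).
congr esum; apply/seteqP; split=> o /=.
  by move=> [_ <-] x; rewrite ffunE.
move=> h; have e : ends o = m by apply/ffunP => x; rewrite ffunE.
by split=> //; apply/EP; rewrite e.
Qed.

Lemma le_Prends (P Q : pred {ffun L -> {set L}}) :
  (forall m, P m -> Q m) -> Prends P <= Prends Q.
Proof.
move=> PQ; rewrite /Prends [leLHS]big_mkcond [leRHS]big_mkcond /=.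
apply: ler_sum => m _; case: ifPn => [/PQ ->//|_].
by case: ifP => // _; exact: ends_prob_ge0.
Qed.

Lemma Prends_compl P : Prends (fun m => ~~ P m) = 1 - Prends P.
Proof. 
by have := Prends1; rewrite /Prends (bigID P) /= => <-; rewrite [RHS]addrC addKr.
Qed.

Lemma Prends_le1 P : Prends P <= 1.
Proof. by rewrite -Prends1; exact: le_Prends. Qed.

Lemma Prends_ge0 P : 0 <= Prends P.
Proof. by apply: sumr_ge0 => m _; exact: ends_prob_ge0. Qed.

Lemma Prends_union (I : finType) (J : pred I) (Q : I -> pred {ffun L -> {set L}})
    (P : pred {ffun L -> {set L}}) :
  (forall m, P m -> exists2 i, J i & Q i m) ->
  Prends P <= \sum_(i | J i) Prends (Q i).
Proof.
move=> PQ; rewrite /Prends [leLHS]big_mkcond /=.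
under [leRHS]eq_bigr do rewrite big_mkcond /=.
rewrite exchange_big; apply: ler_sum => m _.
case: ifPn => [/PQ[i Ji Qi]|_]; last first.
  by apply: sumr_ge0 => i _; case: ifP => // _; exact: ends_prob_ge0.
rewrite (bigD1 i)//= Qi lerDl; apply: sumr_ge0 => j _.
by case: ifP => // _; exact: ends_prob_ge0.
Qed.

(* Swapping the rows indexed by [A] between two independent copies of the
   outcome preserves the law of the pair. *)
Lemma Prends_indep (A : {set L}) (P Q : pred {ffun L -> {set L}}) :
  (forall m m' : {ffun L -> {set L}}, (forall x, x \in A -> m x = m' x) -> P m = P m') ->
  (forall m m' : {ffun L -> {set L}}, (forall x, x \notin A -> m x = m' x) -> Q m = Q m') ->
  Prends (fun m => P m && Q m) = Prends P * Prends Q.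
Proof.
move=> PA QA.
pose mix (m m' : {ffun L -> {set L}}) := [ffun x => if x \in A then m x else m' x].
have mixw m m' : ends_prob (mix m m') * ends_prob (mix m' m) = ends_prob m * ends_prob m'.
  rewrite /ends_prob -!big_split /=; apply: eq_bigr => x _; rewrite !ffunE.
  by case: (x \in A) => //; rewrite mulrC.
have mixK m m' : mix (mix m m') (mix m' m) = m.
  by apply/ffunP => x; rewrite !ffunE; case: (x \in A).
rewrite -[LHS]mulr1 -Prends1 /Prends !big_distrlr !pair_big_dep /=.
pose h (u : {ffun L -> {set L}} * {ffun L -> {set L}}) := (mix u.1 u.2, mix u.2 u.1).
have hK : involutive h by move=> [m m']; rewrite /h /= !mixK.
rewrite [RHS](reindex_inj (inv_inj hK)) /=.
apply: eq_big => [[m m']|[m m'] _] /=; last by rewrite mixw.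
rewrite andbT; congr (_ && _); first by apply: PA => x xA; rewrite ffunE xA.
by apply: QA => x xA; rewrite ffunE (negPf xA).
Qed.

End Model.

(** * The limiting cut of a subtree *)

Section Constants.
Variables (R : realType) (b : nat).
Hypothesis hb : (2 <= b)%N.

Local Notation B := (b%:R : R).
Local Notation kap := (@kap R b).

Definition kapoo : R := (B - 1) / B.
(** The sum of (1 - 1/b) b^(-2i) over i >= 0: the energy that a full subtree would have if all
    coefficients [kap] above it were 1. *)
Definition gratio : R := B / (B + 1).

Let B2 : 2 <= B. Proof. exact: B_ge2. Qed.
Let B0 : 0 < B. Proof. exact: B_gt0. Qed.
Let Bn0 : B != 0 := B_neq0 R hb.
Let Bp0 : B + 1 != 0. Proof. by rewrite gt_eqF// addr_gt0. Qed.
Let X0 k : 0 < B ^+ k := Bexp_gt0 R hb k.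
Let Xn0 k : B ^+ k != 0 := Bexp_neq0 R hb k.
Let X1 k : 1 <= B ^+ k. Proof. by rewrite exprn_ege1// ltW// (B_gt1 R hb). Qed.
Let BX1 k : 0 < B * B ^+ k - 1.
Proof. by rewrite subr_gt0 (lt_le_trans (B_gt1 R hb))// ler_peMr// ltW. Qed.
Let BXn k : B * B ^+ k - 1 != 0. Proof. by rewrite gt_eqF. Qed.

Lemma kapE k : kap k = (B - 1) / (B * B ^+ k - 1) * B ^+ k.
Proof. by rewrite /kap /mu exprS. Qed.

Lemma kap_oo k : kap k = kapoo + kapoo / (B * B ^+ k - 1).
Proof. by rewrite kapE /kapoo; field; rewrite BXn Bn0. Qed.

Lemma kapoo_gt0 : 0 < kapoo.
Proof. by rewrite divr_gt0//; have := B2; lra. Qed.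

Lemma gratio_gt0 : 0 < gratio. Proof. by rewrite divr_gt0// addr_gt0. Qed.

Lemma gratio_lt1 : gratio < 1.
Proof. by rewrite ltr_pdivrMr ?mul1r ?addr_gt0//; have := B2; lra. Qed.

Lemma kapoo_lt k : kapoo < kap k.
Proof. by rewrite kap_oo ltrDl divr_gt0 ?kapoo_gt0. Qed.

Lemma kap_gt0 k : 0 < kap k.
Proof. exact: lt_trans kapoo_gt0 (kapoo_lt k). Qed.

Lemma kapS_lt k : kap k.+1 < kap k.
Proof.
rewrite !kap_oo ltrD2l ltr_pM2l ?kapoo_gt0// ltf_pV2 ?posrE//.
by rewrite exprS ltrD2r ltr_pMl ?mulr_gt0// (B_gt1 R hb).
Qed.

Lemma le_kap k h : (k <= h)%N -> kap h <= kap k.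
Proof.
move=> kh; rewrite -(subnK kh); elim: (h - k)%N => [|d IH]; first by rewrite add0n.
by rewrite addSn (le_trans (ltW (kapS_lt _)) IH).
Qed.

Lemma kap_le1 k : kap k <= 1.
Proof.
apply: le_trans (le_kap (leq0n k)) _.
by rewrite kapE expr0 !mulr1 divff// subr_eq0 gt_eqF//; have := B2; lra.
Qed.

Lemma invB_lt1 : `|B^-1| < 1.
Proof. by rewrite ger0_norm ?invr_ge0 ?ltW// invf_lt1//; have := B2; lra. Qed.

Lemma cvg_invX : (B ^+ n)^-1 @[n --> \oo] --> 0.
Proof.
rewrite (_ : (fun n => _) = (fun n => B^-1 ^+ n)); last first.
  by apply/funext => n; rewrite exprVn.
exact: cvg_expr invB_lt1.
Qed.

Lemma kap_cvg : kap k @[k --> \oo] --> kapoo.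
Proof.
apply: (@squeeze_cvgr _ _ _ _ (fun=> kapoo) (fun k => kapoo + kapoo * (B ^+ k)^-1)).
- apply: nearW => k; rewrite (ltW (kapoo_lt k)) /= kap_oo lerD2l ler_pM2l ?kapoo_gt0//.
  by rewrite lef_pV2 ?posrE//; have := X1 k; have := B2; nra.
- exact: cvg_cst.
- rewrite -[X in _ --> X]addr0; apply: cvgD; first exact: cvg_cst.
  by rewrite -[X in _ --> X](mulr0 kapoo); apply: cvgMr; exact: cvg_invX.
Qed.

(** A tail of that geometric series, so that consecutive differences are (1 - 1/b) b^(-2h). The
    ancestor at height h+1 of a full subtree of height k contributes [kap h] times this difference
    times b^(2k). *)
Definition geo_tail h : R := gratio / (B ^+ h) ^+ 2.
Definition cut_term h : R := kap h * (geo_tail h - geo_tail h.+1).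
Definition cut_partial n : R := \sum_(h < n) cut_term h.
Definition cut_total : R := limn cut_partial.
Definition cutoo k : R := (B ^+ k) ^+ 2 * (cut_total - cut_partial k).
(* The energy of the leaves below a vertex of height [k] in the tree of height
   [n]; [cutoo k] is its limit [c_k]. *)
Definition cutn k n : R := (B ^+ k) ^+ 2 * (cut_partial n - cut_partial k).

Lemma geo_tailS h : geo_tail h.+1 < geo_tail h.
Proof.
rewrite /geo_tail ltr_pM2l ?gratio_gt0// ltf_pV2 ?posrE ?exprn_gt0// [B ^+ h.+1]exprS.
by rewrite exprMn ltr_pMl ?exprn_gt0// exprn_egt1// (B_gt1 R hb).
Qed.

Lemma cut_termE h : (B ^+ h) ^+ 2 * cut_term h = kap h * (1 - B^-1).
Proof. by rewrite /cut_term /geo_tail /gratio [B ^+ h.+1]exprS; field; rewrite Bn0 Xn0 Bp0. Qed.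

Lemma cut_term_gt0 h : 0 < cut_term h.
Proof. by rewrite mulr_gt0 ?kap_gt0// subr_gt0 geo_tailS. Qed.

Lemma cut_partialS n : cut_partial n.+1 = cut_partial n + cut_term n.
Proof. by rewrite /cut_partial big_ord_recr. Qed.

Lemma cut_partial_homo : {homo cut_partial : n m / (n <= m)%N >-> n <= m}.
Proof.
move=> n m nm; rewrite -(subnK nm); elim: (m - n)%N => [|d IH]; first by rewrite add0n.
by rewrite addSn cut_partialS (le_trans IH)// lerDl ltW// cut_term_gt0.
Qed.

Lemma cut_partial_le k d :
  cut_partial (d + k) - cut_partial k <= kap k * (geo_tail k - geo_tail (d + k)).
Proof.
elim: d => [|d IH]; first by rewrite !add0n !subrr mulr0.
rewrite addSn cut_partialS; have := le_kap (leq_addl d k); have := geo_tailS (d + k).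
rewrite /cut_term; have := B2; nra.
Qed.

Lemma cut_partial_ge k d :
  kapoo * (geo_tail k - geo_tail (d + k)) <= cut_partial (d + k) - cut_partial k.
Proof.
elim: d => [|d IH]; first by rewrite !add0n !subrr mulr0.
rewrite addSn cut_partialS; have := kapoo_lt (d + k); have := geo_tailS (d + k).
rewrite /cut_term; have := B2; nra.
Qed.

Lemma geo_tail_ge0 k : 0 <= geo_tail k.
Proof. by rewrite divr_ge0 ?exprn_ge0 ?ltW ?gratio_gt0. Qed.

Lemma cut_partial_cvg : cvgn cut_partial.
Proof.
apply: nondecreasing_is_cvgn; first exact: cut_partial_homo.
exists (kap 0 * geo_tail 0) => _ [n _ <-].
have := cut_partial_le 0 n; rewrite addn0 {2}/cut_partial big_ord0 subr0 => /le_trans; apply.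
by rewrite ler_pM2l ?kap_gt0// gerBl geo_tail_ge0.
Qed.

Lemma cut_total_le k : cut_total - cut_partial k <= kap k * geo_tail k.
Proof.
rewrite lerBlDr; apply: limr_le; first exact: cut_partial_cvg.
near=> n; have kn : (k <= n)%N by near: n; exists k.
have := cut_partial_le k (n - k); rewrite subnK// lerBlDr => /le_trans; apply.
by rewrite lerD2r ler_pM2l ?kap_gt0// gerBl geo_tail_ge0.
Unshelve. all: by end_near. Qed.

Lemma cut_total_ge k : kapoo * geo_tail k <= cut_total - cut_partial k.
Proof.
rewrite lerBrDr.
have : kapoo * (geo_tail k - geo_tail n) + cut_partial k @[n --> \oo] -->
    kapoo * (geo_tail k - 0) + cut_partial k.
  apply: cvgD; last exact: cvg_cst.
  apply: cvgMr; apply: cvgB; first exact: cvg_cst.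
  rewrite /geo_tail -[X in _ --> X](mulr0 gratio); apply: cvgMr.
  rewrite (_ : (fun n => _) = (fun n => (B ^+ n)^-1 * (B ^+ n)^-1)); last first.
    by apply/funext => n; rewrite expr2 invfM.
  by rewrite -[X in _ --> X](mulr0 0); apply: cvgM; exact: cvg_invX.
rewrite subr0 => h; apply: (ler_cvg_to h cut_partial_cvg).
near=> n; have kn : (k <= n)%N by near: n; exists k.
by have := cut_partial_ge k (n - k); rewrite subnK// lerBrDr.
Unshelve. all: by end_near. Qed.

Lemma cutoo_le k : cutoo k <= gratio * kap k.
Proof.
have := cut_total_le k; rewrite -(ler_pM2l (exprn_gt0 2 (X0 k))) => /le_trans; apply.
by rewrite /geo_tail le_eqVlt; apply/orP; left; apply/eqP; field.
Qed.

Lemma cutoo_ge k : gratio * kapoo <= cutoo k.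
Proof.
have := cut_total_ge k; rewrite -(ler_pM2l (exprn_gt0 2 (X0 k))); apply: le_trans.
by rewrite /geo_tail le_eqVlt; apply/orP; left; apply/eqP; field.
Qed.

Lemma cutoo_gt0 k : 0 < cutoo k.
Proof. by apply: lt_le_trans (cutoo_ge k); rewrite mulr_gt0 ?gratio_gt0 ?kapoo_gt0. Qed.

(** The first term belongs to the parent; from further up, the set looks like the parent's subtree
    filled with density 1/b. *)
Lemma cutoo_rec k : cutoo k = kap k * (1 - B^-1) + cutoo k.+1 / B ^+ 2.
Proof.
rewrite -cut_termE /cutoo cut_partialS [B ^+ k.+1]exprS; field.
by rewrite Bn0.
Qed.

Lemma cutoo_lt k : cutoo k < gratio * kap k.
Proof.
rewrite cutoo_rec; apply: (@lt_le_trans _ _ (kap k * (1 - B^-1) + gratio * kap k / B ^+ 2)).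
  rewrite ltrD2l ltr_pM2r ?invr_gt0 ?exprn_gt0//; apply: le_lt_trans (cutoo_le _) _.
  by rewrite ltr_pM2l ?gratio_gt0// kapS_lt.
by rewrite le_eqVlt; apply/orP; left; apply/eqP; rewrite /gratio; field; rewrite Bn0 Bp0.
Qed.

Lemma cutoo_lt_kap k : cutoo k < kap k.
Proof.
apply: lt_trans (cutoo_lt k) _; rewrite -[ltRHS]mul1r ltr_pM2r ?kap_gt0//.
exact: gratio_lt1.
Qed.

(** The difference is a positive multiple of [gratio * kap k - cutoo k.+1], and [kap] decreases
    strictly. This is what makes the thresholds strictly increasing. *)
Lemma cutoo_dec k : cutoo k.+1 < cutoo k.
Proof.
have h : cutoo k.+1 < gratio * kap k.
  by apply: le_lt_trans (cutoo_le _) _; rewrite ltr_pM2l ?gratio_gt0// kapS_lt.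
rewrite [cutoo k]cutoo_rec -subr_gt0.
have -> : kap k * (1 - B^-1) + cutoo k.+1 / B ^+ 2 - cutoo k.+1 =
    (1 - B^-1 ^+ 2) * (gratio * kap k - cutoo k.+1).
  by rewrite /gratio; field; rewrite Bn0 Bp0.
rewrite mulr_gt0 ?subr_gt0// exprVn invf_lt1 ?exprn_gt0//; have := B2; nra.
Qed.

Lemma cutoo_cvg : cutoo k @[k --> \oo] --> gratio * kapoo.
Proof.
apply: (@squeeze_cvgr _ _ _ _ (fun=> gratio * kapoo) (fun k => gratio * kap k)).
- by apply: nearW => k; rewrite cutoo_ge cutoo_le.
- exact: cvg_cst.
- by apply: cvgMr; exact: kap_cvg.
Qed.

(** The finite height costs a term of order b^(-2n), negligible even after multiplication by
    lambda. *)
Lemma cutnE k n : cutn k n = cutoo k - (B ^+ k) ^+ 2 / (B ^+ n) ^+ 2 * cutoo n.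
Proof. by rewrite /cutn /cutoo; field. Qed.

Lemma cutn_le k n : cutn k n <= cutoo k.
Proof.
by rewrite cutnE gerBl mulr_ge0 ?divr_ge0 ?exprn_ge0 ?(ltW (cutoo_gt0 _))// ltW.
Qed.

Lemma cutnS k n : cutn k n.+1 = cutn k n + (B ^+ k) ^+ 2 * cut_term n.
Proof. by rewrite /cutn cut_partialS; ring. Qed.

Lemma cutn_ge0 k n : (k <= n)%N -> 0 <= cutn k n.
Proof. by move=> kn; rewrite mulr_ge0 ?exprn_ge0 ?(ltW (X0 _))// subr_ge0 cut_partial_homo. Qed.

End Constants.

(** * Functions supported below a single vertex *)

Section Lift.
Variables (R : realType) (b : nat).
Hypothesis hb : (2 <= b)%N.
Local Notation word := (seq 'I_b).
Local Notation B := (b%:R : R).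
Implicit Types (f g : word -> R) (u w : word).

Fixpoint lift_at u g w : R :=
  match u, w with
  | [::], _ => g w
  | i :: u', j :: w' => if i == j then lift_at u' g w' else 0
  | _, _ => 0
  end.

Lemma mean0 n : mean n ((fun=> 0) : word -> R) = 0 :> R.
Proof. by rewrite /mean (wsum0 R b) mul0r. Qed.

Lemma energy0 n : energy n ((fun=> 0) : word -> R) = 0.
Proof.
elim: n => [//|n IH] /=; rewrite big1 => [|i _]; last exact: IH.
by rewrite big1 ?mulr0 ?addr0// => i _; rewrite /pre !mean0 subrr expr0n.
Qed.

Lemma energyS n f : energy n.+1 f = \sum_(i < b) energy n (pre i f)
    + kap R b n * \sum_(i < b) (mean n (pre i f) - mean n.+1 f) ^+ 2.
Proof. by []. Qed.

Lemma pre_lift i j u g :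
  pre i (lift_at (j :: u) g) = if j == i then lift_at u g else fun=> 0.
Proof. by apply/funext => w; rewrite /pre /=; case: ifP. Qed.

Lemma mean_lift u g k : mean (size u + k) (lift_at u g) = mean k g / B ^+ size u.
Proof.
elim: u => [|j u IH]; first by rewrite add0n expr0 divr1.
rewrite addSn meanS (bigD1 j)//= pre_lift eqxx big1 => [|i ij].
  by rewrite addr0 IH exprSr invfM mulrA.
by rewrite pre_lift eq_sym (negPf ij) mean0.
Qed.

(** On the path above the subtree a single child carries mass at each level, so the outer levels see
    [g] through its mean alone. *)
Lemma energy_lift u g k : energy (size u + k) (lift_at u g) =
  energy k g + cutn R b k (size u + k) * mean k g ^+ 2.
Proof.
elim: u => [|j u IH]; first by rewrite add0n /cutn subrr mulr0 mul0r addr0.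
rewrite -[(size (j :: u) + k)%N]/(size u + k).+1 energyS var_mean//.
rewrite !(bigD1 j (P := xpredT))//= pre_lift eqxx.
rewrite big1 => [|i ij]; last by rewrite pre_lift eq_sym (negPf ij) energy0.
rewrite big1 => [|i ij]; last by rewrite pre_lift eq_sym (negPf ij) mean0 expr0n.
rewrite !addr0 -[(size u + k).+1]/(size (j :: u) + k)%N.
rewrite [mean _ (lift_at (j :: u) g)](mean_lift (j :: u)) mean_lift IH.
rewrite -[(size (j :: u) + k)%N]/(size u + k).+1 cutnS.
rewrite mulrDl -addrA; congr (_ + (_ + _)).
have -> : (B ^+ k) ^+ 2 * cut_term R b (size u + k) =
    (B ^+ k) ^+ 2 / (B ^+ (size u + k)) ^+ 2 * (kap R b (size u + k) * (1 - B^-1)).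
  by rewrite -cut_termE//; field; rewrite Bexp_neq0.
rewrite exprD [size (j :: u)]/= [B ^+ (size u).+1]exprS; field.
by rewrite !Bexp_neq0// B_neq0.
Qed.

End Lift.

(** * Energy of sets of leaves *)

Section LeafSets.
Variables (R : realType) (b : nat).
Hypothesis hb : (2 <= b)%N.
Local Notation word := (seq 'I_b).
Local Notation B := (b%:R : R).

Implicit Types (f g : word -> R) (w : word).

(* Sets of leaves of the tree of height [h]: the tree structure is kept so that
   sums over leaf sets factor over the children of the apex. *)
Fixpoint leafset h : finType := if h is h'.+1 then {ffun 'I_b -> leafset h'} else bool.

Fixpoint dec h : leafset h -> word -> bool :=
  match h return leafset h -> word -> bool with
  | 0%N => fun S _ => S
  | h'.+1 => fun S w => if w is i :: w' then dec (S i) w' else false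
  end.

Fixpoint enc h (P : word -> bool) : leafset h :=
  match h return leafset h with
  | 0%N => P [::]
  | h'.+1 => [ffun i => enc h' (fun w => P (i :: w))]
  end.

Lemma decK h (P : word -> bool) w : size w = h -> dec (enc h P) w = P w.
Proof.
elim: h P w => [|h IH] P [|i w] //= [sw].
by rewrite ffunE IH.
Qed.

Definition rfun h (S : leafset h) : word -> R := fun w => (dec S w)%:R.
Definition density h (S : leafset h) : R := mean h (rfun S).

Lemma densityS h (S : leafset h.+1) : density S = (\sum_i density (S i)) / B.
Proof. by rewrite /density meanS. Qed.

Lemma sum_density h (S : leafset h.+1) : \sum_i density (S i) = B * density S.
Proof. by rewrite densityS mulrC divfK// B_neq0. Qed.

Lemma density0E (S : leafset 0) : density S = (S : bool)%:R.
Proof. by rewrite /density /mean /= expr0 divr1. Qed.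

Lemma density_ge0 h (S : leafset h) : 0 <= density S.
Proof.
by rewrite divr_ge0 ?(ltW (Bexp_gt0 R hb _))// wsum_ge0// => w _; exact: ler0n.
Qed.

Lemma density_le1 h (S : leafset h) : density S <= 1.
Proof.
rewrite ler_pdivrMr ?Bexp_gt0// mul1r -[leRHS]mulr1 -(@wsum_cst R b).
by apply: le_wsum => w _; rewrite lern1 leq_b1.
Qed.

Lemma density_pos_ex h (S : leafset h.+1) : 0 < density S -> exists i, 0 < density (S i).
Proof.
rewrite densityS pmulr_lgt0 ?invr_gt0 ?B_gt0// => h0.
have [/existsP//|/existsPn n0] := boolP [exists i, 0 < density (S i)].
move: h0; rewrite big1 ?ltxx// => i _.
by apply/eqP; rewrite eq_le density_ge0 andbT leNgt.
Qed.

Lemma density_lb h (S : leafset h) : 0 < density S -> (B ^+ h)^-1 <= density S.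
Proof.
elim: h S => [|h IH] S; first by rewrite density0E expr0 invr1; case: S; rewrite //= ltxx.
move=> /density_pos_ex[i /IH hi]; rewrite densityS exprSr invfM ler_pM2r ?invr_gt0 ?B_gt0//.
by rewrite (bigD1 i)//= (le_trans hi)// lerDl sumr_ge0// => j _; exact: density_ge0.
Qed.

Fixpoint compl h : leafset h -> leafset h :=
  match h return leafset h -> leafset h with
  | 0%N => negb
  | h'.+1 => fun S => [ffun i => compl (S i)]
  end.

Lemma complK h : involutive (@compl h).
Proof.
elim: h => [|h IH] S; first exact: negbK.
by apply/ffunP => i; rewrite /= !ffunE IH.
Qed.

Lemma dec_compl h (S : leafset h) w : size w = h -> dec (compl S) w = ~~ dec S w.
Proof. by elim: h S w => [|h IH] S [|i w] //= [sw]; rewrite ffunE IH. Qed.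

Lemma rfun_compl h (S : leafset h) w : size w = h -> rfun (compl S) w = 1 - rfun S w.
Proof. by move=> sw; rewrite /rfun dec_compl//; case: dec; rewrite ?subrr ?subr0. Qed.

Lemma density_compl h (S : leafset h) : density (compl S) = 1 - density S.
Proof.
rewrite /density (eq_mean (rfun_compl S)) /mean wsumB wsum_cst mulr1 mulrBl divff//.
by rewrite Bexp_neq0.
Qed.

Lemma density0_inj h (S S' : leafset h) : density S = 0 -> density S' = 0 -> S = S'.
Proof.
elim: h S S' => [|h IH] S S'.
  by rewrite !density0E; case: S; case: S' => //=; have /eqP := oner_neq0 R.
have H (U : leafset h.+1) : density U = 0 -> forall i, density (U i) = 0.
  rewrite densityS => /eqP; rewrite mulf_eq0 invr_eq0 (negPf (B_neq0 R hb)) orbF.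
  by rewrite psumr_eq0 => [/allP e i|i _]; [apply/eqP/e; rewrite mem_index_enum|exact: density_ge0].
by move=> /H hS /H hS'; apply/ffunP => i; apply: IH.
Qed.

Lemma density1_inj h (S S' : leafset h) : density S = 1 -> density S' = 1 -> S = S'.
Proof.
move=> h1 h2; apply: (can_inj (@complK h)); apply: density0_inj;
by rewrite density_compl ?h1 ?h2 subrr.
Qed.

Definition emptyS h : leafset h := enc h (fun=> false).

Lemma density_empty h : density (emptyS h) = 0.
Proof.
rewrite /density (@eq_mean _ _ _ _ (fun=> 0)) ?mean0// => w sw.
by rewrite /rfun decK.
Qed.

(* Comparing with [kapoo * unit_energy] makes the coefficients the same at all
   heights, so that the recursion below is stationary. *)
Fixpoint unit_energy n (f : word -> R) : R :=
  if n is n'.+1 then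
    \sum_(i < b) unit_energy n' (pre i f) + \sum_(i < b) (mean n' (pre i f) - mean n f) ^+ 2
  else 0.

Lemma energy_ge_unit_energy n f : kapoo R b * unit_energy n f <= energy n f.
Proof.
elim: n f => [|n IH] f /=; first by rewrite mulr0.
rewrite mulrDr mulr_sumr lerD ?ler_sum// ler_wpM2r ?(ltW (kapoo_lt R hb _))//.
by apply: sumr_ge0 => i _; exact: sqr_ge0.
Qed.

Lemma unit_energy_ge0 n f : 0 <= unit_energy n f.
Proof.
elim: n f => [//|n IH] f /=; rewrite addr_ge0 ?sumr_ge0// => i _; exact: sqr_ge0.
Qed.

Lemma energy_ge0 n f : 0 <= energy n f.
Proof.
apply: le_trans (energy_ge_unit_energy n f).
by rewrite mulr_ge0 ?unit_energy_ge0// ltW// kapoo_gt0.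
Qed.

Lemma eq_unit_energy n f g : (forall w, size w = n -> f w = g w) -> unit_energy n f = unit_energy n g.
Proof.
elim: n f g => [//|n IH] f g fg /=.
have pfg i w : size w = n -> pre i f w = pre i g w.
  by move=> sw; apply: fg; rewrite /= sw.
rewrite (eq_mean fg); congr (_ + _); apply: eq_bigr => i _.
  by apply: IH => w; exact: pfg.
by rewrite (@eq_mean _ _ n _ (pre i g))// => w; exact: pfg.
Qed.

Lemma unit_energy_compl n f : unit_energy n (fun w => 1 - f w) = unit_energy n f.
Proof.
elim: n f => [//|n IH] f /=.
have mc m g : mean m (fun w => 1 - g w) = 1 - mean m g.
  by rewrite /mean wsumB wsum_cst mulr1 mulrBl divff ?Bexp_neq0.
congr (_ + _); apply: eq_bigr => i _; first exact: (IH (pre i f)).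
rewrite (mc n.+1) -[mean n (pre i _)]/(mean n (fun w => 1 - pre i f w)) mc.
ring.
Qed.

Definition set_unit_energy h (S : leafset h) : R := unit_energy h (rfun S).

Lemma set_unit_energy_compl h (S : leafset h) : set_unit_energy (compl S) = set_unit_energy S.
Proof. by rewrite /set_unit_energy (eq_unit_energy (rfun_compl S)) unit_energy_compl. Qed.

Lemma set_unit_energyS h (S : leafset h.+1) : set_unit_energy S = \sum_i set_unit_energy (S i) +
  (\sum_i density (S i) ^+ 2 - B * density S ^+ 2).
Proof. by rewrite /set_unit_energy /= var_mean. Qed.

(* The energy of [S] placed below a vertex of height [h] in an infinite tree that
   carries no other leaf of the set. *)
Definition outer_energy h (S : leafset h) : R := set_unit_energy S + gratio R b * density S ^+ 2.

(** This value of [gratio] leaves only products of distinct child densities as the interaction. With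
    one occupied child they vanish, and the outer energy is unchanged from child to parent. *)
Lemma outer_energyS h (S : leafset h.+1) : outer_energy S = \sum_i outer_energy (S i) -
  (1 - gratio R b) * ((\sum_i density (S i)) ^+ 2 - \sum_i density (S i) ^+ 2).
Proof.
rewrite /outer_energy set_unit_energyS big_split /= -mulr_sumr sum_density /gratio; field.
by rewrite gt_eqF// addr_gt0// B_gt0.
Qed.

Lemma set_unit_energy_density0 h (S : leafset h) : density S = 0 -> set_unit_energy S = 0.
Proof.
move=> d0; rewrite (density0_inj d0 (density_empty h)) /set_unit_energy.
rewrite (@eq_unit_energy _ _ (fun=> 0)) => [|w sw]; last by rewrite /rfun decK.
elim: h {S d0} => [//|h IH] /=.
have m0 m : mean m ((fun=> 0) : word -> R) = 0 by exact: mean0.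
rewrite big1 => [|i _]; last exact: IH.
by rewrite big1 ?addr0// => i _; rewrite /pre !m0 subrr expr0n.
Qed.

Lemma set_unit_energy_density1 h (S : leafset h) : density S = 1 -> set_unit_energy S = 0.
Proof. by move=> d; rewrite -set_unit_energy_compl set_unit_energy_density0// density_compl d subrr. Qed.

Lemma outer_energy_density0 h (S : leafset h) : density S = 0 -> outer_energy S = 0.
Proof. by move=> d; rewrite /outer_energy set_unit_energy_density0// d expr0n mulr0 addr0. Qed.

Definition set_energy h (S : leafset h) : R := energy h (rfun S).

(* The subtree cut is the cheapest one among the nonempty sets of leaves below
   a vertex of height [k]; [M] children carrying leaves of [S] cost at least
   [M c_k - (kap - c_k) M (M - 1)], which is concave in [M]. *)
Lemma set_energy_ge k (S : leafset k) : 0 < density S ->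
  cutoo R b k <= set_energy S + cutoo R b k * density S ^+ 2 /\
  (density S < 1 -> cutoo R b k < set_energy S + cutoo R b k * density S ^+ 2).
Proof.
elim: k S => [|k IH] S.
  rewrite density0E /set_energy /= add0r; case: S => /=; last by rewrite ltxx.
  by rewrite expr1n mulr1 !ltxx.
move=> dS.
pose a i := density (S i); pose I := [set i | 0 < a i]%SET.
have a0 i : 0 <= a i by exact: density_ge0.
have a1 i : a i <= 1 by exact: density_le1.
pose K := kap R b k; pose c := cutoo R b k; pose M : R := #|I|%:R.
have Kc : 0 < K - c by rewrite subr_gt0 cutoo_lt_kap.
have M1 : 1 <= M.
  have [i ai] := density_pos_ex dS.
  by rewrite ler1n; apply/card_gt0P; exists i; rewrite inE.
have MB : M <= B by rewrite ler_nat -[leqRHS](card_ord b) max_card.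
pose s := \sum_i a i.
have sE : s = B * density S by rewrite -sum_density.
have outI i : i \notin I -> a i = 0.
  by rewrite inE -leNgt => h; apply/eqP; rewrite eq_le h a0.
have e_ge : \sum_i set_energy (S i) >= \sum_(i in I) c * (1 - a i ^+ 2).
  rewrite [leLHS]big_mkcond; apply: ler_sum => i _; case: ifPn => iI.
    rewrite inE in iI; have [h _] := IH _ iI.
    by rewrite mulrBr mulr1 lerBlDr.
  exact: energy_ge0.
have sI : s = \sum_(i in I) a i.
  by rewrite [RHS]big_mkcond; apply: eq_bigr => i _; case: ifPn => // /outI.
have s2I : \sum_i a i ^+ 2 = \sum_(i in I) a i ^+ 2.
  rewrite [RHS]big_mkcond; apply: eq_bigr => i _; case: ifPn => // /outI ->.
  by rewrite expr0n.
have card1 i : i \in I -> \sum_(j in I | j != i) 1 = M - 1 :> R.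
  move=> iI; rewrite /M -sum1_card natr_sum [X in _ = X - _](bigD1 i)//=.
  by rewrite addrAC subrr add0r.
have others i : i \in I -> 0 <= s - a i <= M - 1.
  move=> iI; rewrite sI (bigD1 i)//= addrC addrK sumr_ge0//=.
  by rewrite -(card1 i iI); exact: ler_sum.
have cross : s ^+ 2 - \sum_i a i ^+ 2 = \sum_(i in I) a i * (s - a i).
  rewrite expr2 {1}sI s2I mulr_suml -sumrB; apply: eq_bigr => i _.
  by rewrite mulrBr expr2.
have term i : i \in I -> a i * (s - a i) <= M - 1.
  move=> /others /andP[h1 h2]; apply: le_trans h2.
  by rewrite ler_piMl.
have cross_le : \sum_(i in I) a i * (s - a i) <= M * (M - 1).
  by apply: le_trans (ler_sum _ term) _; rewrite sumr_const -mulr_natl.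
pose c' := cutoo R b k.+1.
have rec : c = K * (1 - B^-1) + c' / B ^+ 2 by exact: cutoo_rec.
(* The lower bound is an equality at M = B, the case of full children. *)
have rec' : c' = B * c - (K - c) * (B * (B - 1)).
  by rewrite rec; field; rewrite B_neq0.
have tot_ge : c * M - (K - c) * (s ^+ 2 - \sum_i a i ^+ 2) <=
    set_energy S + c' * density S ^+ 2.
  rewrite /set_energy energyS var_mean//.
  have -> : c' * density S ^+ 2 = (B * c - (K - c) * (B * (B - 1))) * density S ^+ 2.
    by rewrite rec'.
  rewrite -[\sum_i energy _ _]/(\sum_i set_energy (S i)).
  rewrite -[\sum_i mean k _ ^+ 2]/(\sum_i a i ^+ 2) -/(density S) -/K.
  move: e_ge; rewrite -mulr_sumr sumrB sumr_const -s2I -/M sE => e_ge.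
  rewrite -addrA; apply: le_trans (lerD e_ge (lexx _)).
  rewrite le_eqVlt; apply/orP; left; apply/eqP; ring.
(* The excess of the bound over [c'] is this factor times B - M. Positivity is worst at M = 1, where
   it is exactly [cutoo_lt]. *)
have slope : 0 < (K - c) * (B + M - 1) - c.
  have Bp : 0 < B + 1 by rewrite addr_gt0// B_gt0.
  have := cutoo_lt R hb k; rewrite /gratio mulrAC (ltr_pdivlMr _ _ Bp) -/K -/c => h.
 have -> : (K - c) * (B + M - 1) - c =
      (B * K - c * (B + 1)) + (K - c) * (M - 1) by ring.
  apply: ltr_wpDr; last by rewrite subr_gt0.
  by apply: mulr_ge0; [exact: ltW | rewrite subr_ge0].
have gM : c * M - (K - c) * (M * (M - 1)) - c' =
    (B - M) * ((K - c) * (B + M - 1) - c) by rewrite rec'; ring.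
have base : c' <= c * M - (K - c) * (M * (M - 1)).
  by rewrite -subr_ge0 gM; apply: mulr_ge0; [rewrite subr_ge0 | exact: ltW].
split.
  apply: le_trans tot_ge; apply: le_trans base _.
  by rewrite lerD2l lerN2 ler_pM2l// cross.
move=> dS1; apply: lt_le_trans tot_ge; rewrite cross.
(* Strictness comes from [slope] if some child is empty; otherwise some child has density below 1
   and makes its own cross term strict. *)
have [MltB|BleM] := ltP M B.
  apply: (@lt_le_trans _ _ (c * M - (K - c) * (M * (M - 1)))).
    by rewrite -subr_gt0 gM; apply: mulr_gt0 => //; rewrite subr_gt0.
  by rewrite lerD2l lerN2 ler_pM2l.
apply: le_lt_trans base _; rewrite ltrD2l ltrN2 ltr_pM2l//.
have MeqB : M = B by apply/eqP; rewrite eq_le MB BleM.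
have [i ai] : exists i, a i < 1.
  have [/existsP//|/existsPn n1] := boolP [exists i, a i < 1].
  suff : density S = 1 by move=> e; rewrite e ltxx in dS1.
  rewrite densityS (eq_bigr (fun=> 1)) => [|i _]; last first.
    by apply/eqP; rewrite eq_le a1 leNgt n1.
  by rewrite sumr_const card_ord divff// B_neq0.
have iI : i \in I.
  apply/negPn/negP => ni; have : (#|I| < #|[set: 'I_b]%SET|)%N.
    by apply: proper_card; apply/properP; split; [exact: finset.subsetT|exists i].
  by rewrite cardsT card_ord -(ltr_nat R) -/M MeqB ltxx.
rewrite (bigD1 i)//= [X in _ < X](_ : _ = (M - 1) + (M - 1) * (M - 1)); last by ring.
apply: ltr_leD.
  have /andP[h1 h2] := others _ iI.
  apply: (@le_lt_trans _ _ (a i * (M - 1))); first by rewrite ler_wpM2l.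
  by rewrite -[ltRHS]mul1r ltr_pM2r// subr_gt0 MeqB B_gt1.
apply: (@le_trans _ _ (\sum_(j in I | j != i) (M - 1))).
  by apply: ler_sum => j /andP[jI _]; exact: term.
have -> : \sum_(j in I | j != i) (M - 1) = (\sum_(j in I | j != i) 1) * (M - 1).
  by rewrite mulr_suml; apply: eq_bigr => j _; rewrite mul1r.
by rewrite card1.
Qed.

Lemma fin_gap (T : finType) (P : pred T) (phi : T -> R) :
  (forall t, P t -> 0 < phi t) ->
  exists2 d, 0 < d & forall t, P t -> d <= phi t.
Proof.
(* The reciprocal of a sum of reciprocals lies below every value; the added 1 covers an empty
   [P]. *)
move=> h; exists ((\sum_(t | P t) (phi t)^-1 + 1)^-1).
  by rewrite invr_gt0 ltr_wpDl// sumr_ge0// => t /h ht; rewrite invr_ge0 ltW.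
move=> t Pt; rewrite -[leRHS]invrK lef_pV2 ?posrE ?invr_gt0 ?h//; last first.
  by rewrite ltr_wpDl// sumr_ge0// => u /h ht; rewrite invr_ge0 ltW.
rewrite (bigD1 t)//= -addrA lerDl addr_ge0// sumr_ge0// => u /andP[/h ht _].
by rewrite invr_ge0 ltW.
Qed.

Lemma set_energy_gap k : exists2 d, 0 < d & forall S : leafset k, 0 < density S < 1 ->
  cutoo R b k + d <= set_energy S + cutoo R b k * density S ^+ 2.
Proof.
have [|d d0 H] := @fin_gap (leafset k) (fun S => 0 < density S < 1)
   (fun S => set_energy S + cutoo R b k * density S ^+ 2 - cutoo R b k).
  by move=> S /andP[h1 h2]; rewrite subr_gt0; apply: (set_energy_ge h1).2.
by exists d => // S /H; rewrite lerBrDl.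
Qed.

End LeafSets.

(** * The sum over all sets of leaves *)

Section Partition.
Variables (R : realType) (b : nat).
Hypothesis hb : (2 <= b)%N.
Local Notation B := (b%:R : R).
Local Notation q := (gratio R b).
Local Notation leafset := (leafset b).

Variables (n : nat) (T beta : R).
Hypothesis beta01 : 0 <= beta <= 1.
Hypothesis T0 : 0 <= T.
(** The price of a gap [g] in energy must pay for a density [a]. For thin sets [g] is close to 1 and
    the exponential has to beat the least density b^(-n), which is the supercritical condition; for
    thick sets any fixed positive gap suffices. *)
Hypothesis decay : forall a g : R, (B ^+ n)^-1 <= a <= 1 ->
  1 - 2 * a <= g -> 8^-1 <= g -> expR (- (T * q * g)) <= beta * a.

Let D h (S : leafset h) : R := density R S.

(** The density offsets the b choices for a single occupied child, and the shift by [q] gives the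
    full set weight 1. *)
Definition omega h (S : leafset h) : R := D S * expR (- (T * (outer_energy R S - q))).

(** The cap is forced: when S is full, the cross products eat up the whole cost of a further
    occupied child. Up to density 3/4 a gap of 1/8 remains, and heavier sets are exchanged for their
    complements. *)
Definition light_sum h : R := \sum_(S : leafset h | 0 < D S <= 3 / 4) omega S.
Definition full_sum h : R := \sum_(S : leafset h | 0 < D S) omega S.

Let B2 : 2 <= B. Proof. exact: B_ge2. Qed.
Let B0 : 0 < B. Proof. exact: B_gt0. Qed.
Let Bp : 0 < B + 1. Proof. exact: addr_gt0. Qed.
Let D0 h (S : leafset h) : 0 <= D S. Proof. exact: density_ge0. Qed.
Let D1 h (S : leafset h) : D S <= 1. Proof. exact: density_le1. Qed.

Lemma omega_ge0 h (S : leafset h) : 0 <= omega S.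
Proof. by rewrite mulr_ge0 ?expR_ge0. Qed.

Lemma light_sum_ge0 h : 0 <= light_sum h.
Proof. by apply: sumr_ge0 => S _; exact: omega_ge0. Qed.

Lemma full_sum_ge0 h : 0 <= full_sum h.
Proof. by apply: sumr_ge0 => S _; exact: omega_ge0. Qed.

Lemma density_range h (S : leafset h) : (h <= n)%N -> 0 < D S -> (B ^+ n)^-1 <= D S <= 1.
Proof.
move=> hn d0; rewrite D1 andbT; apply: le_trans (density_lb hb d0).
by rewrite lef_pV2 ?posrE ?exprn_gt0// ler_weXn2l// ltW// (B_gt1 R hb).
Qed.

Lemma omega_full h (S : leafset h) : D S = 1 -> omega S = 1.
Proof.
move=> d; rewrite /omega d mul1r /outer_energy set_unit_energy_density1// -/(D S) d.
rewrite expr1n mulr1 add0r.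
by rewrite subrr mulr0 oppr0 expR0.
Qed.

(** Complementation preserves [unit_energy]; only the boundary term changes, and the heavy set pays
    an extra q (1 - 2a), with a < 1/4 the density of the complement. *)
Lemma omega_compl h (S : leafset h) : (h <= n)%N -> 3 / 4 < D S -> D S < 1 ->
  omega S <= beta * omega (compl S).
Proof.
move=> hn d34 d1; have dc : D (compl S) = 1 - D S by exact: density_compl.
have e : outer_energy R S - q = (outer_energy R (compl S) - q) + q * (1 - 2 * D (compl S)).
  by rewrite /outer_energy set_unit_energy_compl// -/(D _) -/(D _) dc; ring.
rewrite /omega e; set tc := outer_energy R _ - q; set x := 1 - _.
have -> : expR (- (T * (tc + q * x))) = expR (- (T * q * x)) * expR (- (T * tc)).
  by rewrite -expRD; congr expR; ring.
rewrite (mulrA (D S)) (mulrA beta) ler_wpM2r ?expR_ge0//.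
apply: (@le_trans _ _ (expR (- (T * q * x)))); first by rewrite -[leRHS]mul1r ler_wpM2r ?expR_ge0.
apply: decay => //; last by rewrite /x dc; lra.
by apply: density_range; rewrite // dc subr_gt0.
Qed.

Lemma full_sum_le h : (h <= n)%N -> full_sum h <= 1 + (1 + beta) * light_sum h.
Proof.
move=> hn; rewrite /full_sum (bigID (fun S => D S <= 3 / 4)) /= -/(light_sum h).
rewrite (_ : 1 + _ = light_sum h + (1 + beta * light_sum h)); last by ring.
rewrite lerD2l (bigID (fun S => D S == 1)) /=.
apply: lerD.
  have [S0|S0] := pselect (exists S : leafset h, D S = 1).
    have [S dS] := S0; rewrite (big_pred1 S) ?omega_full// => S'.
    apply/andP/eqP => [[_ /eqP dS']|->]; first exact: (density1_inj hb dS' dS).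
    by rewrite dS eqxx ltr01 -ltNge; split=> //; lra.
  rewrite big1 ?ler01// => S /andP[_ /eqP dS].
  by exfalso; apply: S0; exists S.
rewrite mulr_sumr.
apply: (@le_trans _ _ (\sum_(S : leafset h | 0 < D (compl S) <= 3 / 4)
    beta * omega (compl S))).
  rewrite [leLHS]big_mkcond [leRHS]big_mkcond; apply: ler_sum => S _.
  have dc : D (compl S) = 1 - D S by exact: density_compl.
  case: ifPn => [/andP[/andP[d0]]|_]; last first.
    by case: ifP => // _; rewrite mulr_ge0 ?omega_ge0//; case/andP: beta01.
  rewrite -ltNge => d34 dn1.
  have d1 : D S < 1 by rewrite lt_neqAle dn1 D1.
  rewrite ifT; first exact: omega_compl.
  by rewrite dc subr_gt0 d1 /=; lra.
rewrite [leRHS](reindex_inj (inv_inj (@complK b h))) /=.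
exact: lexx.
Qed.

(* [G i] selects the configurations in which only the child [i] carries leaves. *)
Let G h (i j : 'I_b) (S : leafset h) : R :=
  if i == j then (if 0 < D S then omega S else 0) else (D S == 0)%:R.
Let H h (S : leafset h) : R := if 0 < D S then omega S else 1.

Lemma sum_empty h : \sum_(S : leafset h) ((D S == 0)%:R : R) = 1.
Proof.
rewrite (bigD1 (emptyS b h)) //= [D _]density_empty eqxx big1 ?addr0// => S Sn.
case: eqP => // dS; case/eqP: Sn.
exact: (density0_inj hb dS (density_empty R b h)).
Qed.

Lemma omega_branch h (S : leafset h.+1) : (h < n)%N -> 0 < D S <= 3 / 4 ->
  omega S <= \sum_i B^-1 * \prod_j G i j (S j) + beta * \prod_j H (S j).
Proof.
move=> hn /andP[dS d34].
pose a i := D (S i); pose I := [set i | 0 < a i]%SET.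
have a0 i : 0 <= a i by exact: D0.
have a1 i : a i <= 1 by exact: D1.
have G0 i : 0 <= \prod_j G i j (S j).
  apply: prodr_ge0 => j _; rewrite /G; case: eqP => // _.
  by case: ifP => // _; exact: omega_ge0.
have H0 : 0 <= \prod_j H (S j).
  by apply: prodr_ge0 => j _; rewrite /H; case: ifP => // _; exact: omega_ge0.
have b0 : 0 <= beta by case/andP: beta01.
have outI i : i \notin I -> a i = 0.
  by rewrite inE -leNgt => hi; apply/eqP; rewrite eq_le hi a0.
have [i1 ai1] := density_pos_ex hb dS.
(* The densest child dominates the density of S and so supplies the prefactor of its own weight. *)
pose i0 := [arg max_(i > i1) a i]%O.
have amax i : a i <= a i0 by rewrite /i0; case: arg_maxP => // j _; apply.
have ai0 : 0 < a i0 by apply: lt_le_trans ai1 (amax _).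
have sE : \sum_i a i = B * D S by exact: sum_density.
have sI : \sum_i a i = \sum_(i in I) a i.
  by rewrite [RHS]big_mkcond; apply: eq_bigr => i _; case: ifPn => // /outI.
have i0I : i0 \in I by rewrite inE.
pose J := (I :\ i0)%SET.
pose s := \sum_i a i.
have sJ : s = a i0 + \sum_(j in J) a j.
  rewrite /s sI (bigD1 i0)//=; congr (_ + _).
  by apply: eq_bigl => j; rewrite !inE andbC.
have s2J : \sum_i a i ^+ 2 = a i0 ^+ 2 + \sum_(j in J) a j ^+ 2.
  rewrite (bigD1 i0)//=; congr (_ + _); rewrite big_mkcond [RHS]big_mkcond.
  apply: eq_bigr => j _; rewrite !inE; case: eqP => //= _.
  by case: ltP => // aj; rewrite (_ : a j = 0) ?expr0n//; apply/eqP; rewrite eq_le aj a0.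
(* All cross products are charged to the occupied children other than [i0], each of which must then
   earn a factor [beta]. *)
have cross : s ^+ 2 - \sum_i a i ^+ 2 =
    \sum_(j in J) a j * (a i0 + s - a j).
  rewrite s2J; transitivity ((a i0 + s) * (\sum_(j in J) a j) - \sum_(j in J) a j ^+ 2).
    by rewrite sJ; ring.
  by rewrite mulr_sumr -sumrB; apply: eq_bigr => j _; ring.
have totJ : \sum_i outer_energy R (S i) =
    outer_energy R (S i0) + \sum_(j in J) outer_energy R (S j).
  rewrite (bigD1 i0)//=; congr (_ + _); rewrite big_mkcond [RHS]big_mkcond.
  apply: eq_bigr => j _; rewrite !inE; case: eqP => //= _.
  case: ltP => // aj; apply: outer_energy_density0 => //; apply/eqP.
  by rewrite eq_le aj density_ge0.
have totE : outer_energy R S - q = (outer_energy R (S i0) - q) + \sum_(j in J)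
   ((outer_energy R (S j) - q) + (q - (1 - q) * (a j * (a i0 + s - a j)))).
  rewrite outer_energyS// -[\sum_i density R (S i)]/s.
  rewrite -[\sum_i density R (S i) ^+ 2]/(\sum_i a i ^+ 2).
  have -> : \sum_(j in J)
       ((outer_energy R (S j) - q) + (q - (1 - q) * (a j * (a i0 + s - a j)))) =
     \sum_(j in J) outer_energy R (S j) - (1 - q) * \sum_(j in J) (a j * (a i0 + s - a j)).
    by rewrite mulr_sumr -sumrB; apply: eq_bigr => j _; rewrite addrA subrK.
  by rewrite cross totJ; set u := outer_energy R (S i0); set v := \sum_(j in J) outer_energy _ _; ring.
have [J0|Jn0] := eqVneq J finset.set0.
  apply: ler_wpDr; first exact: mulr_ge0.
  rewrite (bigD1 i0)//= ler_wpDr//.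
    by apply: sumr_ge0 => i _; rewrite mulr_ge0 ?invr_ge0 ?(ltW B0).
  have only j : j != i0 -> D (S j) = 0.
    move=> ji; apply: outI; apply/negP => jI.
    have jJ : j \in J by move: jI; rewrite !inE ji.
    by rewrite J0 finset.in_set0 in jJ.
  rewrite (bigD1 i0)//= big1 => [|j ji]; last first.
    by rewrite /G eq_sym (negPf ji) only// eqxx.
  rewrite mulr1 /G eqxx -/(a i0) ai0 /omega totE J0 big_set0 addr0.
  rewrite mulrA ler_wpM2r ?expR_ge0// -/(a i0).
  have : s = a i0 by rewrite sJ J0 big_set0 addr0.
  by rewrite /s sE => <-; rewrite mulKf// gt_eqF.
apply: ler_wpDl; first by apply: sumr_ge0 => i _; rewrite mulr_ge0 ?invr_ge0 ?(ltW B0).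
have -> : \prod_j H (S j) = omega (S i0) * \prod_(j in J) omega (S j).
  rewrite (bigD1 i0)//= {1}/H -/(a i0) ai0; congr (_ * _).
  rewrite big_mkcond [RHS]big_mkcond; apply: eq_bigr => j _.
  by rewrite !inE /H -/(a j); case: eqP => //= _.
rewrite /omega totE mulrDr opprD expRD mulr_sumr -sumrN expR_sum.
have dSi0 : D S <= a i0.
  have := sE; rewrite -(ler_pM2l B0) => <-.
  apply: le_trans (ler_sum _ (fun i _ => amax i)) _.
  by rewrite sumr_const card_ord mulr_natl.
have fac j : j \in J -> expR (- (T * (outer_energy R (S j) - q +
      (q - (1 - q) * (a j * (a i0 + s - a j)))))) <= beta * omega (S j).
  rewrite !inE => /andP[_ aj]; rewrite mulrDr opprD expRD /omega -/(a j).
  rewrite mulrA [leLHS]mulrC ler_wpM2r ?expR_ge0//.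
  (* The density of [i0] is bounded by 1 and that of S by 3/4. That g >= 1/8 then follows from a (1
     - a) <= 1/4 <= b/8. *)
  pose g := 1 - a j * (1 + 3 / 4 * B - a j) / B.
  apply: (@le_trans _ _ (expR (- (T * q * g)))); last first.
    apply: decay; first exact: density_range (ltnW hn) aj.
      rewrite /g lerD2l lerN2 -mulrA [2 * _]mulrC ler_wpM2l// ler_pdivrMr//.
      by have := a0 j; have := B2; lra.
    rewrite /g lerBrDl -lerBrDr ler_pdivrMr//.
    have h1 : 0 <= (1 - a j) * B by rewrite mulr_ge0 ?subr_ge0// ltW.
    have h2 := sqr_ge0 (a j - 2^-1).
    by have := a0 j; have := a1 j; have := B2; nra.
  rewrite ler_expR lerN2; set u := a j * (a i0 + s - a j).
  have uB : u <= a j * (1 + 3 / 4 * B - a j).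
    rewrite ler_wpM2l// lerD2r lerD// /s sE mulrC ler_wpM2r// ltW//.
  have -> : q - (1 - q) * u = q * (1 - u / B).
    by rewrite /gratio; field; rewrite !gt_eqF.
  rewrite -mulrA ler_wpM2l// ler_wpM2l ?(ltW (gratio_gt0 R hb))// /g lerD2l lerN2.
  by rewrite ler_pM2r ?invr_gt0.
have prodJ : \prod_(j in J) expR (- (T * (outer_energy R (S j) - q +
      (q - (1 - q) * (a j * (a i0 + s - a j)))))) <=
    beta * \prod_(j in J) omega (S j).
  apply: (@le_trans _ _ (\prod_(j in J) (beta * omega (S j)))).
    by apply: ler_prod => j jJ; rewrite expR_ge0 fac.
  rewrite big_split /= ler_wpM2r ?prodr_ge0//; first by move=> j _; exact: omega_ge0.
  rewrite prodr_const; move: Jn0; rewrite -card_gt0; case: #|J| => // m _.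
  by rewrite exprS ler_piMr// exprn_ile1//; case/andP: beta01.
set E := expR (- (T * (outer_energy R (S i0) - q))) in prodJ *.
set P := \prod_(j in J) expR _ in prodJ *.
set W := \prod_(j in J) _ in prodJ *.
have P0 : 0 <= P by apply: prodr_ge0 => j _; exact: expR_ge0.
have E0 : 0 <= E by exact: expR_ge0.
apply: (@le_trans _ _ (a i0 * (E * (beta * W)))).
  by apply: ler_pM => //; [exact: mulr_ge0 | rewrite ler_wpM2l].
by rewrite le_eqVlt; apply/orP; left; apply/eqP; rewrite -/(a i0); ring.
Qed.

(** Summed over S, both products in [omega_branch] factor over the children. The b positions of the
    single child cancel the factor 1/b, and in the other term an empty child counts 1. *)
Lemma light_sum_rec h : (h < n)%N ->
  light_sum h.+1 <= full_sum h + beta * (1 + full_sum h) ^+ b.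
Proof.
move=> hn.
have b0 : 0 <= beta by case/andP: beta01.
have G0 i (S : leafset h.+1) : 0 <= \prod_j G i j (S j).
  apply: prodr_ge0 => j _; rewrite /G; case: eqP => // _.
  by case: ifP => // _; exact: omega_ge0.
have H0 (S : leafset h.+1) : 0 <= \prod_j H (S j).
  by apply: prodr_ge0 => j _; rewrite /H; case: ifP => // _; exact: omega_ge0.
apply: (@le_trans _ _ (\sum_(S : leafset h.+1)
    (\sum_i B^-1 * \prod_j G i j (S j) + beta * \prod_j H (S j)))).
  rewrite [leLHS]big_mkcond; apply: ler_sum => S _; case: ifPn => [|_].
    exact: omega_branch.
  rewrite addr_ge0 ?mulr_ge0// sumr_ge0// => i _.
  by rewrite mulr_ge0 ?invr_ge0 ?(ltW B0).
rewrite big_split /= -mulr_sumr exchange_big /=.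
have sG i : \sum_(S : leafset h.+1) B^-1 * \prod_j G i j (S j) = B^-1 * full_sum h.
  rewrite -mulr_sumr -(bigA_distr_bigA (fun j (U : leafset h) => G i j U)).
  congr (_ * _); rewrite (bigD1 i)//= [X in _ * X]big1 => [|j ji].
    by rewrite mulr1 /full_sum [RHS]big_mkcond; apply: eq_bigr => U _; rewrite /G eqxx.
  by rewrite -[RHS](sum_empty h); apply: eq_bigr => U _; rewrite /G eq_sym (negPf ji).
rewrite (eq_bigr _ (fun i _ => sG i)) sumr_const card_ord.
have -> : (B^-1 * full_sum h) *+ b = full_sum h by rewrite -[LHS]mulr_natl mulVKf ?gt_eqF.
rewrite lerD2l ler_wpM2l// -(bigA_distr_bigA (fun j (U : leafset h) => H U)) /=.
rewrite prodr_const card_ord lerXn2r ?nnegrE//.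
- by apply: sumr_ge0 => U _; rewrite /H; case: ifP => // _; exact: omega_ge0.
- by rewrite addr_ge0// full_sum_ge0.
rewrite -(sum_empty h) /full_sum [X in _ + X]big_mkcond -big_split /=.
apply: ler_sum => U _; rewrite /H; case: ltP => [d0|d0]; first by rewrite lerDr ler0n.
by rewrite eq_le d0 D0 addr0.
Qed.

(** Each level then adds at most 1 for the full set and at most 1 for all terms with [beta];
    [2 + 4 * n] bounds [1 + full_sum h] as long as [light_sum h] is at most [2 * n]. *)
Hypothesis small : beta * ((2 * n)%:R + (2 + 4 * n)%:R ^+ b) <= 1.

Lemma light_sum_le h : (h <= n)%N -> light_sum h <= (2 * h)%:R.
Proof.
have /andP[b0 b1] := beta01.
elim: h => [|h IH] hn.
  rewrite /light_sum big1 // => S; rewrite [D S]density0E; case: (S : bool) => /=.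
    by move=> /andP[_]; lra.
  by rewrite ltxx.
have {}IH := IH (ltnW hn); have X0 := light_sum_ge0 h.
have X2n : light_sum h <= (2 * n)%:R.
  by apply: le_trans IH _; rewrite ler_nat leq_mul2l ltnW.
apply: le_trans (light_sum_rec hn) _.
have Y1 := full_sum_le (ltnW hn).
have Y2 : 1 + full_sum h <= (2 + 4 * n)%:R.
  apply: le_trans (lerD (lexx 1) Y1) _.
  by rewrite natrD natrM; move: X2n; rewrite natrM; nra.
have Y3 : (1 + full_sum h) ^+ b <= (2 + 4 * n)%:R ^+ b.
  by apply: lerXn2r => //; rewrite nnegrE ?ler0n// addr_ge0// full_sum_ge0.
apply: (@le_trans _ _ (1 + (1 + beta) * light_sum h + beta * (2 + 4 * n)%:R ^+ b)).
  by rewrite lerD// ler_wpM2l.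
have b2n : beta * light_sum h <= beta * (2 * n)%:R by rewrite ler_wpM2l.
have := small; rewrite mulrDr mulnS natrD.
by move: IH b2n; set u := _ ^+ b; lra.
Qed.

(** Without the outer term the exponent exceeds that of [omega] by q (1 - a^2), a gap of at least
    3/4 when a <= 1/2; [decay] turns it into [beta] times the density. *)
Lemma partition_bound :
  \sum_(S : leafset n | 0 < D S <= 1 / 2) expR (- (T * set_unit_energy R S)) <= beta * (2 * n)%:R.
Proof.
have /andP[b0 b1] := beta01.
apply: le_trans (ler_wpM2l b0 (light_sum_le (leqnn n))).
rewrite /light_sum mulr_sumr [leLHS]big_mkcond [leRHS]big_mkcond.
apply: ler_sum => S _; case: ifPn => [/andP[d0 d12]|_]; last first.
  by case: ifP => // _; rewrite mulr_ge0 ?omega_ge0.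
rewrite ifT; last by rewrite d0 /=; lra.
have -> : expR (- (T * set_unit_energy R S)) =
    expR (- (T * q * (1 - D S ^+ 2))) * expR (- (T * (outer_energy R S - q))).
  by rewrite -expRD /outer_energy -/(D S); congr expR; ring.
rewrite /omega (mulrA beta) ler_wpM2r ?expR_ge0//; apply: decay.
- exact: density_range.
- by have := sqr_ge0 (D S); nra.
- by nra.
Qed.

End Partition.

(** * Endpoint probabilities between different subtrees *)

Section Lifts.
Variables (R : realType) (b : nat).
Hypothesis hb : (2 <= b)%N.
Local Notation word := (seq 'I_b).
Local Notation B := (b%:R : R).

Lemma lift_atE (u : word) (g : word -> R) w :
  lift_at u g w = if prefix u w then g (drop (size u) w) else 0.
Proof.
elim: u w => [|i u IH] w; first by rewrite prefix0s drop0.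
case: w => [|j w] //=; rewrite IH.
by case: (i == j).
Qed.

Lemma energy_lift_at u (g : word -> R) k n : (size u + k)%N = n ->
  energy n (lift_at u g) = energy k g + cutn R b k n * mean k g ^+ 2.
Proof. by move=> <-; exact: energy_lift. Qed.

Lemma mu_le (m n : nat) : (m <= n)%N ->
  mu R b n.+1 / B ^+ n.+1 <= mu R b m.+1 / B ^+ m.+1.
Proof.
move=> mn; have B1 := B_gt1 R hb.
have h : B ^+ m.+1 <= B ^+ n.+1 by rewrite ler_weXn2l// ltW.
have g1 k : 0 < B ^+ k.+1 - 1 by rewrite subr_gt0 BexpS_gt1.
apply: ler_pM; rewrite ?invr_ge0 ?(ltW (Bexp_gt0 R hb _))//.
- by rewrite /mu divr_ge0 ?subr_ge0 ?(ltW B1)// -subr_ge0 ltW.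
- by rewrite /mu ler_pM2l ?subr_gt0// lef_pV2 ?posrE// lerD2r.
- by rewrite lef_pV2 ?posrE ?Bexp_gt0.
Qed.

Lemma mu_gt0 n : 0 < mu R b n.+1.
Proof. by rewrite /mu divr_gt0 ?subr_gt0 ?B_gt1 ?BexpS_gt1. Qed.

(** Every common leading letter contributes a nonpositive term, so only the first differing letter
    counts; it belongs to a height above [k], and [mu_le] lowers that height to [k.+1]. *)
Lemma hker_le (x y : word) n k : size x = n -> size y = n -> (k < n)%N ->
  take (n - k) x != take (n - k) y ->
  hker R n x y <= mu R b k.+1 / B ^+ k.+1.
Proof.
elim: n x y => [//|n IH] [//|i x] [//|j y] [sx] [sy]; rewrite ltnS => kn.
rewrite subSn//= eqseq_cons negb_and /=.
have [_|ij] := eqVneq i j; last by rewrite add0r mu_le.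
move=> /= ne; have {}kn : (k < n)%N.
  by rewrite ltn_neqAle kn andbT; apply: contraNneq ne => ->; rewrite subnn !take0.
apply: le_trans (IH _ _ sx sy kn ne).
rewrite -addrA gerDl addrC subr_le0 ler_pM2l ?mu_gt0// lef_pV2 ?posrE ?Bexp_gt0//.
by rewrite ler_weXn2l// ltW// B_gt1.
Qed.

Lemma hker_head (x y : word) n i j : i != j ->
  hker R n.+1 (i :: x) (j :: y) = mu R b n.+1 / B ^+ n.+1.
Proof. by move=> ij /=; rewrite (negPf ij) add0r. Qed.

End Lifts.

(** * The events *)

Section Events.
Variables (R : realType) (b n : nat).
Hypothesis hb : (2 <= b)%N.
Hypothesis n0 : (0 < n)%N.
Local Notation word := (seq 'I_b).
Local Notation B := (b%:R : R).
Local Notation V := (vertex b n).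
Local Notation L := (leaf b n).
Local Notation Omega := {ffun L -> {set L}}.

Definition iso (S : {set L}) : pred Omega :=
  fun m => [forall x, m x \subset (if x \in S then S else ~: S)%SET].

Definition cut (S : {set L}) : R := \sum_(x in S) \sum_(y in ~: S) hk R x y.

Lemma cut_sym S : \sum_(x in ~: S) \sum_(y in S) hk R x y = cut S.
Proof.
rewrite exchange_big; apply: eq_bigr => x _; apply: eq_bigr => y _; exact: hk_sym.
Qed.

(** By symmetry of the kernel both directions contribute equally, which cancels the 1/2 in the
    number of particles per leaf. *)
Lemma cut_sum (S : {set L}) :
  \sum_x \sum_(y in ~: (if x \in S then S else ~: S)%SET) hk R x y = 2 * cut S.
Proof.
rewrite mulr_natl mulr2n (bigID (mem S)) /=; congr (_ + _).
  by apply: eq_bigr => x ->.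
rewrite -cut_sym; apply: eq_big => [x|x /negPf ->]; first by rewrite inE.
by rewrite finset.setCK.
Qed.

Lemma cut_energy S : cut S = energy n (ind R S).
Proof.
rewrite -energy_hop// -sum_leaf /cut [LHS]big_mkcond; apply: eq_bigr => x _.
rewrite indE hop_ind//; case: (x \in S); rewrite ?mul0r// mul1r.
have := hk_sum1 R hb x; rewrite (bigID (mem S)) /= => <-.
rewrite addrAC subrr add0r.
by apply: eq_bigl => y; rewrite inE.
Qed.

Definition subset_at (u : word) k (S : leafset b k) : {set L} :=
  [set x | prefix u (lword x) && dec S (drop (size u) (lword x))]%SET.

Lemma cut_subset_at u k (S : leafset b k) : (size u + k)%N = n ->
  cut (subset_at u S) = set_energy R S + cutn R b k n * density R S ^+ 2.
Proof.
move=> sn; rewrite cut_energy (@eq_energy R b n _ (lift_at u (rfun R S))).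
  by rewrite (energy_lift_at hb _ sn).
move=> w /lword_surj[x <-]; rewrite indE lift_atE inE /rfun.
by case: prefix.
Qed.

Lemma energy_cst k (c : R) : energy k ((fun=> c) : word -> R) = 0.
Proof.
elim: k => [//|k IH]; rewrite energyS big1 => [|i _]; last exact: IH.
rewrite big1 ?mulr0 ?addr0// => i _.
have m m' : mean m' ((fun=> c) : word -> R) = c.
  by rewrite /mean wsum_cst mulrC mulKf// Bexp_neq0.
by rewrite [mean k _]m m subrr expr0n.
Qed.

Definition below (v : V) : {set L} := [set x | ancestor v (val x)]%SET.

Lemma belowE v x : (x \in below v) = prefix (val v) (lword x).
Proof. by rewrite inE. Qed.

Lemma height_size k (v : V) : (k <= n)%N -> (height v == k) = (size (val v) == (n - k)%N).
Proof. by move=> kn; rewrite /height; have := size_bseq v; rewrite /=; lia. Qed.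

Lemma cut_below k v : (k <= n)%N -> height v == k -> cut (below v) = cutn R b k n.
Proof.
move=> kn; rewrite height_size// => /eqP sv.
have sn : (size (val v) + k)%N = n by rewrite sv subnK.
rewrite cut_energy (@eq_energy R b n _ (lift_at (val v) (fun=> 1))).
  rewrite (energy_lift_at hb _ sn) energy_cst add0r.
  by rewrite /mean wsum_cst mulr1 divff ?Bexp_neq0// expr1n mulr1.
move=> w /lword_surj[x <-]; rewrite indE lift_atE belowE.
by case: prefix.
Qed.

Lemma card_height k : (k <= n)%N -> \sum_(v : V | height v == k) (1 : R) = B ^+ (n - k).
Proof.
move=> kn; rewrite -[RHS]mulr1 -wsum_cst.
rewrite -(@big_words R b V (fun v => height v == k) val (n - k) (fun=> 1))//.
- by move=> v; rewrite height_size// => /eqP.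
- move=> w sw; have lw : (size w <= n)%N by rewrite sw leq_subr.
  by exists (Bseq lw) => //; rewrite height_size//= sw.
Qed.

Lemma isoP (S : {set L}) (m : Omega) :
  reflect (forall x y, x \in S -> y \notin S -> (y \notin m x) /\ (x \notin m y))
    (iso S m).
Proof.
apply: (iffP forallP) => [h x y xS yS|h x].
  split; apply/negP => hm.
    by have /fintype.subsetP /(_ _ hm) := h x; rewrite xS (negPf yS).
  by have /fintype.subsetP /(_ _ hm) := h y; rewrite (negPf yS) inE xS.
apply/fintype.subsetP => y ym; case: ifPn => xS.
  by apply/negPn/negP => /(h _ _ xS)[]; rewrite ym.
by rewrite inE; apply/negP => yS; have [] := h _ _ yS xS; rewrite ym.
Qed.

Lemma iso_compl S m : iso (~: S)%SET m = iso S m.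
Proof.
by apply: eq_forallb => x; rewrite inE; case: (x \in S); rewrite ?finset.setCK.
Qed.

Definition adjm (m : Omega) (x y : L) := (y \in m x) || (x \in m y).

Lemma edgeE (o : outcome b n) x y : edge o x y = adjm (ends o) x y.
Proof. by rewrite /adjm /ends !ffunE !inE. Qed.

Lemma iso_adjm S m :
  iso S m <-> forall x y, x \in S -> y \notin S -> ~~ adjm m x y.
Proof.
split=> [/isoP h x y xS yS|h]; first by rewrite negb_or; apply/andP; exact: h.
by apply/isoP => x y xS yS; apply/andP; rewrite -negb_or; exact: h.
Qed.

Lemma connect_edge (o : outcome b n) : connect (edge o) =2 connect (adjm (ends o)).
Proof. by move=> x y; apply: eq_connect => {}x {}y; exact: edgeE. Qed.

Definition cluster_of (m : Omega) x : {set L} := [set y | connect (adjm m) x y]%SET.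

Lemma iso_cluster m x : iso (cluster_of m x) m.
Proof.
apply/iso_adjm => y z; rewrite !inE => xy; apply: contraNN => yz.
exact: connect_trans xy (connect1 yz).
Qed.

Definition evDm k : pred Omega :=
  fun m => [exists v : V, (height v == k) && iso (below v) m].

Definition evCm k : pred Omega :=
  fun m => [exists x : L, exists v : V, (height v == k) && (cluster_of m x \subset below v)].

Definition connm : pred Omega := fun m => [forall x, forall y, connect (adjm m) x y].

Lemma evD_m k (o : outcome b n) : evD b n k o <-> evDm k (ends o).
Proof.
split=> [[v [hv h]]|/existsP[v /andP[/eqP hv /iso_adjm h]]].
  apply/existsP; exists v; rewrite hv eqxx; apply/iso_adjm => x y.
  by rewrite !inE -edgeE; exact: h.
exists v; split=> // x y vx vy; rewrite edgeE; apply: h; by rewrite inE.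
Qed.

Lemma evC_m k (o : outcome b n) : evC b n k o <-> evCm k (ends o).
Proof.
split=> [[x [v [hv h]]]|/existsP[x /existsP[v /andP[/eqP hv /fintype.subsetP h]]]].
  apply/existsP; exists x; apply/existsP; exists v; rewrite hv eqxx.
  apply/fintype.subsetP => y; rewrite !inE -connect_edge => xy.
  by apply: h; rewrite inE.
exists x, v; split=> // y; rewrite inE connect_edge => xy.
by have := h y; rewrite !inE; apply.
Qed.

Lemma conn_m (o : outcome b n) : ev_connected b n o <-> connm (ends o).
Proof.
split=> [h|/forallP h x y].
  by apply/forallP => x; apply/forallP => y; rewrite -connect_edge; exact: h.
by rewrite connect_edge; exact: (forallP (h x) y).
Qed.

Lemma evDC k m : (k <= n)%N -> evDm k m -> evCm k m.
Proof.
move=> kn /existsP[v /andP[hv iv]].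
have := hv; rewrite height_size// => /eqP sv.
pose i0 : 'I_b := Ordinal (ltnW hb).
have [x ex] : exists x : L, lword x = val v ++ nseq k i0.
  by apply: lword_surj; rewrite size_cat size_nseq sv subnK.
apply/existsP; exists x; apply/existsP; exists v; rewrite hv /=.
have xv : x \in below v by rewrite belowE ex prefix_prefix.
apply/fintype.subsetP => y; rewrite inE => /connectP[p].
elim: p x xv {ex} => [|z p IH] x xv /=; first by move=> _ ->.
move=> /andP[xz pz] ey; apply: IH pz ey.
apply/negPn/negP => zv; have /iso_adjm h := iv.
by have := h _ _ xv zv; rewrite xz.
Qed.

Lemma Prends_iso (lam : R) (S : {set L}) : 0 <= lam ->
  Prends lam (iso S) = expR (- (lam * cut S)).
Proof. by move=> lam0; rewrite Prends_rect// cut_sum; congr expR; field. Qed.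

End Events.

(** * First and second moment bounds *)

Section Bounds.
Variables (R : realType) (b n : nat).
Hypothesis hb : (2 <= b)%N.
Hypothesis n0 : (0 < n)%N.
Variable lam : R.
Hypothesis lam0 : 0 <= lam.

Local Notation word := (seq 'I_b).
Local Notation B := (b%:R : R).
Local Notation V := (vertex b n).
Local Notation L := (leaf b n).
Local Notation Omega := {ffun L -> {set L}}.
Local Notation Prends := (Prends lam).

(* The indicator of [X > 0] dominates [2 t X - t^2 X^2] for every [t]. *)
Lemma Prends_second (I : finType) (J : pred I) (Q : I -> pred Omega) (P : pred Omega)
    (e1 := \sum_(i | J i) Prends (Q i))
    (e2 := \sum_(i | J i) \sum_(j | J j) Prends (fun m => Q i m && Q j m)) :
  (forall m i, J i -> Q i m -> P m) -> 0 < e2 -> e1 ^+ 2 / e2 <= Prends P.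
Proof.
move=> QP e20; pose X m := \sum_(i | J i) ((Q i m)%:R : R).
have PPE (P' : pred Omega) : Prends P' = \sum_m ends_prob lam m * (P' m)%:R.
  rewrite /Prends big_mkcond; apply: eq_bigr => m _.
  by case: (P' m); rewrite ?mulr1 ?mulr0.
have E1 : e1 = \sum_m ends_prob lam m * X m.
  rewrite /e1; under eq_bigr do rewrite PPE.
  by rewrite exchange_big; apply: eq_bigr => m _; rewrite -mulr_sumr.
have E2 : e2 = \sum_m ends_prob lam m * X m ^+ 2.
  rewrite /e2; under eq_bigr => i _ do under eq_bigr => j _ do rewrite PPE.
  under eq_bigr do rewrite exchange_big.
  rewrite exchange_big; apply: eq_bigr => m _; rewrite expr2 /X mulr_suml mulr_sumr.
  apply: eq_bigr => i _; rewrite !mulr_sumr; apply: eq_bigr => j _.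
  by rewrite -mulnb natrM.
pose t := e1 / e2.
have -> : e1 ^+ 2 / e2 = 2 * t * e1 - t ^+ 2 * e2.
  by rewrite /t; field; rewrite gt_eqF.
clearbody t; rewrite E1 E2 PPE !mulr_sumr -sumrB; apply: ler_sum => m _.
rewrite mulrCA [t ^+ 2 * _]mulrCA -mulrBr ler_wpM2l ?ends_prob_ge0//.
have [Pm|Pm] := boolP (P m).
  rewrite -subr_ge0 (_ : _ - _ = (1 - t * X m) ^+ 2) ?sqr_ge0//=; ring.
suff -> : X m = 0 by rewrite expr0n !mulr0 subrr.
rewrite /X big1 // => i Ji; case: (boolP (Q i m)) => // Qi.
by rewrite (QP m i) in Pm.
Qed.

Variable k : nat.
Hypothesis kn : (k < n)%N.
Local Notation J := (fun v : V => height v == k).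
Local Notation c := (cutn R b k n).
Local Notation below := (@below b n).
Local Notation evDm := (@evDm b n).

Let kn' : (k <= n)%N. Proof. exact: ltnW. Qed.
Let c0 : 0 <= c. Proof. exact: cutn_ge0. Qed.

Lemma sum_height (a : R) : \sum_(v | J v) a = B ^+ (n - k) * a.
Proof.
rewrite -(card_height R hb n0 kn') mulr_suml; apply: eq_bigr => v _.
by rewrite mul1r.
Qed.

Lemma evDm_upper : Prends (evDm k) <= B ^+ (n - k) * expR (- (lam * c)).
Proof.
rewrite -sum_height; apply: le_trans (@Prends_union R b n hb n0 lam lam0 V J
  (fun v => iso (below v)) (evDm k) _) _.
  by move=> m /existsP[v /andP[hv iv]]; exists v.
by apply: ler_sum => v hv; rewrite Prends_iso// (cut_below R hb n0 kn' hv).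
Qed.

Definition crossing (v w : V) : R := \sum_(x in below v) \sum_(y in below w) hk R x y.

Lemma below_take v x : height v == k ->
  (x \in below v) = (take (n - k) (lword x) == val v).
Proof. by rewrite height_size// belowE prefixE => /eqP ->. Qed.

Lemma below_disj v w x : height v == k -> height w == k -> v != w ->
  x \in below v -> x \notin below w.
Proof.
move=> hv hw vw; rewrite !below_take// => /eqP ->.
by apply: contra vw => /eqP/val_inj ->.
Qed.

(** A particle running between the two subtrees violates both events but is to be counted once,
    hence the correction by [crossing]. *)
Lemma Prends_iso2 v w : height v == k -> height w == k -> v != w ->
  Prends (fun m => iso (below v) m && iso (below w) m) =
  expR (- (lam * (2 * c - crossing v w))).
Proof.
move=> hv hw vw.
pose a (u : V) (x : L) : {set L} := (if x \in below u then below u else ~: below u)%SET.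
transitivity (Prends (fun m => [forall x, m x \subset (a v x :&: a w x)%SET])).
  apply: eq_bigl => m; apply/andP/forallP => [[/forallP h1 /forallP h2] x|h].
    by rewrite finset.subsetI h1 h2.
  by split; apply/forallP => x; have := h x; rewrite finset.subsetI => /andP[].
rewrite Prends_rect//; congr expR.
have aE u x y : (y \in ~: a u x)%SET = (x \in below u) (+) (y \in below u).
  by rewrite inE /a; case: ifP => _; rewrite ?inE ?negbK.
have key x : \sum_(y in ~: (a v x :&: a w x)%SET) hk R x y =
    \sum_(y in (~: a v x)%SET) hk R x y + \sum_(y in (~: a w x)%SET) hk R x y
    - ((x \in below v)%:R * \sum_(y in below w) hk R x y
       + (x \in below w)%:R * \sum_(y in below v) hk R x y).
  rewrite !mulr_sumr ![\sum_(i in _) _]big_mkcond /= -!big_split /= -sumrB.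
  apply: eq_bigr => y _; rewrite finset.setCI finset.in_setU !aE.
  have := @below_disj v w x hv hw vw; have := @below_disj v w y hv hw vw.
  case: (x \in below v); case: (x \in below w); case: (y \in below v);
  case: (y \in below w) => /= h1 h2; rewrite ?mulr1n ?mul0r ?mul1r ?subrr ?addr0 ?subr0 ?add0r//;
  try (by have := h1 isT); try (by have := h2 isT);
  by rewrite ?addrK ?addKr ?subrr.
under eq_bigr do rewrite key.
have cutE u : height u == k -> \sum_x \sum_(y in (~: a u x)%SET) hk R x y = 2 * c.
  by move=> hu; rewrite cut_sum (cut_below R hb n0 kn' hu).
rewrite sumrB big_split /= !cutE// [X in _ - X]big_split /=.
have ind2 u u' : \sum_x (x \in below u)%:R * \sum_(y in below u') hk R x y = crossing u u'.
  rewrite /crossing [RHS]big_mkcond; apply: eq_bigr => x _.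
  by case: (x \in below u); rewrite ?mul1r ?mul0r.
rewrite !ind2; have -> : crossing w v = crossing v w.
  by rewrite /crossing exchange_big; apply: eq_bigr => x _; apply: eq_bigr => y _; rewrite hk_sym.
by field.
Qed.

Lemma card_below v : height v == k -> \sum_(x in below v) (1 : R) = B ^+ k.
Proof.
move=> hv; have sv : size (val v) = (n - k)%N by apply/eqP; rewrite -height_size.
have sn : (size (val v) + k)%N = n by rewrite sv subnK.
have E m (Hm : (size (val v) + k)%N = m) :
    wsum m (lift_at (val v) (fun=> 1)) = B ^+ k :> R.
  rewrite -Hm wsum_mean// mean_lift// /mean wsum_cst mulr1 divff ?Bexp_neq0//.
  by rewrite exprD; field; rewrite Bexp_neq0.
rewrite -(E n sn) -sum_leaf big_mkcond; apply: eq_bigr => x _.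
by rewrite belowE lift_atE; case: prefix.
Qed.

Lemma crossing_le v w : height v == k -> height w == k -> v != w -> crossing v w <= kap R b k / B.
Proof.
move=> hv hw vw.
apply: (@le_trans _ _ (\sum_(x in below v) \sum_(y in below w)
    mu R b k.+1 / B ^+ k.+1)).
  apply: ler_sum => x xv; apply: ler_sum => y yw.
  apply: hker_le; rewrite ?size_lword//.
  move: xv yw; rewrite !below_take// => /eqP -> /eqP ->.
  by apply: contra vw => /eqP/val_inj ->.
have cst u (a : R) : height u == k -> \sum_(x in below u) a = B ^+ k * a.
  move=> hu; rewrite -(card_below hu) mulr_suml.
  by apply: eq_bigr => x _; rewrite mul1r.
rewrite (eq_bigr _ (fun x _ => cst w _ hw)) cst// /kap exprS.
by rewrite le_eqVlt; apply/orP; left; apply/eqP; field; rewrite B_neq0 ?Bexp_neq0.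
Qed.

Lemma crossing_ge0 v w : 0 <= crossing v w.
Proof. by apply: sumr_ge0 => x _; apply: sumr_ge0 => y _; exact: hk_ge0. Qed.

(** The subtrees of height [k] are disjoint, so these flows are parts of one cut. Using
    [crossing_le] for each [w] would cost a factor b^(n-k). *)
Lemma crossing_sum v : height v == k -> \sum_(w | J w && (w != v)) crossing v w <= c.
Proof.
move=> hv; rewrite -(cut_below R hb n0 kn' hv) /crossing exchange_big; apply: ler_sum => x xv.
under eq_bigr do rewrite big_mkcond.
rewrite exchange_big [leRHS]big_mkcond; apply: ler_sum => y _; rewrite inE.
have [yv|yv] := boolP (y \in below v).
  rewrite big1 // => w /andP[hw wv].
  by rewrite (negPf (below_disj hv hw _ yv))// eq_sym.
have [/existsP[w /and3P[hw wv yw]]|/existsPn nw] :=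
    boolP [exists w, [&& J w, w != v & y \in below w]].
  rewrite (bigD1 w) ?hw//= yw big1 ?addr0// => u /andP[/andP[hu _] uw].
  by rewrite (negPf (below_disj hw hu _ yw))// eq_sym.
rewrite big1 ?hk_ge0// => w /andP[hw wv].
by case: ifPn => // yw; have := nw w; rewrite hw wv yw.
Qed.

(** Here [e1] is the expected number of isolated subtrees. By exp(y) <= 1 + y exp(y) the
    correlations become linear in [crossing], so that their sum is controlled by one cut, and
    [crossing_le] enters only through the worst exponential factor. *)
Lemma evDm_lower (e1 := B ^+ (n - k) * expR (- (lam * c))) :
  (e1^-1 + 1 + lam * c * expR (lam * (kap R b k / B)) / B ^+ (n - k))^-1
  <= Prends (evDm k).
Proof.
set N := B ^+ (n - k) in e1 *; set E := expR (lam * (kap R b k / B)).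
have N0 : 0 < N by exact: Bexp_gt0.
have e10 : 0 < e1 by rewrite mulr_gt0 ?expR_gt0.
have E0 : 0 <= E by exact: expR_ge0.
pose Q v := iso (below v).
have E1 : \sum_(v | J v) Prends (Q v) = e1.
  rewrite /e1 -sum_height; apply: eq_bigr => v hv.
  by rewrite Prends_iso// (cut_below R hb n0 kn' hv).
pose e2 := \sum_(v | J v) \sum_(w | J w) Prends (fun m => Q v m && Q w m).
pose x := expR (- (lam * c)).
have row v : height v == k -> \sum_(w | J w) Prends (fun m => Q v m && Q w m)
    <= x + x ^+ 2 * (N + lam * c * E).
  move=> hv; rewrite (bigD1 v)//=.
  have -> : Prends (fun m => Q v m && Q v m) = x.
    rewrite -[RHS]/(expR _) -(cut_below R hb n0 kn' hv) -Prends_iso//.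
    by apply: eq_bigl => m; rewrite andbb.
  rewrite lerD2l.
  apply: (@le_trans _ _ (\sum_(w | J w && (w != v)) (x ^+ 2 * (1 + lam * E * crossing v w)))).
    apply: ler_sum => w /andP[hw wv].
    rewrite Prends_iso2// 1?eq_sym//.
    have -> : - (lam * (2 * c - crossing v w)) =
        - (lam * c) + - (lam * c) + lam * crossing v w by ring.
    rewrite !expRD -expr2 -/x ler_wpM2l ?sqr_ge0//.
    have y0 : 0 <= lam * crossing v w by rewrite mulr_ge0 ?crossing_ge0.
    have yE : expR (lam * crossing v w) <= E.
      by rewrite ler_expR ler_wpM2l// crossing_le// eq_sym.
    have := expR_ge1Dx (- (lam * crossing v w)).
    rewrite expRN -[_^-1]div1r ler_pdivlMr ?expR_gt0//.
    have : lam * crossing v w * expR (lam * crossing v w) <=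
        lam * crossing v w * E by rewrite ler_wpM2l.
    by set y := lam * crossing v w; set z := expR y => h1 h2; rewrite mulrAC -/y; lra.
  rewrite -mulr_sumr ler_wpM2l ?sqr_ge0// big_split /= -mulr_sumr.
  apply: lerD.
    rewrite -[leRHS]mulr1 -sum_height [leRHS](bigD1 v)//=.
    by rewrite lerDr.
  rewrite [leRHS]mulrAC ler_wpM2l ?mulr_ge0//.
  by apply: le_trans (crossing_sum hv).
have e2le : e2 <= e1 + e1 ^+ 2 * (1 + lam * c * E / N).
  apply: le_trans (ler_sum _ row) _; rewrite sum_height -/N /e1 -/x.
  by rewrite le_eqVlt; apply/orP; left; apply/eqP; field; rewrite gt_eqF.
have e2ge : e1 <= e2.
  rewrite -E1; apply: ler_sum => v hv; rewrite (bigD1 v)//= ler_wpDr//.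
    by apply: sumr_ge0 => w _; exact: Prends_ge0.
  by rewrite le_eqVlt; apply/orP; left; apply/eqP; apply: eq_bigl => m; rewrite andbb.
have e20 : 0 < e2 by exact: lt_le_trans e2ge.
have := @Prends_second V J Q (evDm k); rewrite E1 -/e2.
move=> /(_ _ e20) h; apply: le_trans (h _); last first.
  by move=> m v hv iv; apply/existsP; exists v; rewrite hv.
set r := lam * c * E / N in e2le *.
have r0 : 0 <= r by apply: divr_ge0; [apply: mulr_ge0 => //; exact: mulr_ge0 | exact: ltW].
have D0 : 0 < e1^-1 + 1 + r by rewrite ltr_wpDr// addr_gt0// invr_gt0.
rewrite ler_pdivlMr// mulrC ler_pdivrMr//; apply: le_trans e2le _.
by rewrite le_eqVlt; apply/orP; left; apply/eqP; field; rewrite gt_eqF.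
Qed.

(** * Union bounds for components and disconnection *)

Local Notation evCm := (@evCm b n).
Local Notation leafset := (leafset b).

Lemma dec_dens0 h (S : leafset h) w : density R S = 0 -> size w = h -> dec S w = false.
Proof. by move=> d sw; rewrite (density0_inj hb d (density_empty R b h)) /emptyS decK. Qed.

Lemma dec_density_gt0 h (S : leafset h) w : size w = h -> dec S w -> 0 < density R S.
Proof.
move=> sw dw; rewrite lt_neqAle density_ge0// andbT eq_sym; apply/eqP => d.
by rewrite (dec_dens0 d sw) in dw.
Qed.

Lemma dec_density_lt1 h (S : leafset h) w : size w = h -> ~~ dec S w -> density R S < 1.
Proof.
move=> sw dw; have := @dec_density_gt0 _ (compl S) w sw.
by rewrite dec_compl// density_compl// subr_gt0; apply.
Qed.

(* Unless it fills [below v], the isolated component splits off a proper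
   nonempty set of leaves below [v]. *)
Lemma evCm_upper : Prends (evCm k) <= Prends (evDm k) +
  \sum_(S : leafset k | 0 < density R S < 1)
    B ^+ (n - k) * expR (- (lam * (set_energy R S + c * density R S ^+ 2))).
Proof.
pose I := (V * leafset k)%type.
pose K (i : I) := (height i.1 == k) && (0 < density R i.2 < 1).
pose Q (i : I) : pred Omega := iso (subset_at n (val i.1) i.2).
pose Dany : pred Omega := fun m => [exists i : I, K i && Q i m].
apply: (@le_trans _ _ (Prends (fun m => evDm k m || Dany m))).
  apply: le_Prends => // m /existsP[x /existsP[v /andP[hv cv]]].
  have [e|ne] := eqVneq (cluster_of m x) (below v).
    apply/orP; left; apply/existsP; exists v; rewrite hv -e; exact: iso_cluster.
  apply/orP; right; apply/existsP.
  pose S := enc k (fun w => [exists y, (y \in cluster_of m x) && (lword y == val v ++ w)]).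
  have sv : size (val v) = (n - k)%N by apply/eqP; rewrite -height_size.
  have decS y : y \in below v -> dec S (drop (size (val v)) (lword y)) = (y \in cluster_of m x).
    rewrite belowE => /prefixP[w ew].
    rewrite ew drop_size_cat// decK; last first.
      by have := size_lword y; rewrite ew size_cat sv; lia.
    apply/existsP/idP => [[z /andP[zc /eqP ez]]|yc]; last by exists y; rewrite yc ew eqxx.
    by rewrite -(lword_inj (etrans ez (esym ew))).
  have eS : subset_at n (val v) S = cluster_of m x.
    apply/setP => y; rewrite inE -belowE; case: (boolP (y \in below v)) => yv /=.
      exact: decS.
    by apply/esym/negP => yc; have := fintype.subsetP cv y yc; rewrite (negPf yv).
  have szd y : y \in below v -> size (drop (size (val v)) (lword y)) = k.
    by move=> _; rewrite size_drop size_lword sv; lia.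
  exists (v, S); rewrite /K /Q /= hv eS iso_cluster andbT /=; apply/andP; split.
    have xc : x \in cluster_of m x by rewrite inE connect0.
    have xv := fintype.subsetP cv x xc.
    by apply: (@dec_density_gt0 _ _ _ (szd x xv)); rewrite decS.
  have : ~~ (below v \subset cluster_of m x).
    by apply: contra ne => h; rewrite finset.eqEsubset cv h.
  move=> /fintype.subsetPn[y yv yc].
  by apply: (@dec_density_lt1 _ _ _ (szd y yv)); rewrite decS.
apply: (@le_trans _ _ (Prends (evDm k) + Prends Dany)).
  apply: le_trans (@Prends_union R b n hb n0 lam lam0 bool predT
    (fun i => if i then evDm k else Dany) _ _) _.
    by move=> m /orP[h|h]; [exists true | exists false].
  by rewrite big_bool.
rewrite lerD2l; apply: le_trans (@Prends_union R b n hb n0 lam lam0 I K Q Dany _) _.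
  by move=> m /existsP[i /andP[Ki Qi]]; exists i.
rewrite /K -(pair_big (fun v : V => height v == k) (fun S : leafset k => 0 < density R S < 1)
  (fun v S => Prends (Q (v, S)))) /= exchange_big /=.
apply: ler_sum => S _; rewrite -sum_height; apply: ler_sum => v hv.
have sn : (size (val v) + k)%N = n.
  by move: hv; rewrite height_size// => /eqP ->; rewrite subnK.
by rewrite Prends_iso// cut_subset_at.
Qed.

(* A component or its complement has density at most 1/2. *)
Lemma disconnected_upper : Prends (fun m : Omega => ~~ connm m) <=
  \sum_(S : leafset n | 0 < density R S <= 1 / 2) expR (- (lam * set_energy R S)).
Proof.
pose Q (S : leafset n) : pred Omega := iso (subset_at n [::] S).
apply: le_trans (@Prends_union R b n hb n0 lam lam0 _
   (fun S : leafset n => 0 < density R S <= 1 / 2) Q _ _) _.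
  move=> m /forallPn[x /forallPn[y xy]].
  pose S := enc n (fun w => [exists z, (z \in cluster_of m x) && (lword z == w)]).
  have decS z : dec S (lword z) = (z \in cluster_of m x).
    rewrite decK ?size_lword//; apply/existsP/idP => [[t /andP[tc /eqP/lword_inj <-//]]|zc].
    by exists z; rewrite zc eqxx.
  have eS : subset_at n [::] S = cluster_of m x.
    by apply/setP => z; rewrite inE prefix0s drop0 /= decS.
  have eC : subset_at n [::] (compl S) = (~: cluster_of m x)%SET.
    by apply/setP => z; rewrite inE prefix0s drop0 /= dec_compl ?size_lword// decS finset.in_setC.
  have d0 : 0 < density R S.
    by apply: (@dec_density_gt0 _ _ (lword x)); rewrite ?size_lword// decS inE connect0.
  have d1 : density R S < 1.
    by apply: (@dec_density_lt1 _ _ (lword y)); rewrite ?size_lword// decS inE.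
  have [h|h] := leP (density R S) (1 / 2).
    by exists S; [rewrite d0 h | rewrite /Q eS; exact: iso_cluster].
  exists (compl S); last by rewrite /Q eC iso_compl; exact: iso_cluster.
  by rewrite density_compl// subr_gt0 d1 /=; lra.
apply: ler_sum => S _; rewrite /Q Prends_iso// (@cut_subset_at R b n hb [::] n)//.
by rewrite /cutn subrr mulr0 mul0r addr0.
Qed.

(** * Splitting the tree at the apex *)

Definition head0 (w : word) : bool := if w is i :: _ then val i == 0%N else false.

(** Isolation as seen from A: only particles started in A are observed, and endpoints outside A are
    ignored. It is implied by [iso] and determined by the rows in A, which gives independence of the
    two parts. *)
Definition iso_in (A S : {set L}) : pred Omega :=
  fun m => [forall x in A, m x \subset ((if x \in S then S else ~: S) :|: ~: A)%SET].

Lemma sum_leaf1 : \sum_(x : L) (1 : R) = B ^+ n.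
Proof. by rewrite (sum_leaf n (fun=> 1)) wsum_cst mulr1. Qed.

(** The ignored flow between the subtree and the complement of A is at most b^k [mu] in each
    direction. *)
Lemma Prends_iso_in (A : {set L}) v : height v == k ->
  (forall x, x \in below v -> x \in A) ->
  (forall x y, x \in A -> y \notin A -> hk R x y = mu R b n / B ^+ n) ->
  Prends (iso_in A (below v)) <= expR (- (lam * (c - B ^+ k * mu R b n))).
Proof.
move=> hv vA hA; set S := below v.
pose a x : {set L} := (if x \in S then S else ~: S)%SET.
pose A' x : {set L} := if x \in A then (a x :|: ~: A)%SET else finset.setT.
have -> : Prends (iso_in A S) = Prends (fun m => [forall x, m x \subset A' x]).
  apply: eq_bigl => m; apply: eq_forallb => x; rewrite /A'.
  by case: (x \in A) => //=; rewrite finset.subsetT.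
rewrite Prends_rect// ler_expR mulNr lerN2 -mulrA ler_wpM2l//.
rewrite ler_pdivlMl//; apply: (@le_trans _ _ (\sum_x \sum_(y in (~: a x)%SET) hk R x y
   - (\sum_(x in S) \sum_(y in (~: A)%SET) hk R x y
      + \sum_(x in (~: A)%SET) \sum_(y in S) hk R x y))).
  rewrite cut_sum /S (cut_below R hb n0 kn' hv) mulrBr lerD2l lerN2.
  have h1 : \sum_(x in S) \sum_(y in (~: A)%SET) hk R x y <= B ^+ k * mu R b n.
    apply: (@le_trans _ _ (\sum_(x in S) mu R b n)).
      apply: ler_sum => x xS.
      rewrite (eq_bigr (fun=> mu R b n / B ^+ n)) => [|y]; last first.
        by rewrite inE => yA; rewrite hA// vA.
      apply: (@le_trans _ _ (\sum_(y : L) mu R b n / B ^+ n)).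
        rewrite [leLHS]big_mkcond; apply: ler_sum => y _; case: ifP => // _.
        by rewrite divr_ge0 ?exprn_ge0// /mu divr_ge0// subr_ge0 ?ler1n ?exprn_ege1 ?ler1n; lia.
      have -> : \sum_(y : L) mu R b n / B ^+ n = (\sum_(y : L) 1) * (mu R b n / B ^+ n).
        by rewrite mulr_suml; apply: eq_bigr => y _; rewrite mul1r.
      by rewrite sum_leaf1 mulrC divfK// Bexp_neq0.
    rewrite -(card_below hv) mulr_suml le_eqVlt; apply/orP; left; apply/eqP.
    by apply: eq_bigr => x _; rewrite mul1r.
  rewrite exchange_big /= in h1 *.
  have -> : \sum_(x in (~: A)%SET) \sum_(y in S) hk R x y =
      \sum_(x in (~: A)%SET) \sum_(y in S) hk R y x.
    by apply: eq_bigr => x _; apply: eq_bigr => y _; rewrite hk_sym.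
  by move: h1; set u := \sum_(x in _) _; lra.
rewrite [X in _ - (X + _)]big_mkcond [X in _ - (_ + X)]big_mkcond -big_split -sumrB /=.
apply: ler_sum => x _.
have mk (b0 : bool) (F : L -> R) : (if b0 then \sum_y F y else 0) = \sum_y if b0 then F y else 0.
  by case: b0 => //; rewrite big1.
rewrite ![\sum_(y in _) _]big_mkcond !mk -big_split -sumrB /=.
apply: ler_sum => y _; have h0 := hk_ge0 R hb n0 x y.
have ia : (y \in (~: a x)%SET) = (x \in S) (+) (y \in S).
  by rewrite finset.in_setC /a; case: (x \in S); rewrite ?finset.in_setC ?negbK.
have iA : (y \in (~: A' x)%SET) = [&& x \in A, y \in A & (x \in S) (+) (y \in S)].
  rewrite finset.in_setC /A'; case: (x \in A); rewrite ?finset.in_setT//=.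
  by rewrite finset.in_setU negb_or -finset.in_setC ia finset.in_setC negbK andbC.
have := vA x; have := vA y; rewrite -/S ia iA !finset.in_setC.
by case: (x \in S); case: (y \in S); case: (x \in A); case: (y \in A) => //= h1 h2;
  try (by have := h1 isT); try (by have := h2 isT); lra.
Qed.

Lemma hk_head (x y : L) : head0 (lword x) != head0 (lword y) ->
  hk R x y = mu R b n / B ^+ n.
Proof.
have H N (w w' : word) : size w = N -> size w' = N -> head0 w != head0 w' ->
    hker R N w w' = mu R b N / B ^+ N.
  case: N => [|N]; first by move=> /size0nil -> /size0nil ->.
  case: w w' => [//|i w] [//|j w'] _ _ ij; apply: hker_head.
  by apply: contraNneq ij => ->.
by apply: H; exact: size_lword.
Qed.

Lemma sum_head0 : \sum_(v : V | height v == k) ((head0 (val v))%:R : R) = B ^+ (n - k) / B.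
Proof.
rewrite (@big_words R b V (fun v => height v == k) val (n - k) (fun w => (head0 w)%:R))//.
- have -> : (n - k = (n - k.+1).+1)%N by lia.
  rewrite /= (bigD1 (Ordinal (ltnW hb)))//= big1 => [|i].
    by rewrite (wsum_cst) mulr1 addr0 exprSr mulfK// B_neq0.
  rewrite -val_eqE /= => /negPf i0; rewrite -[RHS](wsum0 R b (n - k.+1)).
  by apply: eq_wsum => w _; rewrite /pre /= i0.
- by move=> v; rewrite height_size// => /eqP.
- move=> w sw; have lw : (size w <= n)%N by rewrite sw leq_subr.
  by exists (Bseq lw) => //; rewrite height_size//= sw.
Qed.

Lemma iso_sub_in (A S : {set L}) m : iso S m -> iso_in A S m.
Proof.
move=> /forallP h; apply/forall_inP => x _; apply: fintype.subset_trans (h x) _.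
exact: finset.subsetUl.
Qed.

Lemma iso_in_ext (A S : {set L}) (m m' : Omega) :
  (forall x, x \in A -> m x = m' x) -> iso_in A S m = iso_in A S m'.
Proof.
move=> e; apply: eq_forallb => x; case: (boolP (x \in A)) => //= xA.
by rewrite e.
Qed.

(** With an expected number near 1 the union bound over the whole tree gives nothing. The two parts
    have bounds near 1/b and 1 - 1/b, both away from 1, and their failures are independent. *)
Lemma evDm_block (e := expR (- (lam * (c - B ^+ k * mu R b n)))) :
  B ^+ (n - k) * e <= 1 + (2 * B)^-1 ->
  ((2 * B)^-1) ^+ 2 <= Prends (fun m => ~~ evDm k m).
Proof.
move=> hz; set z := B ^+ (n - k) * e in hz.
pose A := [set x : L | head0 (lword x)]%SET.
pose E1 : pred Omega := fun m => [exists v : V,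
  ((height v == k) && head0 (val v)) && iso_in A (below v) m].
pose E2 : pred Omega := fun m => [exists v : V,
  ((height v == k) && ~~ head0 (val v)) && iso_in (~: A)%SET (below v) m].
have e0 : 0 <= e by exact: expR_ge0.
have hd v x : height v == k -> x \in below v -> head0 (lword x) = head0 (val v).
  rewrite height_size// belowE => /eqP sv /prefixP[w ->].
  by case: (val v) sv => [|i u] //=; lia.
have P1 : 1 - z / B <= Prends (fun m => ~~ E1 m).
  rewrite (Prends_compl hb n0 lam0) lerD2l lerN2.
  apply: le_trans (@Prends_union R b n hb n0 lam lam0 V
    (fun v => (height v == k) && head0 (val v)) (fun v => iso_in A (below v)) E1 _) _.
    by move=> m /existsP[v /andP[h1 h2]]; exists v.
  rewrite /z mulrAC -sum_head0 mulr_suml big_mkcondr /=.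
  apply: ler_sum => v hv; case: ifP => hh; last by rewrite mul0r.
  rewrite mul1r; apply: Prends_iso_in => // [x xv|x y]; first by rewrite inE (hd v).
  by rewrite !inE => h1 h2; apply: hk_head; rewrite h1 eq_sym eqb_id.
have P2 : 1 - z * (1 - B^-1) <= Prends (fun m => ~~ E2 m).
  rewrite (Prends_compl hb n0 lam0) lerD2l lerN2.
  apply: le_trans (@Prends_union R b n hb n0 lam lam0 V
    (fun v => (height v == k) && ~~ head0 (val v))
    (fun v => iso_in (~: A)%SET (below v)) E2 _) _.
    by move=> m /existsP[v /andP[h1 h2]]; exists v.
  have -> : z * (1 - B^-1) = (B ^+ (n - k) * 1 - B ^+ (n - k) / B) * e.
    by rewrite /z; ring.
  rewrite -sum_head0 -sum_height -sumrB mulr_suml big_mkcondr /=.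
  apply: ler_sum => v hv; case: (boolP (head0 (val v))) => hh /=.
    by rewrite subrr mul0r.
  rewrite subr0 mul1r; apply: Prends_iso_in => // [x xv|x y]; first by rewrite !inE (hd v).
  by rewrite !inE negbK => h1 h2; apply: hk_head; rewrite h2 eqb_id.
apply: (@le_trans _ _ (Prends (fun m => ~~ E1 m && ~~ E2 m))); last first.
  apply: le_Prends => // m /andP[n1 n2]; apply/negP => /existsP[v /andP[hv iv]].
  case: (boolP (head0 (val v))) => hh.
    by move/negP: n1; apply; apply/existsP; exists v; rewrite hv hh iso_sub_in.
  by move/negP: n2; apply; apply/existsP; exists v; rewrite hv hh iso_sub_in.
rewrite (@Prends_indep R b n hb n0 lam lam0 A (fun m => ~~ E1 m) (fun m => ~~ E2 m)); last 2 first.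
- move=> m m' mm; congr (~~ _); apply: eq_existsb => v; congr (_ && _).
  exact: iso_in_ext.
- move=> m m' mm; congr (~~ _); apply: eq_existsb => v; congr (_ && _).
  by apply: iso_in_ext => x; rewrite inE; exact: mm.
have B2 := B_ge2 R hb; have B0 := B_gt0 R hb.
(* For 0 < t <= 1/2 and z <= 1 + t/2, both 1 - z t and 1 - z (1 - t) are at least t/2. *)
pose t := B^-1; have tE : (2 * B)^-1 = t / 2 by rewrite /t invfM mulrC.
have t0 : 0 < t by rewrite invr_gt0.
have t2 : t <= 1 / 2 by rewrite div1r lef_pV2 ?posrE.
have z0 : 0 <= z by rewrite mulr_ge0// exprn_ge0// ltW.
rewrite tE in hz *; rewrite -/t in P1 P2.
rewrite expr2; apply: ler_pM; rewrite ?divr_ge0 ?(ltW t0)//.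
  by apply: le_trans P1; nra.
by apply: le_trans P2; nra.
Qed.

End Bounds.

(** * Limits *)

Section Asymptotics.
Variables (R : realType) (b : nat).
Hypothesis hb : (2 <= b)%N.
Local Notation B := (b%:R : R).
Local Notation ell := (ln B).
Local Notation cutoo := (cutoo R b).
Local Notation cutn := (cutn R b).
Local Notation kap := (@kap R b).

Lemma ell_gt0 : 0 < ell. Proof. exact: ln_gt0 (B_gt1 R hb). Qed.

Lemma Bexp_expR n : B ^+ n = expR (ell * n%:R).
Proof. by rewrite expRM_natr lnK// posrE B_gt0. Qed.

Lemma Bexp_inv n : (B ^+ n)^-1 = expR (- (ell * n%:R)).
Proof. by rewrite Bexp_expR expRN. Qed.

Lemma expR_ge_pow m (x : R) : 0 <= x -> x ^+ m <= m`!%:R * expR x.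
Proof.
move=> x0; rewrite mulrC -ler_pdivrMr ?ltr0n ?fact_gt0//.
rewrite -lee_fin -esum_exp_coeff// (esumID [set m]); last first.
  by move=> i _; rewrite lee_fin divr_ge0// exprn_ge0.
rewrite setTI esum_set1 ?lee_fin ?divr_ge0 ?exprn_ge0// leeDl// esum_ge0// => i _.
by rewrite lee_fin divr_ge0// exprn_ge0.
Qed.

Lemma poly_exp_cvg0 m (g : R) : 0 < g ->
  n%:R ^+ m * expR (- (g * n%:R)) @[n --> \oo] --> 0.
Proof.
move=> g0.
have bd j n : n%:R ^+ j * expR (- (g * n%:R)) <= j`!%:R / g ^+ j.
  have := @expR_ge_pow j (g * n%:R) (mulr_ge0 (ltW g0) (ler0n R n)).
  rewrite exprMn => h; rewrite expRN ler_pdivrMr ?expR_gt0//.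
  by rewrite mulrAC ler_pdivlMr ?exprn_gt0// mulrC.
pose C := m.+1`!%:R / g ^+ m.+1 + m`!%:R / g ^+ m.
apply: (@squeeze_cvgr _ _ _ _ (fun=> 0) (fun n => C * harmonic n)).
- apply: nearW => n; rewrite mulr_ge0 ?exprn_ge0 ?expR_ge0//=.
  rewrite ler_pdivlMr ?ltr0Sn// -natr1 mulrDr mulr1 mulrAC -exprSr.
  by rewrite lerD.
- exact: cvg_cst.
- by rewrite -[X in _ --> X](mulr0 C); apply: cvgMr; exact: cvg_harmonic.
Qed.

Lemma exp_cvg0 (g : R) : 0 < g -> expR (- (g * n%:R)) @[n --> \oo] --> 0.
Proof.
move=> g0; have := @poly_exp_cvg0 0 g g0.
by under eq_fun do rewrite expr0 mul1r.
Qed.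

(** The loss from the finite height plus the flow ignored in [Prends_iso_in], so that one error term
    serves all upper bounds. *)
Definition err k n : R := (B ^+ k) ^+ 2 / (B ^+ n) ^+ 2 * cutoo n + B ^+ k * mu R b n.

Lemma mu_ge0 n : (0 < n)%N -> 0 <= mu R b n.
Proof. by case: n => // n _; rewrite ltW// mu_gt0. Qed.

Lemma err_ge0 k n : (0 < n)%N -> 0 <= err k n.
Proof.
by move=> n0; rewrite /err addr_ge0// mulr_ge0 ?mu_ge0 ?exprn_ge0 ?(ltW (cutoo_gt0 R hb n)).
Qed.

Lemma cutn_err k n : cutn k n - B ^+ k * mu R b n = cutoo k - err k n.
Proof. by rewrite cutnE// /err; ring. Qed.

Lemma cutn_ge k n : (0 < n)%N -> cutoo k - err k n <= cutn k n.
Proof.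
by move=> n0; rewrite -cutn_err gerBl mulr_ge0 ?mu_ge0.
Qed.

Lemma err_cvg k : n%:R * err k n @[n --> \oo] --> 0.
Proof.
pose C := (B ^+ k) ^+ 2 + B ^+ k * (2 * (B - 1)).
have B1 := B_gt1 R hb; have B2 := B_ge2 R hb; have B0 := B_gt0 R hb.
apply: (@squeeze_cvgr _ _ _ _ (fun=> 0)
   (fun n => C * (n%:R ^+ 1 * expR (- (ell * n%:R))))).
- near=> n; have n0 : (0 < n)%N by near: n; exact: nbhs_infty_gt.
  rewrite mulr_ge0 ?err_ge0//= expr1 mulrCA ler_wpM2l// -Bexp_inv.
  have X2 : 2 <= B ^+ n.
    by rewrite (le_trans B2)// -[leLHS]expr1 ler_weXn2l// ltW.
  rewrite mulrDl lerD//.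
    rewrite -mulrA ler_wpM2l ?exprn_ge0// ?(ltW B0)//.
    have c1 : cutoo n <= 1 by rewrite (le_trans (ltW (cutoo_lt_kap R hb n)))// kap_le1.
    rewrite expr2 invfM -mulrA ler_piMr ?invr_ge0 ?exprn_ge0// ?(ltW B0)//.
    rewrite mulr_ile1 ?invr_ge0 ?exprn_ge0 ?(ltW B0) ?(ltW (cutoo_gt0 R hb n))//.
    by rewrite invf_le1 ?exprn_gt0//; lra.
  rewrite -mulrA ler_wpM2l ?exprn_ge0// ?(ltW B0)// /mu.
  rewrite ler_pdivrMr; last lra.
  by rewrite mulrAC ler_pdivlMr; [nra|lra].
- exact: cvg_cst.
- by rewrite -[X in _ --> X](mulr0 C); apply: cvgMr; apply: poly_exp_cvg0; exact: ell_gt0.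
Unshelve. all: by end_near. Qed.

Lemma err_exp_cvg k (s : R) : expR (s * (n%:R * err k n)) @[n --> \oo] --> (1 : R).
Proof.
rewrite -[X in _ --> X]expR0 -(mulr0 s).
by apply: continuous_cvg; [exact: continuous_expR | apply: cvgMr; exact: err_cvg].
Qed.

Lemma expected_eq k n (s : R) : (k <= n)%N ->
  B ^+ (n - k) * expR (- (s * n%:R * (cutoo k - err k n))) =
  (B ^+ k)^-1 * expR (- ((s * cutoo k - ell) * n%:R)) * expR (s * (n%:R * err k n)).
Proof.
move=> kn; rewrite Bexp_inv Bexp_expR -!expRD natrB//; congr expR; ring.
Qed.

Definition sigma k : R := ell / cutoo k.

Lemma sigma_lt k : sigma k < sigma k.+1.
Proof. by rewrite ltr_pM2l ?ell_gt0// ltf_pV2 ?posrE ?cutoo_gt0// cutoo_dec. Qed.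

Lemma sigma_gt0 k : 0 < sigma k.
Proof. by rewrite divr_gt0 ?ell_gt0 ?cutoo_gt0. Qed.

Lemma sigma_critE : sigma_crit R b = ell / (gratio R b * kapoo R b).
Proof.
have B1 := B_gt1 R hb; rewrite /sigma_crit /gratio /kapoo; field.
by rewrite B_neq0// gt_eqF ?addr_gt0 ?B_gt0// subr_eq0 gt_eqF.
Qed.

Lemma sigma_cvg : sigma k @[k --> \oo] --> sigma_crit R b.
Proof.
rewrite sigma_critE; apply: cvgMr; apply/cvgVP; last exact: cutoo_cvg.
by rewrite gt_eqF// mulr_gt0 ?gratio_gt0 ?kapoo_gt0.
Qed.

Lemma whp_ge (s : R) (E : forall n, set (outcome b n)) (f : nat -> R) :
  (\forall n \near \oo, ((f n)%:E <= Pr b n (s * n%:R) (E n) <= 1)%E) ->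
  f n @[n --> \oo] --> (1 : R) -> whp s E.
Proof.
move=> h f1; apply: (squeeze_cvge h); last exact: cvg_cst.
by apply: cvg_EFin f1; apply: nearW.
Qed.

(** * Asymptotic moment bounds at a fixed height *)

Section Fixed.
Variable k : nat.

(** The correlation term of [evDm_lower] at [lam = s * n%:R], with the cut bounded by 1. *)
Definition overlap (s : R) n : R :=
  B ^+ k * s * (n%:R ^+ 1 * expR (- ((ell - s * (kap k / B)) * n%:R))).

Lemma overlap_cvg (s : R) : 0 <= s -> s <= sigma k -> overlap s n @[n --> \oo] --> 0.
Proof.
move=> s0 ss; rewrite -[X in _ --> X](mulr0 (B ^+ k * s)); apply: cvgMr.
apply: poly_exp_cvg0; rewrite subr_gt0.
(* The flow to one sibling is less than the whole cut: the parent's term alone is kap (1 - 1/b), at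
   least kap / b since b >= 2. *)
have d : kap k / B < cutoo k.
  rewrite (cutoo_rec R hb); apply: (@le_lt_trans _ _ (kap k * (1 - B^-1))).
    rewrite ler_wpM2l// ?(ltW (kap_gt0 R hb k))//.
    have : B^-1 <= 2^-1 by rewrite lef_pV2 ?posrE ?B_gt0// B_ge2.
    lra.
  by rewrite ltrDl divr_gt0 ?cutoo_gt0 ?exprn_gt0 ?B_gt0.
have [->|sn0] := eqVneq s 0; first by rewrite mul0r ell_gt0.
have sp : 0 < s by rewrite lt_neqAle eq_sym sn0.
apply: (@lt_le_trans _ _ (s * cutoo k)); first by rewrite ltr_pM2l.
by rewrite -ler_pdivlMr ?cutoo_gt0.
Qed.

Definition low_bound (s : R) n : R :=
  (B ^+ k * expR (- ((ell - s * cutoo k) * n%:R)) + 1 + overlap s n)^-1.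

Lemma evD_low (s : R) n : 0 <= s -> (k < n)%N ->
  low_bound s n <= Prends (s * n%:R) (@evDm b n k).
Proof.
move=> s0 kn; have n0 : (0 < n)%N by exact: leq_ltn_trans kn.
have l0 : 0 <= s * n%:R by rewrite mulr_ge0.
apply: le_trans (evDm_lower hb n0 l0 kn).
have B0 := B_gt0 R hb; have X0 m : 0 < B ^+ m by rewrite exprn_gt0.
have c0 : 0 <= cutn k n by rewrite cutn_ge0// ltnW.
have t0 : 0 <= overlap s n by rewrite !mulr_ge0 ?exprn_ge0 ?expR_ge0// ltW.
rewrite /low_bound lef_pV2 ?posrE; last 2 first.
- by rewrite ltr_wpDr// ltr_wpDl// mulr_ge0 ?expR_ge0// ltW.
- apply: ltr_wpDr; first by rewrite divr_ge0 ?exprn_ge0// mulr_ge0 ?expR_ge0// mulr_ge0.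
  by rewrite addr_gt0// invr_gt0 mulr_gt0// expR_gt0.
apply: lerD; first rewrite lerD2r.
  rewrite invfM -expRN opprK Bexp_inv natrB ?(ltnW kn)// Bexp_expR -!expRD ler_expR.
  have := ler_wpM2l l0 (cutn_le R hb k n); set u := s * _ * cutn _ _.
  by rewrite (mulrAC s); lra.
rewrite /overlap expr1 Bexp_inv natrB ?(ltnW kn)// Bexp_expR.
have -> : expR (ell * k%:R) * s * (n%:R * expR (- ((ell - s * (kap k / B)) * n%:R))) =
   s * n%:R * expR (s * n%:R * (kap k / B)) * expR (- (ell * (n%:R - k%:R))).
  rewrite [LHS](_ : _ = s * n%:R * (expR (ell * k%:R) *
    expR (- ((ell - s * (kap k / B)) * n%:R)))); last by ring.
  by rewrite -[RHS]mulrA -!expRD; congr (_ * expR _); ring.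
rewrite ler_wpM2r ?expR_ge0// ler_wpM2r ?expR_ge0// ler_piMr//.
apply: le_trans (cutn_le R hb k n) _.
by rewrite (le_trans (ltW (cutoo_lt_kap R hb k)))// kap_le1.
Qed.

Definition up_bound (s : R) n : R :=
  expR (- ((s * cutoo k - ell) * n%:R)) * expR (s * (n%:R * err k n)).

Lemma expected_le (s : R) n : (k <= n)%N ->
  B ^+ (n - k) * expR (- (s * n%:R * (cutoo k - err k n))) <= up_bound s n.
Proof.
move=> kn; rewrite expected_eq// -mulrA ler_piMl ?mulr_ge0 ?expR_ge0//.
by rewrite invf_le1 ?exprn_gt0 ?B_gt0// exprn_ege1// ltW// B_gt1.
Qed.

Lemma evD_up (s : R) n : 0 <= s -> (k < n)%N ->
  Prends (s * n%:R) (@evDm b n k) <= up_bound s n.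
Proof.
move=> s0 kn; have n0 : (0 < n)%N by exact: leq_ltn_trans kn.
have l0 : 0 <= s * n%:R by rewrite mulr_ge0.
apply: le_trans (evDm_upper hb n0 l0 kn) _.
apply: le_trans (expected_le s (ltnW kn)).
rewrite ler_wpM2l ?exprn_ge0 ?(ltW (B_gt0 R hb))// ler_expR lerN2 ler_wpM2l//.
exact: cutn_ge.
Qed.

(** For fixed [k] there are boundedly many proper sets below a vertex, and each costs at least [d]
    more than the full one. From [sigma k] on, the expected number of isolated full subtrees is
    bounded, so the proper sets are exponentially rare. *)
Lemma evC_up : exists C d : R, 0 < d /\ forall (s : R) n, sigma k <= s -> (k < n)%N ->
  Prends (s * n%:R) (@evCm b n k) <= Prends (s * n%:R) (@evDm b n k)
    + C * (expR (- (s * d * n%:R)) * expR (s * (n%:R * err k n))).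
Proof.
have [d d0 gap] := set_energy_gap R hb k.
exists (#|leafset b k|%:R), d; split=> // s n ss kn.
have n0 : (0 < n)%N by exact: leq_ltn_trans kn.
have s0 : 0 <= s := le_trans (ltW (sigma_gt0 k)) ss.
have l0 : 0 <= s * n%:R by rewrite mulr_ge0.
apply: le_trans (evCm_upper hb n0 l0 kn) _; rewrite lerD2l.
set F := expR _ * _.
have F0 : 0 <= F by rewrite mulr_ge0 ?expR_ge0.
have -> : #|leafset b k|%:R * F = \sum_(S : leafset b k) F.
  by rewrite sumr_const mulr_natl.
rewrite [leLHS]big_mkcond; apply: ler_sum => S _; case: ifPn => // hS.
have g := gap S hS; have /andP[dS dS1] := hS.
apply: (@le_trans _ _ (B ^+ (n - k) *
   expR (- (s * n%:R * (cutoo k - err k n))) * expR (- (s * d * n%:R)))).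
  rewrite -[leRHS]mulrA ler_wpM2l ?exprn_ge0 ?(ltW (B_gt0 R hb))// -expRD ler_expR.
  have e0 := err_ge0 k n0; have c1 := cutn_ge k n0.
  have h : cutoo k - err k n + d <= set_energy R S + cutn k n * density R S ^+ 2.
    have D2 : density R S ^+ 2 <= 1 by rewrite exprn_ile1// ltW.
    have D20 := sqr_ge0 (density R S).
    by move: g; set D := density R S ^+ 2 in D2 D20 *; nra.
  have := ler_wpM2l l0 h; set u := _ * (set_energy _ _ + _).
  by rewrite mulrDr (mulrAC s d); lra.
rewrite /F mulrC ler_wpM2l ?expR_ge0//.
apply: le_trans (expected_le s (ltnW kn)) _.
rewrite /up_bound ler_piMl ?expR_ge0// -[leRHS]expR0 ler_expR oppr_le0 mulr_ge0//.
by rewrite subr_ge0 -ler_pdivrMr ?cutoo_gt0.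
Qed.

End Fixed.

Lemma decay_asym (r : R) : ell < r -> exists2 eta, 0 < eta &
  \forall n \near \oo, forall a g : R, (B ^+ n)^-1 <= a <= 1 ->
    1 - 2 * a <= g -> 8^-1 <= g ->
    expR (- (r * n%:R * g)) <= expR (- (eta * n%:R)) * a.
Proof.
move=> hr; have l0 := ell_gt0; have r0 : 0 < r by lra.
(* For a <= a0 the exponent exceeds [ell] by (r - ell)/2. For larger a it is at least r/8: one half
   pays for [eta], the other makes the remaining factor smaller than [a0]. *)
pose eta := Num.min ((r - ell) / 2) (r / 16).
have eta0 : 0 < eta by rewrite lt_min !divr_gt0// subr_gt0.
have eta1 : eta <= (r - ell) / 2 by rewrite ge_min lexx.
have eta2 : eta <= r / 16 by rewrite ge_min lexx orbT.
pose a0 := (r - ell) / (4 * r).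
have a00 : 0 < a0 by rewrite divr_gt0 ?subr_gt0// mulr_gt0.
exists eta => //.
have h1 : \forall n \near \oo, expR (- ((r / 16) * n%:R)) < a0.
  by apply: (cvgr_lt 0) => //; apply: exp_cvg0; rewrite divr_gt0.
near=> n => a g /andP[an a1] ga g8.
have n0 : 0 <= n%:R :> R by [].
have [aa|aa] := leP a a0.
  apply: (@le_trans _ _ (expR (- (eta * n%:R)) * (B ^+ n)^-1)); last first.
    by rewrite ler_wpM2l ?expR_ge0.
  rewrite Bexp_inv -expRD ler_expR -opprD lerN2 -mulrDl mulrAC ler_wpM2r//.
  have : r * (1 - 2 * a0) <= r * g by rewrite ler_wpM2l ?(ltW r0)//; lra.
  have -> : r * (1 - 2 * a0) = r - (r - ell) / 2 by rewrite /a0; field; rewrite gt_eqF.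
  lra.
apply: (@le_trans _ _ (expR (- (eta * n%:R)) * a0)); last first.
  by rewrite ler_wpM2l ?expR_ge0// ltW.
have h : expR (- ((r / 16) * n%:R)) < a0 by near: n.
apply: le_trans (ler_wpM2l (expR_ge0 _) (ltW h)).
rewrite -expRD ler_expR -opprD lerN2 -mulrDl mulrAC ler_wpM2r//.
have : r * 8^-1 <= r * g by rewrite ler_wpM2l ?(ltW r0).
lra.
Unshelve. all: by end_near. Qed.

Lemma disconnected_cvg (s : R) : sigma_crit R b < s -> exists2 f : nat -> R,
  f n @[n --> \oo] --> 0 &
  \forall n \near \oo, Prends (s * n%:R) (fun m => ~~ @connm b n m) <= f n.
Proof.
have q0 := gratio_gt0 R hb; have k0 := kapoo_gt0 R hb.
rewrite sigma_critE (ltr_pdivrMr _ _ (mulr_gt0 q0 k0)) => hs.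
have s0 : 0 < s.
  by rewrite -(pmulr_lgt0 _ (mulr_gt0 q0 k0)); apply: lt_trans hs; exact: ell_gt0.
have [eta eta0 dec] := decay_asym hs.
exists (fun n => 2 * (n%:R ^+ 1 * expR (- (eta * n%:R)))).
  by rewrite -[X in _ --> X](mulr0 2); apply: cvgMr; exact: poly_exp_cvg0.
(* This yields [small], since 6n dominates both 2n and 2 + 4n. *)
have sm : \forall n \near \oo,
    (2 * 6 ^+ b) * (n%:R ^+ b * expR (- (eta * n%:R))) < 1 :> R.
  apply: (cvgr_lt 0) => //; rewrite -[X in _ --> X](mulr0 (2 * 6 ^+ b)).
  by apply: cvgMr; exact: poly_exp_cvg0.
near=> n.
have n0 : (0 < n)%N by near: n; exact: nbhs_infty_gt.
have l0 : 0 <= s * n%:R by rewrite mulr_ge0 ?(ltW s0).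
apply: le_trans (disconnected_upper hb n0 l0) _.
pose T := s * n%:R * kapoo R b.
have T0 : 0 <= T by apply: mulr_ge0 => //; exact: ltW.
apply: (@le_trans _ _ (\sum_(S : leafset b n | 0 < density R S <= 1 / 2)
    expR (- (T * set_unit_energy R S)))).
  apply: ler_sum => S _; rewrite ler_expR lerN2 /T -mulrA ler_wpM2l//.
  exact: energy_ge_unit_energy.
set beta := expR (- (eta * n%:R)).
have b01 : 0 <= beta <= 1.
  by rewrite expR_ge0 -[leRHS]expR0 ler_expR oppr_le0 mulr_ge0 ?(ltW eta0).
have dec' (a g : R) : (B ^+ n)^-1 <= a <= 1 -> 1 - 2 * a <= g -> 8^-1 <= g ->
    expR (- (T * gratio R b * g)) <= beta * a.
  have -> : T * gratio R b = s * (gratio R b * kapoo R b) * n%:R by rewrite /T; ring.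
  have h : forall a g : R, (B ^+ n)^-1 <= a <= 1 ->
    1 - 2 * a <= g -> 8^-1 <= g ->
    expR (- (s * (gratio R b * kapoo R b) * n%:R * g)) <= expR (- (eta * n%:R)) * a.
    by near: n.
  exact: h.
apply: le_trans (partition_bound hb b01 T0 dec' _) _; last first.
  by rewrite natrM expr1 le_eqVlt; apply/orP; left; apply/eqP; rewrite -/beta; ring.
have h : (2 * 6 ^+ b) * (n%:R ^+ b * expR (- (eta * n%:R))) < 1 :> R by near: n.
apply: le_trans (ltW h); rewrite -/beta mulrA [leRHS]mulrC.
have /andP[b0 _] := b01; apply: ler_wpM2l => //.
rewrite -mulrA -exprMn mulr_natl mulr2n; apply: lerD.
  apply: (@le_trans _ _ ((6 * n)%:R ^+ 1)).
    by rewrite expr1 ler_nat leq_mul2r orbT.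
  rewrite natrM; apply: ler_weXn2l; last by lia.
  by rewrite -natrM ler1n; lia.
by rewrite -natrM; apply: lerXn2r; rewrite ?nnegrE ?ler0n// ler_nat; lia.
Unshelve. all: by end_near. Qed.

End Asymptotics.

(** * Thresholds and behaviour at the thresholds *)

Section Final.
Variables (R : realType) (b : nat).
Hypothesis hb : (2 <= b)%N.
Local Notation B := (b%:R : R).
Local Notation sigma := (sigma R b).

Lemma evCm_disc n k (m : {ffun leaf b n -> {set leaf b n}}) :
  (k < n)%N -> evCm k m -> ~~ connm m.
Proof.
move=> kn /existsP[x /existsP[v /andP[hv /fintype.subsetP cv]]].
have n0 : (0 < n)%N by exact: leq_ltn_trans kn.
have sv : size (val v) = (n - k)%N.
  by apply/eqP; rewrite -(height_size hb n0) ?(ltnW kn).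
pose i0 : 'I_b := Ordinal (ltnW hb); pose i1 : 'I_b := Ordinal hb.
(* As k < n, [v] is not the apex, and a leaf in the other part of the tree lies outside its
   subtree. *)
pose i := if head0 (val v) then i1 else i0.
have [y ey] : exists y : leaf b n, lword y = nseq n i.
  by apply: lword_surj; rewrite size_nseq.
apply/negP => /forallP /(_ x) /forallP /(_ y) xy.
have : y \in below v by apply: cv; rewrite inE.
rewrite belowE ey => /prefixP[w ew].
have : head0 (nseq n i) = head0 (val v).
  by rewrite ew; case: (val v) sv => //=; lia.
have H p : (0 < p)%N -> head0 (nseq p i) = (val i == 0%N) by case: p.
by rewrite H// /i; case: head0.
Qed.

Lemma Pr_D n k (s : R) : 0 <= s -> (0 < n)%N ->
  Pr b n (s * n%:R) (evD b n k) = (Prends (s * n%:R) (@evDm b n k))%:E.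
Proof. by move=> s0 n0; apply: Pr_ends => //; [rewrite mulr_ge0 | exact: evD_m]. Qed.

Lemma Pr_C n k (s : R) : 0 <= s -> (0 < n)%N ->
  Pr b n (s * n%:R) (evC b n k) = (Prends (s * n%:R) (@evCm b n k))%:E.
Proof. by move=> s0 n0; apply: Pr_ends => //; [rewrite mulr_ge0 | exact: evC_m]. Qed.

Lemma Pr_conn n (s : R) : 0 <= s -> (0 < n)%N ->
  Pr b n (s * n%:R) (ev_connected b n) = (Prends (s * n%:R) (@connm b n))%:E.
Proof. by move=> s0 n0; apply: Pr_ends => //; [rewrite mulr_ge0 | exact: conn_m]. Qed.

Lemma Pr_setC n (s : R) (E : set (outcome b n))
    (P : pred {ffun leaf b n -> {set leaf b n}}) :
  0 <= s -> (0 < n)%N -> (forall o, E o <-> P (ends o)) ->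
  Pr b n (s * n%:R) (~` E) = (1 - Prends (s * n%:R) P)%:E.
Proof.
move=> s0 n0 EP; rewrite -Prends_compl// ?mulr_ge0//.
apply: Pr_ends => //; first by rewrite mulr_ge0.
move=> o; rewrite /setC /=; split=> [nE|/negP nP /EP//].
by apply/negP => /EP.
Qed.

Lemma low_bound_cvg k (s : R) : 0 <= s -> s < sigma k -> low_bound b k s n @[n --> \oo] --> (1 : R).
Proof.
move=> s0 ss; rewrite -[X in _ --> X]invr1; apply/cvgVP; first exact: oner_neq0.
rewrite -[X in _ --> X](addr0 1); apply: cvgD; last exact: overlap_cvg (ltW ss).
rewrite -[X in _ --> X](add0r 1); apply: cvgD; last exact: cvg_cst.
rewrite -[X in _ --> X](mulr0 (B ^+ k)); apply: cvgMr; apply: exp_cvg0.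
by rewrite subr_gt0 -ltr_pdivlMr ?cutoo_gt0.
Qed.

Lemma up_bound_cvg k (s : R) : sigma k < s -> up_bound b k s n @[n --> \oo] --> (0 : R).
Proof.
move=> ss; rewrite -[X in _ --> X](mul0r 1); apply: cvgM; last exact: err_exp_cvg.
by apply: exp_cvg0; rewrite subr_gt0 -ltr_pdivrMr ?cutoo_gt0.
Qed.

Lemma up_bound_sigma k n : up_bound b k (sigma k) n = expR (sigma k * (n%:R * err R b k n)).
Proof.
rewrite /up_bound /sigma divfK ?gt_eqF ?cutoo_gt0//.
by rewrite subrr mul0r oppr0 expR0 mul1r.
Qed.

Lemma whp_low k (s : R) : 0 <= s -> s < sigma k ->
  whp s (fun n => evC b n k) /\ whp s (fun n => evD b n k).
Proof.
move=> s0 ss; split; apply: (whp_ge _ (low_bound_cvg s0 ss)); near=> n;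
  have kn : (k < n)%N by near: n; exact: nbhs_infty_gt.
  have n0 : (0 < n)%N by exact: leq_ltn_trans kn.
  have l0 : 0 <= s * n%:R by rewrite mulr_ge0.
  rewrite Pr_C// !lee_fin Prends_le1// andbT; apply: le_trans (evD_low hb s0 kn) _.
  by apply: le_Prends => // m; apply: evDC => //; exact: ltnW.
have n0 : (0 < n)%N by exact: leq_ltn_trans kn.
have l0 : 0 <= s * n%:R by rewrite mulr_ge0.
by rewrite Pr_D// !lee_fin Prends_le1// andbT evD_low.
Unshelve. all: by end_near. Qed.

Lemma whp_high k (s : R) : sigma k < s ->
  whp s (fun n => ~` evC b n k) /\ whp s (fun n => ~` evD b n k).
Proof.
move=> ss; have s0 : 0 < s by apply: lt_trans ss; exact: sigma_gt0.
have [C [d [d0 hC]]] := evC_up R hb k.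
split.
  apply: (@whp_ge _ _ _ _ (fun n => 1 - (up_bound b k s n +
     C * (expR (- (s * d * n%:R)) * expR (s * (n%:R * err R b k n)))))).
    near=> n; have kn : (k < n)%N by near: n; exact: nbhs_infty_gt.
    have n0 : (0 < n)%N by exact: leq_ltn_trans kn.
    rewrite (@Pr_setC _ _ _ (@evCm b n k))//; [|exact: ltW|exact: evC_m].
    rewrite !lee_fin gerBl Prends_ge0 ?mulr_ge0 ?(ltW s0)// andbT lerD2l lerN2.
    by apply: le_trans (hC _ _ (ltW ss) kn) _; rewrite lerD2r evD_up// ltW.
  rewrite -[X in _ --> X](subr0 1); apply: cvgB; first exact: cvg_cst.
  rewrite -[X in _ --> X](addr0 0); apply: cvgD; first exact: up_bound_cvg.
  rewrite -[X in _ --> X](mulr0 C); apply: cvgMr.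
  rewrite -[X in _ --> X](mul0r 1); apply: cvgM; last exact: err_exp_cvg.
  by apply: exp_cvg0; rewrite mulr_gt0.
apply: (@whp_ge _ _ _ _ (fun n => 1 - up_bound b k s n)).
  near=> n; have kn : (k < n)%N by near: n; exact: nbhs_infty_gt.
  have n0 : (0 < n)%N by exact: leq_ltn_trans kn.
  rewrite (@Pr_setC _ _ _ (@evDm b n k))//; [|exact: ltW|exact: evD_m].
  rewrite !lee_fin gerBl Prends_ge0 ?mulr_ge0 ?(ltW s0)// andbT lerD2l lerN2.
  by rewrite evD_up// ltW.
rewrite -[X in _ --> X](subr0 1); apply: cvgB; first exact: cvg_cst.
exact: up_bound_cvg.
Unshelve. all: by end_near. Qed.

Lemma whp_disconnected (s : R) : 0 <= s -> s < sigma_crit R b ->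
  whp s (fun n => ~` ev_connected b n).
Proof.
move=> s0 sc.
have [k sk] : exists k, s < sigma k.
  have [N _ hN] := cvgr_gt _ (sigma_cvg hb) _ sc.
  by exists N; apply: hN => /=.
apply: (whp_ge _ (low_bound_cvg s0 sk)); near=> n.
have kn : (k < n)%N by near: n; exact: nbhs_infty_gt.
have n0 : (0 < n)%N by exact: leq_ltn_trans kn.
have l0 : 0 <= s * n%:R by rewrite mulr_ge0.
rewrite (@Pr_setC _ _ _ (@connm b n))//; last exact: conn_m.
rewrite !lee_fin gerBl Prends_ge0// andbT -Prends_compl//.
apply: le_trans (evD_low hb s0 kn) _; apply: le_Prends => // m h.
by apply: (evCm_disc kn); apply: evDC => //; exact: ltnW.
Unshelve. all: by end_near. Qed.

Lemma whp_connected (s : R) : sigma_crit R b < s -> whp s (fun n => ev_connected b n).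
Proof.
move=> sc; have [f f0 hf] := disconnected_cvg hb sc.
have s0 : 0 <= s.
  apply: ltW; apply: le_lt_trans sc; rewrite sigma_critE//.
  have e0 := ell_gt0 R hb; have q0 := gratio_gt0 R hb; have k0 := kapoo_gt0 R hb.
  by apply: divr_ge0; [exact: ltW | apply: mulr_ge0; exact: ltW].
apply: (@whp_ge _ _ _ _ (fun n => 1 - f n)); last first.
  by rewrite -[X in _ --> X](subr0 1); apply: cvgB => //; exact: cvg_cst.
near=> n; have n0 : (0 < n)%N by near: n; exact: nbhs_infty_gt.
have l0 : 0 <= s * n%:R by rewrite mulr_ge0.
rewrite Pr_conn// !lee_fin Prends_le1// andbT.
have h : Prends (s * n%:R) (fun m => ~~ @connm b n m) <= f n by near: n.
by move: h; rewrite Prends_compl//; lra.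
Unshelve. all: by end_near. Qed.

Lemma bounded_away_sigma k :
  bounded_away (sigma k) (fun n => evD b n k) /\
  bounded_away (sigma k) (fun n => evC b n k).
Proof.
have B0 := B_gt0 R hb; have s0 := sigma_gt0 R hb k; have s0' := ltW s0.
have [C [d [d0 hC]]] := evC_up R hb k.
pose u := ((2 * B)^-1) ^+ 2.
have u0 : 0 < u by rewrite exprn_gt0// invr_gt0 mulr_gt0.
(* At [sigma k] the lower bound is 1 / (b^k + 1 + overlap) with overlap eventually below 1.
   [evDm_block] leaves room [u] below 1, half of which absorbs the excess of C_k over D_k. *)
pose c := Num.min ((B ^+ k + 2)^-1) (u / 2).
have c1 : c <= (B ^+ k + 2)^-1 by rewrite ge_min lexx.
have c2 : c <= u / 2 by rewrite ge_min lexx orbT.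
have c0 : 0 < c.
  by rewrite lt_min invr_gt0 divr_gt0// andbT addr_gt0// exprn_gt0.
have tc : \forall n \near \oo, overlap b k (sigma k) n < 1.
  by apply: (cvgr_lt 0) => //; apply: overlap_cvg.
have ec : \forall n \near \oo,
    expR (sigma k * (n%:R * err R b k n)) < 1 + (2 * B)^-1.
  apply: (cvgr_lt 1); first exact: err_exp_cvg.
  by rewrite ltrDl invr_gt0 mulr_gt0.
have cutoo : \forall n \near \oo,
    C * (expR (- (sigma k * d * n%:R)) * expR (sigma k * (n%:R * err R b k n))) < u / 2.
  apply: (cvgr_lt 0); last by rewrite divr_gt0.
  rewrite -[X in _ --> X](mulr0 C); apply: cvgMr.
  rewrite -[X in _ --> X](mul0r 1); apply: cvgM; last exact: err_exp_cvg.
  by apply: exp_cvg0; rewrite mulr_gt0.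
have low : \forall n \near \oo, c <= Prends (sigma k * n%:R) (@evDm b n k).
  near=> n; have kn : (k < n)%N by near: n; exact: nbhs_infty_gt.
  have t1 : overlap b k (sigma k) n < 1 by near: n.
  have t0 : 0 <= overlap b k (sigma k) n.
    apply: mulr_ge0; first by apply: mulr_ge0 => //; exact: exprn_ge0.
    by apply: mulr_ge0; [exact: exprn_ge0 | exact: expR_ge0].
  apply: le_trans (evD_low hb s0' kn); apply: le_trans c1 _.
  rewrite /low_bound /sigma divfK ?gt_eqF ?cutoo_gt0// subrr mul0r oppr0 expR0 mulr1.
  have X0 : 0 < B ^+ k by rewrite exprn_gt0.
  by rewrite lef_pV2 ?posrE; move: t0 t1; rewrite /sigma; lra.
have upD : \forall n \near \oo, Prends (sigma k * n%:R) (@evDm b n k) <= 1 - u.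
  near=> n; have kn : (k < n)%N by near: n; exact: nbhs_infty_gt.
  have n0 : (0 < n)%N by exact: leq_ltn_trans kn.
  have l0 : 0 <= sigma k * n%:R by rewrite mulr_ge0.
  have e1 : expR (sigma k * (n%:R * err R b k n)) < 1 + (2 * B)^-1 by near: n.
  have := evDm_block hb n0 l0 kn; rewrite /= cutn_err// Prends_compl// -/u.
  move=> h; have {}h : u <= 1 - Prends (sigma k * n%:R) (@evDm b n k).
    apply: h; apply: le_trans (ltW e1); rewrite -up_bound_sigma.
    by apply: expected_le => //; exact: ltnW.
  lra.
split; exists c; split=> //; near=> n.
  have kn : (k < n)%N by near: n; exact: nbhs_infty_gt.
  have n0 : (0 < n)%N by exact: leq_ltn_trans kn.
  rewrite Pr_D// !lee_fin; apply/andP; split; first by near: n.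
  have h : Prends (sigma k * n%:R) (@evDm b n k) <= 1 - u by near: n.
  by apply: le_trans h _; move: c2 u0; lra.
have kn : (k < n)%N by near: n; exact: nbhs_infty_gt.
have n0 : (0 < n)%N by exact: leq_ltn_trans kn.
have l0 : 0 <= sigma k * n%:R by rewrite mulr_ge0.
rewrite Pr_C// !lee_fin; apply/andP; split.
  have h : c <= Prends (sigma k * n%:R) (@evDm b n k) by near: n.
  by apply: le_trans h _; apply: le_Prends => // m; apply: evDC => //; exact: ltnW.
have h : Prends (sigma k * n%:R) (@evDm b n k) <= 1 - u by near: n.
have h' : C * (expR (- (sigma k * d * n%:R)) * expR (sigma k * (n%:R * err R b k n))) < u / 2
  by near: n.
apply: le_trans (hC _ _ (lexx _) kn) _.
by move: h h' c2; lra.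
Unshelve. all: by end_near. Qed.

End Final.

Unset Implicit Arguments.

Theorem theorem7p5 (R : realType) (b : nat) (hb : (2 <= b)%N) :
  exists sigma : nat -> R,
    (forall k, sigma k < sigma k.+1) /\
    (sigma k @[k --> \oo] --> sigma_crit R b) /\
    (forall (k : nat) (s : R), 0 <= s ->
       (s < sigma k ->
          whp s (fun n => evC b n k) /\ whp s (fun n => evD b n k)) /\
       (sigma k < s ->
          whp s (fun n => ~` evC b n k) /\ whp s (fun n => ~` evD b n k))) /\
    (forall s : R, 0 <= s ->
       (s < sigma_crit R b -> whp s (fun n => ~` ev_connected b n)) /\
       (sigma_crit R b < s -> whp s (fun n => ev_connected b n))) /\
    (forall k : nat,
       bounded_away (sigma k) (fun n => evD b n k) /\
       bounded_away (sigma k) (fun n => evC b n k)).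
Proof.
exists (sigma R b); split; first exact: sigma_lt.
split; first exact: sigma_cvg.
split.
  move=> k s s0; split; first exact: whp_low.
  exact: whp_high.
split.
  move=> s s0; split; first exact: whp_disconnected.
  exact: whp_connected.
exact: bounded_away_sigma.
Qed.
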